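(* Let $n\ge 1$ be an integer, $1<p<\infty$ and let $w$ be a parabolic $A_p$ weight on $\mathbb{R}^{n+1}$. Then there exist constants $\delta>0$ and $c>0$, depending only on $n$, $p$ and $[w]_p$, such that with $$k=\frac{n+2}{n+1}+\delta>1$$ the following holds for every $r>0$. If $u\in L^1((-r^2,r^2), W^1_1(K_r))$ with $Du\in L^p_w(Q_r,\mathbb{R}^n)$ is a distributional solution to $u_t=\mathrm{div}\,G$ in $Q_r$, where $G\in L^p_w(Q_r,\mathbb{R}^n)$, then $u\in L^{pk}_w(Q_r)$ and $$\left( \frac{1}{w(Q_r)}\int_{Q_r}|u-(u)_{Q_r}|^{pk}\,w\,dz\right)^{\frac{1}{pk}} \le c\,r\left(\frac{1}{w(Q_r)}\int_{Q_r}\big[|Du|+|G|\big]^p\,w\, dz\right)^{\frac{1}{p}}.$$ Moreover, the same statement holds true if the $n$-dimensional cube $K_r$ and the parabolic cube $Q_r$ are replaced throughout by the $n$-dimensional ball $B_r$ and the parabolic cylinder $C_r$, respectively.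
   Context: Points of $\mathbb{R}^{n+1}=\mathbb{R}^n\times\mathbb{R}$ are written $z=(x,t)$, $dz=dx\,dt$. For $r>0$ and $z=(x,t)$: $K_r(x)=\{y\in\mathbb{R}^n:|x_i-y_i|<r,\ i=1,\dots,n\}$ and $B_r(x)=\{y\in\mathbb{R}^n:|x-y|<r\}$ (Euclidean norm); the parabolic cube is $Q_r(z)=K_r(x)\times(t-r^2,t+r^2)$ and the parabolic cylinder is $C_r(z)=B_r(x)\times(t-r^2,t+r^2)$. When the center is the origin it is omitted: $K_r,B_r,Q_r,C_r$. $Du=D_xu$ is the spatial gradient and $\mathrm{div}=\mathrm{div}_x$ the spatial divergence. $(g)_U=\frac1{|U|}\int_U g\,dz$. A weight $w$ is a nonnegative locally integrable function on $\mathbb{R}^{n+1}$. For $1<p<\infty$ it is a parabolic $A_p$ weight ($w\in A_p$) if $$[w]_p:=\sup_Q\Big(\frac1{|Q|}\int_Q w\,dz\Big)\Big(\frac1{|Q|}\int_Q w^{-\frac1{p-1}}\,dz\Big)^{p-1}<\infty,$$ the supremum over all parabolic cubes $Q=Q_s(z)\subset\mathbb{R}^{n+1}$; both averages are finite, so $w>0$ a.e. Write $w(E)=\int_E w\,dz$. $L^p_w(U)$ is the space of measurable functions $f$ on $U$ with $\int_U|f|^pw\,dz<\infty$; $L^p_w(U,\mathbb{R}^n)$ is the $\mathbb{R}^n$-valued version. For an open set $\Omega\subset\mathbb{R}^n$ and an interval $I$, $u\in L^1(I,W^1_1(\Omega))$ means that $u(\cdot,t)\in W^1_1(\Omega)$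 (i.e. $u(\cdot,t)$ and its weak gradient lie in $L^1(\Omega)$) for a.e. $t\in I$, and $u,Du\in L^1(\Omega\times I)$. Such a $u$ is a distributional solution of $u_t=\mathrm{div}\,G$ in $\Omega\times I$ (with $G\in L^1(\Omega\times I,\mathbb{R}^n)$) if $\int_{\Omega\times I}u\,\varphi_t\,dz=\int_{\Omega\times I}G\cdot D_x\varphi\,dz$ for all $\varphi\in C_0^\infty(\Omega\times I)$. *)

(* Defs.v *)
From HB Require Import structures.
From mathcomp Require Import all_boot all_order all_algebra.
From mathcomp Require Import all_classical all_reals all_analysis.

Set Implicit Arguments.
Unset Strict Implicit.
Unset Printing Implicit Defensive.

Import Order.TTheory GRing.Theory Num.Theory.
Import numFieldNormedType.Exports.

Local Open Scope classical_set_scope.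
Local Open Scope ring_scope.

(* 'rV[R]_n gets the sigma-algebra generated by the coordinates, i.e. the
   Borel sets, exactly as the library does for n.-tuple. *)
Definition measure_rV_display : measure_display -> measure_display.
Proof. exact. Qed.

Section measurable_rV.
Context {R : realType} {n : nat}.

Let coord : 'I_n -> 'rV[R]_n -> R := fun i x => x ord0 i.

Let rV_set0 : g_sigma_preimage coord set0.
Proof. exact: sigma_algebra0. Qed.

Let rV_setC A : g_sigma_preimage coord A -> g_sigma_preimage coord (~` A).
Proof. exact: sigma_algebraC. Qed.

Let rV_bigcup (F : _^nat) : (forall i, g_sigma_preimage coord (F i)) ->
  g_sigma_preimage coord (\bigcup_i (F i)).
Proof. exact: sigma_algebra_bigcup. Qed.

HB.instance Definition _ :=
  @isMeasurable.Build (measure_rV_display default_measure_display)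
    'rV[R]_n (g_sigma_preimage coord) rV_set0 rV_setC rV_bigcup.

Lemma measurable_coord (i : 'I_n) :
  measurable_fun [set: 'rV[R]_n] (fun x : 'rV[R]_n => x ord0 i).
Proof.
move=> _ Y mY; rewrite setTI; apply: sub_sigma_algebra => /=.
rewrite -bigcup_seq/=; exists i => /=; first by rewrite mem_index_enum.
by exists Y => //; rewrite setTI.
Qed.

Lemma measurable_fun_rV d (T : measurableType d) (f : T -> 'rV[R]_n) :
  (forall i, measurable_fun [set: T] (fun x => f x ord0 i)) ->
  measurable_fun [set: T] f.
Proof.
move=> mf; rewrite /measurable_fun => _ Y mY; rewrite setTI.
suff /(_ Y mY) : g_sigma_preimage coord `<=`
    [set A | measurable (f @^-1` A)] by [].
apply: smallest_sub.
  split=> /=.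
  - by rewrite preimage_set0; exact: measurable0.
  - by move=> A mA; rewrite setTD preimage_setC; exact: measurableC.
  - move=> F mF; rewrite preimage_bigcup; exact: bigcup_measurable.
move=> A; rewrite -bigcup_seq => -[i _ [B mB <-]] /=.
by rewrite setTI -[X in measurable X]setTI; exact: mf.
Qed.

End measurable_rV.

Section consrV.
Context {R : realType} {n : nat}.

Definition cons_rV (z : measurableTypeR R * 'rV[R]_n) : 'rV[R]_n.+1 :=
  row_mx (const_mx (z.1 : R)) z.2 : 'rV[R]_(1 + n).

Definition uncons_rV (x : 'rV[R]_n.+1) : measurableTypeR R * 'rV[R]_n :=
  (x ord0 ord0, \row_j x ord0 (lift ord0 j)).

Lemma cons_rVE (z : measurableTypeR R * 'rV[R]_n) (i : 'I_n.+1) :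
  cons_rV z ord0 i =
  if unlift ord0 i is Some j then z.2 ord0 j else z.1.
Proof.
case: unliftP => [j ->|->].
  by rewrite (_ : lift ord0 j = rshift 1 j) ?[LHS]row_mxEr//; apply/val_inj.
rewrite (_ : ord0 = lshift n (@ord0 0) :> 'I_(1 + n)); last exact/val_inj.
by rewrite [LHS]row_mxEl mxE.
Qed.

Lemma measurable_cons_rV : measurable_fun [set: _] cons_rV.
Proof.
apply: measurable_fun_rV => i.
under eq_fun do rewrite cons_rVE.
case: unliftP => [j _|_].
  exact: (measurableT_comp (measurable_coord j) measurable_snd).
exact: measurable_fst.
Qed.

Lemma measurable_uncons_rV : measurable_fun [set: _] uncons_rV.
Proof.
apply: measurable_fun_pair => /=; first exact: measurable_coord.
apply: measurable_fun_rV => i.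
by under eq_fun do rewrite mxE; exact: measurable_coord.
Qed.

Lemma cons_rVK : cancel cons_rV uncons_rV.
Proof.
move=> z; rewrite /uncons_rV cons_rVE unlift_none /=.
rewrite [RHS]surjective_pairing; congr pair.
by apply/rowP => j; rewrite mxE cons_rVE liftK.
Qed.

Variable mu : {sigma_finite_measure set 'rV[R]_n -> \bar R}.

Definition lebesgue_cons : set 'rV[R]_n.+1 -> \bar R :=
  pushforward (lebesgue_measure \x mu)%E cons_rV.

Let pf : {measure set 'rV[R]_n.+1 -> \bar R} :=
  measure_function_pushforward__canonical__measure_function_Measure
    (lebesgue_measure \x mu)%E measurable_cons_rV.

Let lebesgue_cons0 : lebesgue_cons set0 = 0%E.
Proof. exact: (measure0 pf). Qed.

Let lebesgue_cons_ge0 A : (0 <= lebesgue_cons A)%E.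
Proof. exact: (measure_ge0 pf). Qed.

Let lebesgue_cons_sigma_additive : semi_sigma_additive lebesgue_cons.
Proof. exact: (@measure_semi_sigma_additive _ _ _ pf). Qed.

HB.instance Definition _ := isMeasure.Build _ _ _ lebesgue_cons
  lebesgue_cons0 lebesgue_cons_ge0 lebesgue_cons_sigma_additive.

Let lebesgue_cons_sigma_finite : sigma_finite setT lebesgue_cons.
Proof.
have /sigma_finiteP[F [FT ndF mF]] := sigma_finiteT (@lebesgue_measure R).
have /sigma_finiteP[G [GT ndG mG]] := sigma_finiteT mu.
exists (fun k => uncons_rV @^-1` (F k `*` G k)).
  apply/esym; rewrite -preimage_bigcup -subTset => x _.
  have [k _ Fk] : (\bigcup_k F k) (uncons_rV x).1 by rewrite -FT.
  have [l _ Gl] : (\bigcup_k G k) (uncons_rV x).2 by rewrite -GT.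
  exists (maxn k l) => //; split.
    by move: Fk; exact/subsetPset/ndF/leq_maxl.
  by move: Gl; exact/subsetPset/ndG/leq_maxr.
move=> k; have [mFk Fkoo] := mF k; have [mGk Gkoo] := mG k; split.
  rewrite -[X in measurable X]setTI; apply: measurable_uncons_rV => //.
  exact: measurableX.
rewrite /lebesgue_cons /pushforward -comp_preimage.
rewrite (_ : uncons_rV \o cons_rV = id) ?preimage_id; last first.
  by apply/funext => z /=; rewrite cons_rVK.
by rewrite product_measure1E// lte_mul_pinfty// ge0_fin_numE.
Qed.

HB.instance Definition _ := Measure_isSigmaFinite.Build _ _ _ lebesgue_cons
  lebesgue_cons_sigma_finite.

End consrV.

(* Lebesgue measure on R^n: the image of the n-fold product of lebesgue_measure
   under concatenation of coordinates; see lebesgue_rV_box. *)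
Fixpoint lebesgue_rV (R : realType) (n : nat) :
    {sigma_finite_measure set 'rV[R]_n -> \bar R} :=
  match n with
  | 0 => \d_(0 : 'rV[R]_0)
  | m.+1 => lebesgue_cons (lebesgue_rV R m)
  end.

Lemma lebesgue_rV_box (R : realType) (n : nat) (A : 'I_n -> set R) :
  (forall i, measurable (A i)) ->
  lebesgue_rV R n [set x | forall i, A i (x ord0 i)] =
  (\prod_(i < n) lebesgue_measure (A i))%E.
Proof.
elim: n A => [|n IHn] A mA.
  by rewrite big_ord0 /= diracE mem_set// => -[].
rewrite big_ord_recl -IHn// -product_measure1E//=.
  rewrite /lebesgue_cons /pushforward; congr product_measure1.
  apply/seteqP; split => -[a x] /=.
    move=> Ax; split=> [|i] /=; first by have := Ax ord0; rewrite cons_rVE unlift_none.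
    by have := Ax (lift ord0 i); rewrite cons_rVE liftK.
  move=> [/= A0 Ax] i; rewrite cons_rVE.
  by case: unliftP => [j ->|->] //=; exact: Ax.
- exact: mA.
- rewrite -[X in measurable X]/[set x : 'rV[R]_n |
      forall i, A (lift ord0 i) (x ord0 i)].
  rewrite (_ : mkset _ = \bigcap_(i in [set: 'I_n])
      ((fun x : 'rV[R]_n => x ord0 i) @^-1` A (lift ord0 i))).
    apply: fin_bigcap_measurable => // i _.
    by rewrite -[X in measurable X]setTI; exact: measurable_coord.
  by apply/seteqP; split => x /= Ax i; [move=> _|]; exact: Ax.
Qed.

Section parabolic.
Context {R : realType} {n : nat}.
Implicit Types (x y : 'rV[R]_n) (z : 'rV[R]_n * R) (t r : R).

(* measurableTypeR R is the alias of R on which lebesgue_measure lives. *)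
Definition spacetime_measure :
    {measure set ('rV[R]_n * measurableTypeR R)%type -> \bar R} :=
  (lebesgue_rV R n \x lebesgue_measure)%E.

(* The library norm on 'rV[R]_n is the sup norm, hence a Euclidean one. *)
Definition enorm x : R := Num.sqrt (\sum_(i < n) x ord0 i ^+ 2).

Definition dotv x y : R := \sum_(i < n) x ord0 i * y ord0 i.

Definition cube r x : set 'rV[R]_n :=
  [set y | forall i, `|x ord0 i - y ord0 i| < r].

Definition eball r x : set 'rV[R]_n := [set y | enorm (x - y) < r].

Definition time_itv r t : set R := `]t - r ^+ 2, t + r ^+ 2[.

Definition pcube r z : set ('rV[R]_n * R)%type := cube r z.1 `*` time_itv r z.2.

Definition pcylinder r z : set ('rV[R]_n * R)%type := eball r z.1 `*` time_itv r z.2.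

Local Notation mu := spacetime_measure.
Implicit Types (U Q : set ('rV[R]_n * R)%type) (f w u : 'rV[R]_n * R -> R).
Implicit Types (G : 'rV[R]_n * R -> 'rV[R]_n).

Definition mean U f : R := (fine (mu U))^-1 * \int[mu]_(z in U) f z.

Definition emean U (f : 'rV[R]_n * R -> \bar R) : \bar R :=
  (((fine (mu U))^-1)%:E * \int[mu]_(z in U) f z)%E.

(* Integrability on compacts needs no absolute value since w is nonnegative. *)
Definition weight w : Prop :=
  [/\ forall z, 0 <= w z, measurable_fun setT w &
      forall K : set ('rV[R]_n * R)%type, compact K ->
        (\int[mu]_(z in K) (w z)%:E < +oo)%E].

(* w^(-1/(p-1)): the library has 0 `^ a = 0 for a < 0, so the value +oo at the
   zeros of w has to be put in by hand. *)
Definition dual_weight (p : R) w z : \bar R :=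
  if w z == 0 then +oo%E else (w z `^ (- (p - 1)^-1))%:E.

Definition Ap_const (p : R) w : \bar R :=
  ereal_sup [set a | exists (z : 'rV[R]_n * R) (s : R), 0 < s /\
    a = (emean (pcube s z) (EFin \o w) *
         emean (pcube s z) (dual_weight p w) `^ (p - 1))%E].

(* The middle clause is not redundant: 0 * +oo = 0 in \bar R, so the third one
   alone would hold for w = 0. *)
Definition Ap_weight (p : R) w : Prop :=
  [/\ weight w,
      forall (z : 'rV[R]_n * R) (s : R), 0 < s ->
        (emean (pcube s z) (EFin \o w) < +oo /\
         emean (pcube s z) (dual_weight p w) < +oo)%E &
      (Ap_const p w < +oo)%E].

Definition wmeasure w U : \bar R := (\int[mu]_(z in U) (w z)%:E)%E.

(* (1 / w(U)) \int_U f w dz, in \bar R. *)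
Definition wmean w U f : \bar R :=
  (((fine (wmeasure w U))^-1)%:E * \int[mu]_(z in U) (f z * w z)%:E)%E.

Definition Lpw (p : R) w U f : Prop :=
  measurable_fun U f /\
  (\int[mu]_(z in U) (`|f z| `^ p * w z)%:E < +oo)%E.

Definition Lpw_vec (p : R) w U G : Prop :=
  measurable_fun U G /\
  (\int[mu]_(z in U) (enorm (G z) `^ p * w z)%:E < +oo)%E.

End parabolic.

Definition iter_derive (R : realType) (V : normedModType R) (f : V -> R)
  (vs : seq V) : V -> R := foldr (fun v (g : V -> R) => 'D_v g) f vs.

(* In finite dimension C^oo amounts to the existence and continuity of all
   iterated directional derivatives. *)
Definition smooth (R : realType) (V : normedModType R) (f : V -> R) : Prop :=
  forall vs, continuous (iter_derive f vs) /\
    forall v x, derivable (iter_derive f vs) x v.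

Definition test_function (R : realType) (V : normedModType R) (U : set V)
    (f : V -> R) : Prop :=
  [/\ smooth f, compact (closure [set x | f x != 0]) &
      closure [set x | f x != 0] `<=` U].

Section sobolev.
Context {R : realType} {n : nat}.
Implicit Types (Omega : set 'rV[R]_n) (I : set R).
Local Notation mu := (@spacetime_measure R n).
Local Notation leb := (lebesgue_rV R n).

Definition unitv (i : 'I_n) : 'rV[R]_n := delta_mx ord0 i.

Definition weak_gradient Omega (v : 'rV[R]_n -> R)
    (g : 'rV[R]_n -> 'rV[R]_n) : Prop :=
  forall phi : 'rV[R]_n -> R, test_function Omega phi ->
  forall i, \int[leb]_(x in Omega) (v x * 'D_(unitv i) phi x) =
            - \int[leb]_(x in Omega) (g x ord0 i * phi x).

Definition W11 Omega (v : 'rV[R]_n -> R) (g : 'rV[R]_n -> 'rV[R]_n) : Prop :=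
  [/\ leb.-integrable Omega (EFin \o v),
      forall i, leb.-integrable Omega (fun x => (g x ord0 i)%:E) &
      weak_gradient Omega v g].

Definition L1_vec (U : set ('rV[R]_n * R)%type)
    (G : 'rV[R]_n * R -> 'rV[R]_n) : Prop :=
  forall i, mu.-integrable U (fun z => (G z ord0 i)%:E).

(* u \in L^1(I, W^1_1(Omega)), with Du a jointly measurable version of its
   spatial weak gradient. *)
Definition L1W11 Omega I (u : 'rV[R]_n * R -> R)
    (Du : 'rV[R]_n * R -> 'rV[R]_n) : Prop :=
  [/\ {ae lebesgue_measure, forall t, I t ->
        W11 Omega (fun x => u (x, t)) (fun x => Du (x, t))},
      mu.-integrable (Omega `*` I) (EFin \o u) &
      L1_vec (Omega `*` I) Du].

Definition Dx (phi : 'rV[R]_n * R -> R) (z : 'rV[R]_n * R) : 'rV[R]_n :=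
  \row_i 'D_(unitv i, 0) phi z.

Definition Dt (phi : 'rV[R]_n * R -> R) (z : 'rV[R]_n * R) : R := 'D_(0, 1) phi z.

Definition distributional_solution Omega I (u : 'rV[R]_n * R -> R)
    (G : 'rV[R]_n * R -> 'rV[R]_n) : Prop :=
  L1_vec (Omega `*` I) G /\
  forall phi : 'rV[R]_n * R -> R, test_function (Omega `*` I) phi ->
    \int[mu]_(z in Omega `*` I) (u z * Dt phi z) =
    \int[mu]_(z in Omega `*` I) dotv (G z) (Dx phi z).

End sobolev.

(* Main.v *)
Require Import Defs.
From HB Require Import structures.
From mathcomp Require Import all_boot all_order all_algebra.
From mathcomp Require Import all_classical all_reals all_analysis measurable_realfun.
From mathcomp Require Import ring lra.

Set Implicit Arguments.
Unset Strict Implicit.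
Unset Printing Implicit Defensive.

Import Order.TTheory GRing.Theory Num.Theory.
Import numFieldNormedType.Exports.

Local Open Scope classical_set_scope.
Local Open Scope ring_scope.

(** For [s_j = (1 - e)^j] let [A_j (z)] be the average of [u] against a smooth kernel
    living in a parabolic cube of size [s_j r] near [z] inside the cylinder; the
    kernel of [A_0] does not depend on [z].  The difference of consecutive kernels is
    a spatial divergence plus a time derivative, so the equation gives
    [|A_(j+1) - A_j| (z) <= c (s_j r)^-(n+1) T_j (z)], with [T_j (z)] the integral of
    [|Du| + |G|] over the cube of radius [2 s_j r] around [z].  These bounds are
    summable in [L^1], hence [A_j -> u] almost everywhere.

    The dual weight [w^(-1/(p-1))] is reverse doubling: its mass on [Q_((1-e)R)] is at
    most [q < 1] times that on [Q_R].  Hence [w (Q_((1-e)^j R))] decays slower, by the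
    factor [q^(-(p-1) j)], than the power [(1-e)^((n+2) p j)] given by [A_p] alone.
    With Hoelder's inequality, doubling and Tonelli's theorem, the weighted [L^(pk)]
    norms of [A_(j+1) - A_j] then decay geometrically for some [k > (n+2)/(n+1)]. *)

Local Notation spacetime R n := ('rV[R]_n * measurableTypeR R)%type.

Section smooth_functions.
Context {R : realType}.

Lemma smooth_coind (V : normedModType R) (C : (V -> R) -> Prop) :
  (forall f, C f -> continuous f /\
     forall v, (forall x, derivable f x v) /\ C ('D_v f)) ->
  forall f, C f -> smooth f.
Proof.
move=> HC f Cf vs.
have {Cf} : C (iter_derive f vs).
  elim: vs => [//|v vs IH] /=; exact: ((HC _ IH).2 v).2.
by move=> /HC [cf Df]; split => // v x; exact: (Df v).1.
Qed.

Lemma smooth_continuous (V : normedModType R) (f : V -> R) :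
  smooth f -> continuous f.
Proof. by move=> /(_ [::])[]. Qed.

Lemma smooth_derivable (V : normedModType R) (f : V -> R) v x :
  smooth f -> derivable f x v.
Proof. by move=> /(_ [::])[_ /(_ v x)]. Qed.

Lemma smooth_derive (V : normedModType R) (f : V -> R) v :
  smooth f -> smooth ('D_v f).
Proof.
move=> sf vs; have := sf (rcons vs v).
rewrite /iter_derive foldr_rcons; exact.
Qed.

Lemma smooth_cst (V : normedModType R) (c : R) : smooth (cst c : V -> R).
Proof.
apply: (@smooth_coind V (fun f => exists c, f = cst c)); last by exists c.
move=> _ [{}c ->]; split; first exact: cst_continuous.
move=> v; split=> [x|]; first exact: derivable_cst.
by exists 0; apply/funext => x; rewrite derive_cst.
Qed.

Inductive smooth_alg (V : normedModType R) : (V -> R) -> Prop :=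
| SAbase f : smooth f -> smooth_alg f
| SAadd f g : smooth_alg f -> smooth_alg g -> smooth_alg (fun x => f x + g x)
| SAmul f g : smooth_alg f -> smooth_alg g -> smooth_alg (fun x => f x * g x)
| SAinv f : (forall x, f x != 0) -> smooth_alg f ->
    smooth_alg (fun x => (f x)^-1).

Lemma smooth_alg_smooth (V : normedModType R) (f : V -> R) :
  smooth_alg f -> smooth f.
Proof.
apply: smooth_coind => {}f; elim => {f}.
- move=> f sf; split; first exact: smooth_continuous.
  move=> v; split=> [x|]; first exact: smooth_derivable.
  exact/SAbase/smooth_derive.
- move=> f g sf [cf Df] sg [cg Dg]; split.
    by move=> x; apply: cvgD; [exact: cf|exact: cg].
  move=> v; split=> [x|]; first exact: (@derivableD R V R f g x v ((Df v).1 x) ((Dg v).1 x)).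
  suff -> : 'D_v (fun x => f x + g x) = (fun x => 'D_v f x + 'D_v g x).
    by apply: SAadd; [exact: (Df v).2|exact: (Dg v).2].
  by apply/funext => x; rewrite [LHS](@deriveD R V R f g x v)//; [exact: (Df v).1|exact: (Dg v).1].
- move=> f g sf [cf Df] sg [cg Dg]; split.
    by move=> x; apply: cvgM; [exact: cf|exact: cg].
  move=> v; split=> [x|]; first exact: (@derivableM R V f g x v ((Df v).1 x) ((Dg v).1 x)).
  suff -> : 'D_v (fun x => f x * g x) =
            (fun x => f x * 'D_v g x + g x * 'D_v f x).
    by apply: SAadd; apply: SAmul => //; [exact: (Dg v).2|exact: (Df v).2].
  by apply/funext => x; rewrite [LHS](@deriveM R V f g x v)//; [exact: (Df v).1|exact: (Dg v).1].
- move=> f f0 sf [cf Df]; split.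
    by move=> x; apply: cvgV; [exact: f0|exact: cf].
  move=> v; split=> [x|]; first by apply: derivableV => //; exact: (Df v).1.
  suff -> : 'D_v (fun x => (f x)^-1) =
            (fun x => (-1) * (((f x)^-1 * (f x)^-1) * 'D_v f x)).
    apply: SAmul; first exact/SAbase/smooth_cst.
    by apply: SAmul; [apply: SAmul; exact: SAinv|exact: (Df v).2].
  apply/funext => x; rewrite deriveV//; last exact: (Df v).1.
  by rewrite scaleNr mulN1r -invfM.
Qed.

Lemma smoothD (V : normedModType R) (f g : V -> R) :
  smooth f -> smooth g -> smooth (fun x => f x + g x).
Proof. by move=> sf sg; apply/smooth_alg_smooth/SAadd; exact: SAbase. Qed.

Lemma smoothM (V : normedModType R) (f g : V -> R) :
  smooth f -> smooth g -> smooth (fun x => f x * g x).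
Proof. by move=> sf sg; apply/smooth_alg_smooth/SAmul; exact: SAbase. Qed.

Lemma smoothV (V : normedModType R) (f : V -> R) :
  (forall x, f x != 0) -> smooth f -> smooth (fun x => (f x)^-1).
Proof. by move=> f0 sf; apply/smooth_alg_smooth/SAinv => //; exact: SAbase. Qed.

Lemma smoothB (V : normedModType R) (f g : V -> R) :
  smooth f -> smooth g -> smooth (fun x => f x - g x).
Proof.
move=> sf sg; have := smoothD sf (smoothM (@smooth_cst V (-1)) sg).
by congr smooth; apply/funext => x; rewrite /= mulN1r.
Qed.

Lemma smooth_prod (V : normedModType R) (I : Type) (s : seq I)
    (g : I -> V -> R) :
  (forall i, smooth (g i)) -> smooth (fun x => \prod_(i <- s) g i x).
Proof.
move=> sg; elim: s => [|i s IH].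
  rewrite (_ : (fun _ => _) = cst 1); first exact: smooth_cst.
  by apply/funext => x; rewrite big_nil.
have := smoothM (sg i) IH.
by congr smooth; apply/funext => x; rewrite big_cons.
Qed.

Lemma smooth_comp_affine (V : normedModType R) (g : R -> R) (l : V -> R)
    (k c : R) : linear l -> continuous l -> smooth (g : R^o -> R) ->
  smooth (fun x => g (k * l x + c)).
Proof.
move=> ll cl sg.
apply: (@smooth_coind V (fun f => exists h : R -> R, smooth (h : R^o -> R) /\
   f = (fun x => h (k * l x + c)))); last by exists g.
move=> _ [h [sh ->]].
split.
  move=> x; apply: (@continuous_comp _ _ _ (fun x => k * l x + c) h).
    by apply: cvgD; [apply: cvgMl_tmp; exact: cl|exact: cvg_cst].
  exact: (smooth_continuous sh).
move=> v.
have E a y : k * l (a *: v + y) + c = a *: (k * l v) + (k * l y + c).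
  by rewrite ll /= mulrDr addrA; congr (_ + _ + _); rewrite mulrCA.
split=> [x|].
  have := @smooth_derivable R^o h (k * l v) (k * l x + c) sh.
  rewrite /derivable/=; set F := (F in cvg (F @ _) -> _).
  by rewrite (_ : (fun _ => _) = F)//; apply/funext => a /=; rewrite E.
exists ('D_(k * l v) (h : R^o -> R)); split; first exact: smooth_derive.
apply/funext => x; rewrite /derive/=; set F := (F in _ = lim (F @ _)).
by rewrite (_ : (fun _ => _) = F)//; apply/funext => a /=; rewrite E.
Qed.

Lemma smooth1_coind (C : (R -> R) -> Prop) :
  (forall f, C f -> exists2 g, C g & forall x : R, is_derive x 1 f (g x)) ->
  (forall k f, C f -> C (fun x => k * f x)) ->
  forall f, C f -> smooth (f : R^o -> R).
Proof.
move=> HC HZ; apply: smooth_coind => f Cf.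
have [g Cg dfg] := HC _ Cf.
have dif x : differentiable (f : R -> R) x.
  by apply/derivable1_diffP; exact: (@ex_derive _ _ _ _ _ _ _ (dfg x)).
split; first by move=> x; exact: differentiable_continuous.
move=> v; split=> [x|]; first exact: diff_derivable.
rewrite (_ : 'D_v _ = (fun x => v * g x)); first exact: HZ.
apply/funext => x; rewrite deriveE// -[X in 'd _ _ X]mulr1 linearZ/=.
by rewrite -deriveE// (@derive_val _ _ _ _ _ _ _ (dfg x)).
Qed.

End smooth_functions.

Section bump.
Context {R : realType}.

Let scaleRE (a b : R) : a *: b = a * b. Proof. by []. Qed.

Definition flat (P : {poly R}) (x : R) : R :=
  if 0 < x then P.[x^-1] * expR (- x^-1) else 0.

Lemma flat_bound (P : {poly R}) :
  exists2 K : R, 0 <= K & forall h, h <= 1 -> `|flat P h| <= K * `|h|.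
Proof.
pose d := size P; pose S := \sum_(i < d) `|P`_i|.
have S0 : 0 <= S by exact: sumr_ge0.
exists (S * d.+1`!%:R); first by rewrite mulr_ge0.
move=> h h1; rewrite /flat; case: ifPn => [h0|_]; last by rewrite normr0 mulr_ge0// mulr_ge0.
set y := h^-1; have y1 : 1 <= y by rewrite invf_ge1.
have y0 : 0 < y by rewrite invr_gt0.
rewrite normrM (ger0_norm (expR_ge0 _)) expRN (gtr0_norm h0).
rewrite ler_pdivrMr ?expR_gt0//.
have : `|P.[y]| <= S * y ^+ d.
  rewrite horner_coef (le_trans (ler_norm_sum _ _ _))// /S mulr_suml.
  apply: ler_sum => i _; rewrite normrM ler_wpM2l// normrX gtr0_norm//.
  by rewrite ler_weXn2l// ltnW.
move/le_trans; apply; rewrite -!mulrA ler_wpM2l//.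
have := @expR_ge1Dxn R y d (ltW y0).
move=> /(le_trans _) => /(_ (y ^+ d.+1 / d.+1`!%:R)).
rewrite lerDr ler01 => /(_ erefl).
rewrite ler_pdivrMr ?ltr0n ?fact_gt0// => H.
rewrite mulrCA -[X in X <= _](@mulKf _ y) ?gt_eqF// -exprS /y invrK.
by rewrite ler_wpM2l ?(ltW h0)// [leRHS]mulrC.
Qed.

Lemma is_derive_flat (P : {poly R}) (x : R) :
  is_derive x 1 (flat P) (flat ('X^2 * (P - P^`())) x).
Proof.
have [x0|x0|->] := ltgtP x 0.
- rewrite [flat _ x]/flat ltNge (ltW x0)/=.
  apply: (near_eq_is_derive _ (is_derive_cst 0 x 1)).
  near=> y; rewrite /flat ltNge ltW//.
  by near: y; exact: lt_nbhsl.
- rewrite [flat _ x]/flat x0.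
  have dP : is_derive (x^-1) 1 (horner P) (P^`()).[x^-1].
    apply: DeriveDef; first exact: derivable_horner.
    by rewrite -derive1E -derivE.
  have dV : is_derive x 1 (fun y : R => y^-1) (- x ^- 2).
    by apply: is_derive_eq; [apply: is_deriveV; rewrite gt_eqF|rewrite scaleRE mulr1].
  have d1 := is_derive1_comp dP dV.
  have dN : is_derive x 1 (fun y : R => - y^-1) (x ^- 2).
    by apply: is_derive_eq; rewrite opprK.
  have d2 := is_derive1_comp (is_derive_expR (- x^-1) : is_derive ((fun y : R => - y^-1) x) 1 expR _) dN.
  have nr : \near x, ((horner P \o GRing.inv) * (expR \o (fun y : R => - y^-1))) x
      = flat P x.
    near=> y; rewrite /flat ifT//.
    by near: y; exact: lt_nbhsr.
  apply: (is_derive_eq (near_eq_is_derive nr (is_deriveM d1 d2))).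
  rewrite hornerM hornerXn hornerD hornerN /= !scaleRE exprVn.
  ring.
- have -> : flat ('X^2 * (P - P^`())) 0 = 0 by rewrite /flat ltxx.
  have [K K0 HK] := flat_bound ('X * P).
  have cv : (fun h : R => h^-1 *: ((flat P \o shift 0) (h *: 1) - flat P 0)) @ 0^'
       --> (0 : R).
    apply/cvgrPdist_le => /= e e0.
    near=> h.
    rewrite sub0r normrN scaler1 addr0 {2}/flat ltxx subr0.
    have hn0 : h != 0 by near: h; exact: nbhs_dnbhs_neq.
    have hsm : `|h| <= Num.min 1 (e / (K + 1)).
      near: h; apply: nbhs_dnbhs.
      have m0 : 0 < Num.min 1 (e / (K + 1)) by rewrite lt_min ltr01 divr_gt0// ltr_wpDl.
      by have := @nbhs0_le R R _ m0.
    move: hsm; rewrite le_min => /andP[h1 he].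
    have -> : h^-1 *: flat P h = flat ('X * P) h.
      rewrite /flat; case: ifP => _; last by rewrite scaler0.
      by rewrite hornerM hornerX scaleRE mulrA.
    rewrite (le_trans (HK _ _))//; first exact: le_trans (ler_norm _) h1.
    rewrite (@le_trans _ _ (K * (e / (K + 1))))// ?ler_wpM2l//.
    rewrite mulrCA ler_piMr ?(ltW e0)// ler_pdivrMr ?ltr_wpDl// mul1r lerDl//.
  by apply: DeriveDef; [apply/cvg_ex; exists 0|exact: cvg_lim cv].
Unshelve. all: by end_near. Qed.

Lemma smooth_flat (P : {poly R}) : smooth (flat P : R^o -> R).
Proof.
apply: (@smooth1_coind R (fun f => exists Q, f = flat Q)); last by exists P.
  move=> _ [Q ->]; eexists; last exact: is_derive_flat.
  by eexists; reflexivity.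
move=> k _ [Q ->]; exists (k *: Q); apply/funext => x; rewrite /flat.
by case: ifP => _; rewrite ?mulr0// hornerZ mulrA.
Qed.

Lemma flat1_gt0 (x : R) : 0 < x -> 0 < flat 1 x.
Proof. by move=> x0; rewrite /flat x0 hornerC mul1r expR_gt0. Qed.

Lemma flat1_ge0 (x : R) : 0 <= flat 1 x.
Proof. by rewrite /flat; case: ifP => // _; rewrite hornerC mul1r expR_ge0. Qed.

Definition step_den (x : R) : R := flat 1 (1 + x) + flat 1 (1 - x).

Lemma step_den_gt0 (x : R) : 0 < step_den x.
Proof.
rewrite /step_den; have [x1|x1] := ltP 0 (1 + x).
  by rewrite ltr_pwDl ?flat1_gt0// flat1_ge0.
by rewrite ltr_wpDl ?flat1_ge0// flat1_gt0//; lra.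
Qed.

Definition step (x : R) : R := flat 1 (1 + x) / step_den x.

Definition bump1 (x : R) : R := 'D_1 (step : R^o -> R) x.

Lemma smooth_flat_affine (k c : R) : smooth ((fun x => flat 1 (k * x + c)) : R^o -> R).
Proof.
apply: (@smooth_comp_affine R R^o (flat 1) id); last exact: smooth_flat.
- by move=> a x y.
- by move=> x; exact: cvg_id.
Qed.

Lemma smooth_step : smooth (step : R^o -> R).
Proof.
have E1 : (fun x => flat 1 (1 + x)) = (fun x => flat 1 (1 * x + 1)) :> (R -> R).
  by apply/funext => x; rewrite mul1r addrC.
have E2 : (fun x => flat 1 (1 - x)) = (fun x => flat 1 (-1 * x + 1)) :> (R -> R).
  by apply/funext => x; rewrite mulN1r addrC.
apply: (@smoothM R R^o (fun x => flat 1 (1 + x)) (fun x => (step_den x)^-1)).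
  by rewrite E1; exact: smooth_flat_affine.
apply: (@smoothV R R^o step_den) => [x|]; first by rewrite gt_eqF// step_den_gt0.
rewrite /step_den; apply: (@smoothD R R^o (fun x => flat 1 (1 + x)) (fun x => flat 1 (1 - x))).
  by rewrite E1; exact: smooth_flat_affine.
by rewrite E2; exact: smooth_flat_affine.
Qed.

Lemma smooth_bump : smooth (bump1 : R^o -> R).
Proof. exact/smooth_derive/smooth_step. Qed.

Lemma step_le (x : R) : x <= -1 -> step x = 0.
Proof.
move=> x1; rewrite /step [X in X / _](_ : _ = 0) ?mul0r//.
by rewrite /flat ifF//; apply/negbTE; rewrite -leNgt; lra.
Qed.

Lemma step_ge (x : R) : 1 <= x -> step x = 1.
Proof.
move=> x1; rewrite /step /step_den (_ : flat 1 (1 - x) = 0).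
  by rewrite addr0 divff// gt_eqF// flat1_gt0//; lra.
by rewrite /flat ifF//; apply/negbTE; rewrite -leNgt; lra.
Qed.

Lemma step_itv (x : R) : 0 <= step x <= 1.
Proof.
rewrite /step divr_ge0 ?flat1_ge0 ?(ltW (step_den_gt0 _))//=.
by rewrite ler_pdivrMr ?step_den_gt0// mul1r lerDl flat1_ge0.
Qed.

Lemma is_derive_step (x : R) : is_derive x 1 step (bump1 x).
Proof. apply: DeriveDef => //; exact: (@smooth_derivable R R^o step 1 x smooth_step). Qed.

Lemma bump_ge0 (x : R) : 0 <= bump1 x.
Proof.
have dp : is_derive x 1 (fun x : R => 1 + x) (0 + 1) :=
  is_deriveD (is_derive_cst (1 : R) x 1) (is_derive_id x 1).
have dm : is_derive x 1 (fun x : R => 1 - x) (0 - 1) :=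
  is_deriveB (is_derive_cst (1 : R) x 1) (is_derive_id x 1).
have d1 := is_derive1_comp
  (is_derive_flat 1 (1 + x) : is_derive ((fun x : R => 1 + x) x) 1 _ _) dp.
have d2 := is_derive1_comp
  (is_derive_flat 1 (1 - x) : is_derive ((fun x : R => 1 - x) x) 1 _ _) dm.
have F0 y : 0 <= flat ('X^2 * (1 - 1^`())) y.
  have -> : (1 : {poly R})^`() = 0 by rewrite -(polyC1 R) derivC.
  rewrite subr0 mulr1 /flat; case: ifP => // _.
  by rewrite hornerXn mulr_ge0 ?expR_ge0 ?sqr_ge0.
have d3 := is_deriveD d1 d2.
have dn0 : step_den x != 0 by rewrite gt_eqF// step_den_gt0.
have d4 : is_derive x 1 (fun y => (step_den y)^-1) _ := is_deriveV dn0 d3.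
have := is_deriveM d1 d4.
move=> /(@derive_val _ _ _ _ _ _ _); rewrite /bump1.
move=> ->.
rewrite /= !scaleRE.
move: (F0 (1 + x)) (F0 (1 - x)); set a' := flat _ (1 + x); set b' := flat _ (1 - x).
have := flat1_ge0 (1 + x); have := flat1_ge0 (1 - x).
have := step_den_gt0 x; rewrite /step_den.
set a := flat 1 (1 + x); set b := flat 1 (1 - x) => D0 b0 a0 a'0 b'0.
have -> : a * (- (a + b) ^- 2 * (a' * (0 + 1) + b' * (0 - 1))) + (a + b)^-1 * (a' * (0 + 1)) =
  (a * b' + a' * b) * (a + b) ^- 2.
  by field; rewrite gt_eqF.
by rewrite mulr_ge0// ?addr_ge0 ?mulr_ge0// invr_ge0 sqr_ge0.
Qed.

Lemma step_near_cst (x : R) : 1 < `|x| -> exists c, \near x, cst c x = step x.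
Proof.
move=> x1; have [x0|x0] := leP 0 x.
  exists 1; near=> y; rewrite step_ge//; apply: ltW.
  by near: y; apply: lt_nbhsr; rewrite -(ger0_norm x0).
exists 0; near=> y; rewrite step_le//; apply: ltW.
near: y; apply: lt_nbhsl.
by rewrite ltrNr -(ltr0_norm x0).
Unshelve. all: by end_near. Qed.

Lemma bump_out (x : R) : 1 < `|x| -> bump1 x = 0.
Proof.
move=> /step_near_cst[c xc].
by rewrite /bump1 -(near_eq_derive _ xc) derive_cst.
Qed.

Lemma derive_bump_out (x : R) : 1 < `|x| -> 'D_1 (bump1 : R^o -> R) x = 0.
Proof.
move=> x1; have xc : \near x, cst 0 x = bump1 x.
  have o : open [set y : R | 1 < `|y|].
    apply: (@open_comp R R (fun y : R => `|y|) [set z | 1 < z]); last exact: open_gt.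
    by move=> y _; exact: norm_continuous.
  have := open_nbhs_nbhs (conj o x1 : open_nbhs x _).
  by apply: filterS => y /= y1; rewrite bump_out.
by rewrite -(near_eq_derive _ xc) derive_cst.
Qed.

Lemma bounded_out (g : R -> R) : continuous g ->
  (forall x, 1 < `|x| -> g x = 0) ->
  exists2 M : R, 1 <= M & forall x, `|g x| <= M.
Proof.
move=> cg gout.
have c : {within `[(-1 : R), 1], continuous (fun x => `|g x|)}.
  apply: continuous_subspaceT => x.
  by apply: continuous_comp; [exact: cg|exact: norm_continuous].
have [|y _ Hy] := EVT_max _ c; first lra.
exists (Num.max 1 `|g y|); first by rewrite le_max lexx.
move=> x; have [x1|x1] := leP `|x| 1.
  by rewrite le_max Hy ?orbT// in_itv/= -ler_norml.
by rewrite gout// normr0 le_max ler01.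
Qed.

Lemma bump_bounded : exists2 M : R, 1 <= M &
  forall x, bump1 x <= M /\ `|'D_1 (bump1 : R^o -> R) x| <= M.
Proof.
have [M M1 bM] := bounded_out (smooth_continuous smooth_bump) bump_out.
have [M' M1' dM] := bounded_out (smooth_continuous (@smooth_derive R R^o bump1 1 smooth_bump))
  derive_bump_out.
exists (M + M') => [|x]; first lra.
split; first by have := ler_norm (bump1 x); have := bM x; lra.
by have := dM x; rewrite /=; lra.
Qed.

End bump.

#[local] Opaque smooth.

Section box_test_functions.
Context {R : realType}.

Lemma test_function_sub (V : normedModType R) (U K : set V) (f : V -> R) :
  smooth f -> compact K -> K `<=` U -> (forall x, f x != 0 -> K x) ->
  test_function U f.
Proof.
move=> sf cK KU fK.
have clK : closure [set x | f x != 0] `<=` K.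
  rewrite closureE; apply: smallest_sub; last by move=> x; exact: fK.
  by apply: compact_closed => //; exact: norm_hausdorff.
split=> //; last exact: subset_trans clK KU.
by apply: subclosed_compact cK clK; exact: closed_closure.
Qed.

Lemma interval_compact (c d : R) : compact [set y : R | `|y - c| <= d].
Proof.
rewrite (_ : mkset _ = `[c - d, c + d]%classic); first exact: segment_compact.
by apply/seteqP; split => y; rewrite /= in_itv/= ler_distl.
Qed.

Lemma box_compact n (c : 'I_n -> R) (d : R) :
  compact [set y : 'rV[R]_n | forall i, `|y ord0 i - c i| <= d].
Proof.
apply: (@rV_compact R n (fun i => [set t | `|t - c i| <= d])) => i.
exact: interval_compact.
Qed.

End box_test_functions.

Section tensor.
Context {R : realType}.

Definition tensor n (g : 'I_n -> R -> R) (x : 'rV[R]_n) : R :=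
  \prod_(l < n) g l (x ord0 l).

Definition tensorD n (g : 'I_n -> R -> R) (i : 'I_n) (x : 'rV[R]_n) : R :=
  tensor (fun l => if l == i then 'D_1 (g l : R^o -> R) else g l) x.

Lemma tensorD1 n (g : 'I_n -> R -> R) i x :
  tensor g x = g i (x ord0 i) * \prod_(l < n | l != i) g l (x ord0 l).
Proof. by rewrite /tensor (bigD1 i). Qed.

Lemma tensorDE n (g : 'I_n -> R -> R) i x :
  tensorD g i x = 'D_1 (g i : R^o -> R) (x ord0 i) *
                  \prod_(l < n | l != i) g l (x ord0 l).
Proof.
rewrite /tensorD (tensorD1 _ i) eqxx; congr (_ * _).
by apply: eq_bigr => l /negbTE ->.
Qed.

Lemma smooth_coord n (g : R -> R) (l : 'I_n) : smooth (g : R^o -> R) ->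
  smooth (fun x : 'rV[R]_n => g (x ord0 l)).
Proof.
move=> sg; have := @smooth_comp_affine R 'rV[R]_n g (fun x => x ord0 l) 1 0.
rewrite (_ : (fun x : 'rV_n => g (1 * _ + 0)) = (fun x => g (x ord0 l))).
  apply=> //; first by move=> a x y; rewrite !mxE.
  exact: coord_continuous.
by apply/funext => x; rewrite mul1r addr0.
Qed.

Lemma smooth_tensor n (g : 'I_n -> R -> R) :
  (forall l, smooth (g l : R^o -> R)) -> smooth (tensor g).
Proof. by move=> sg; apply: smooth_prod => l; exact: smooth_coord. Qed.

Lemma derive_line (V : normedModType R) (F : V -> R) (g : R -> R) (C t : R) (v x : V) :
  smooth (g : R^o -> R) -> (forall h : R, F (h *: v + x) = C * g (h + t)) ->
  'D_v F x = C * 'D_1 (g : R^o -> R) t.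
Proof.
move=> sg HF.
have dg : derivable (g : R^o -> R) t 1 by exact: smooth_derivable.
rewrite -(deriveMr C dg) /derive/=.
set G := (G in _ = lim (G @ _)).
rewrite (_ : (fun _ => _) = G)//; apply/funext => h; rewrite /G /=.
have {2}-> : x = 0 *: v + x by rewrite scale0r add0r.
by rewrite !HF add0r [in RHS]mulrC [g t * C]mulrC [h *: 1]mulr1.
Qed.

Lemma derive_tensor n (g : 'I_n -> R -> R) i (x : 'rV[R]_n) :
  (forall l, smooth (g l : R^o -> R)) ->
  'D_(unitv i) (tensor g) x = tensorD g i x.
Proof.
move=> sg; rewrite tensorDE mulrC; apply: derive_line => // h.
rewrite (tensorD1 _ i) mulrC !mxE !eqxx mulr1; congr (_ * _).
by apply: eq_bigr => l li; rewrite !mxE/= (negbTE li) mulr0 add0r.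
Qed.

Definition tensort n (g : 'I_n -> R -> R) (b : R -> R) (z : 'rV[R]_n * R) : R :=
  tensor g z.1 * b z.2.

Lemma smooth_tensort n (g : 'I_n -> R -> R) (b : R -> R) :
  (forall l, smooth (g l : R^o -> R)) -> smooth (b : R^o -> R) ->
  smooth (tensort g b).
Proof.
move=> sg sb; apply: (@smoothM R _ (fun z => tensor g z.1) (fun z => b z.2)).
  rewrite /tensor; apply: (@smooth_prod R ('rV[R]_n * R)%type _ _ (fun l (z : 'rV[R]_n * R) => g l (z.1 ord0 l))) => l.
  have := @smooth_comp_affine R ('rV[R]_n * R)%type (g l) (fun z => z.1 ord0 l) 1 0.
  rewrite (_ : (fun x : 'rV_n * R => g l (1 * _ + 0)) = (fun z => g l (z.1 ord0 l))).
    apply=> //; first by move=> a x y; rewrite !mxE.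
    move=> z; apply: (@continuous_comp _ _ _ fst (fun y : 'rV[R]_n => y ord0 l)).
      exact: cvg_fst.
    exact: coord_continuous.
  by apply/funext => x; rewrite mul1r addr0.
have := @smooth_comp_affine R ('rV[R]_n * R)%type b snd 1 0.
rewrite (_ : (fun x : 'rV_n * R => b (1 * _ + 0)) = (fun z => b z.2)).
  by apply=> // z; exact: cvg_snd.
by apply/funext => x; rewrite mul1r addr0.
Qed.

Lemma Dt_tensort n (g : 'I_n -> R -> R) (b : R -> R) z :
  smooth (b : R^o -> R) ->
  Dt (tensort g b) z = tensor g z.1 * 'D_1 (b : R^o -> R) z.2.
Proof.
move=> sb; apply: derive_line => // h.
by rewrite /tensort/= scaler0 add0r [h *: 1]mulr1.
Qed.

Lemma Dx_tensort n (g : 'I_n -> R -> R) (b : R -> R) z i :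
  (forall l, smooth (g l : R^o -> R)) ->
  Dx (tensort g b) z ord0 i = tensorD g i z.1 * b z.2.
Proof.
move=> sg; rewrite mxE tensorDE -mulrA [RHS]mulrC.
apply: derive_line => // h.
rewrite /tensort/= scaler0 add0r (tensorD1 _ i) !mxE !eqxx mulr1.
rewrite -mulrA mulrC; congr (_ * _ * _).
by apply: eq_bigr => l li; rewrite !mxE/= (negbTE li) mulr0 add0r.
Qed.

Lemma prod_telescope n (a b : 'I_n -> R) :
  \prod_(l < n) a l - \prod_(l < n) b l =
  \sum_(i < n) \prod_(l < n)
    (if (l < i)%N then a l else if l == i then a l - b l else b l).
Proof.
elim: n a b => [|n IH] a b; first by rewrite !big_ord0 subrr.
rewrite !big_ord_recr/=.
under [X in _ = X + _]eq_bigr => i _.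
  rewrite big_ord_recr/= ltnNge (ltnW (ltn_ord i))/= ifF; last first.
    by apply/negbTE; rewrite -val_eqE/= neq_ltn ltn_ord orbT.
  over.
rewrite -mulr_suml ltnn eqxx.
set L := (X in _ = X * _ + _); have -> : L = \prod_(l < n) a (widen_ord (leqnSn n) l) -
   \prod_(l < n) b (widen_ord (leqnSn n) l).
  rewrite IH; apply: eq_bigr => i _; apply: eq_bigr => l _ /=.
  by rewrite -!val_eqE.
rewrite [X in _ = _ + X * _](_ : _ = \prod_(l < n) a (widen_ord (leqnSn n) l)).
  ring.
by apply: eq_bigr => l _; rewrite /= ltn_ord.
Qed.

End tensor.

Section kernel1d.
Context {R : realType}.
Variable e : R.
Hypothesis e0 : 0 < e.

Definition kpos (s X x y : R) : R := (y - (1 - s) * x) / (e * s * X).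

Definition prim (s X x y : R) : R := step (kpos s X x y).

Definition ker (s X x y : R) : R := (e * s * X)^-1 * bump1 (kpos s X x y).

Let kposE s X x y :
  kpos s X x y = (e * s * X)^-1 * y + - ((1 - s) * x / (e * s * X)).
Proof. by rewrite /kpos mulrBl mulrC. Qed.

Lemma smooth_scaled (g : R -> R) s X x : smooth (g : R^o -> R) ->
  smooth ((fun y => g (kpos s X x y)) : R^o -> R).
Proof.
move=> sg; rewrite (_ : (fun _ => _) =
   (fun y => g ((e * s * X)^-1 * y + - ((1 - s) * x / (e * s * X))))).
  apply: (@smooth_comp_affine R R^o g id) => //.
  by move=> y; exact: cvg_id.
by apply/funext => y; rewrite kposE.
Qed.

Lemma smooth_prim s X x : smooth (prim s X x : R^o -> R).
Proof. exact/smooth_scaled/smooth_step. Qed.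

Lemma smooth_ker s X x : smooth (ker s X x : R^o -> R).
Proof.
apply: (@smoothM R R^o (cst (e * s * X)^-1) (fun y => bump1 (kpos s X x y))).
  exact: smooth_cst.
exact/smooth_scaled/smooth_bump.
Qed.

Lemma derive_scaled (g : R -> R) s X x y : smooth (g : R^o -> R) ->
  'D_1 ((fun y => g (kpos s X x y)) : R^o -> R) y =
  (e * s * X)^-1 * 'D_1 (g : R^o -> R) (kpos s X x y).
Proof.
move=> sg; set k := (e * s * X)^-1; set t := kpos s X x y.
have gd : differentiable (g : R -> R) t.
  by apply/derivable1_diffP; exact: (@smooth_derivable R R^o g 1 t).
have E h : kpos s X x (h *: 1 + y) = h *: k + t.
  by rewrite /t !kposE -/k mulrDr [h *: 1]mulr1 [h *: k]mulrC addrA.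
have -> : 'D_1 ((fun y => g (kpos s X x y)) : R^o -> R) y = 'D_k (g : R^o -> R) t.
  rewrite /derive/=; set G := (G in _ = lim (G @ _)).
  rewrite (_ : (fun _ => _) = G)//; apply/funext => h; rewrite /G /=.
  by rewrite E.
by rewrite !deriveE// -[X in 'd _ _ X]mulr1 linearZ.
Qed.

Lemma derive_prim s X x y : 'D_1 (prim s X x : R^o -> R) y = ker s X x y.
Proof. by rewrite derive_scaled//; exact: smooth_step. Qed.

Lemma derive_ker s X x y : 'D_1 (ker s X x : R^o -> R) y =
  (e * s * X)^-1 ^+ 2 * 'D_1 (bump1 : R^o -> R) (kpos s X x y).
Proof.
rewrite [LHS](deriveMl (e * s * X)^-1 (f := (fun y => bump1 (kpos s X x y)) : R^o -> R)).
  by rewrite derive_scaled ?mulrA//; exact: smooth_bump.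
exact: (@smooth_derivable R R^o _ 1 y (@smooth_scaled bump1 s X x smooth_bump)).
Qed.

Lemma ker_ge0 s X x y : 0 <= s -> 0 <= X -> 0 <= ker s X x y.
Proof. by move=> s0 X0; rewrite mulr_ge0 ?bump_ge0// invr_ge0 !mulr_ge0// ltW. Qed.

Lemma ker_supp s X x y : 0 < s -> 0 < X -> ker s X x y != 0 ->
  `|y - (1 - s) * x| <= e * s * X.
Proof.
move=> s0 X0; apply: contraNT; rewrite -ltNge => H.
rewrite /ker bump_out ?mulr0// /kpos normrM [X in _ * X]gtr0_norm ?invr_gt0 ?mulr_gt0//.
by rewrite ltr_pdivlMr ?mul1r ?mulr_gt0.
Qed.

Lemma prim_lt s X x y : 0 < s -> 0 < X -> e * s * X < y - (1 - s) * x ->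
  prim s X x y = 1.
Proof.
move=> s0 X0 H; rewrite /prim step_ge// /kpos ler_pdivlMr ?mul1r ?mulr_gt0//.
exact: ltW.
Qed.

Lemma prim_gt s X x y : 0 < s -> 0 < X -> y - (1 - s) * x < - (e * s * X) ->
  prim s X x y = 0.
Proof.
move=> s0 X0 H; rewrite /prim step_le// /kpos ler_pdivrMr ?mulr_gt0// mulN1r.
exact: ltW.
Qed.

Lemma prim_itv s X x y : 0 <= prim s X x y <= 1.
Proof. exact: step_itv. Qed.

Lemma ker_supp2 s s' X x y : 0 < s' -> s' <= s -> s - s' <= 2 * e * s ->
  0 < X -> `|x| <= X ->
  ker s' X x y != 0 -> `|y - (1 - s) * x| <= 3 * e * s * X.
Proof.
move=> s'0 s's ss X0 xX /(ker_supp s'0 X0) H.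
have -> : y - (1 - s) * x = (y - (1 - s') * x) + (s - s') * x by ring.
rewrite (le_trans (ler_normD _ _))// normrM [`|s - s'|]ger0_norm ?subr_ge0//.
have -> : 3 * e * s * X = e * s * X + 2 * e * s * X by ring.
apply: lerD; first by apply: (le_trans H); rewrite ler_wpM2r ?(ltW X0)// ler_wpM2l// ltW.
by rewrite ler_pM// subr_ge0.
Qed.

Lemma primB_supp s s' X x y : 0 < s' -> s' <= s -> s - s' <= 2 * e * s ->
  0 < X -> `|x| <= X ->
  prim s' X x y - prim s X x y != 0 -> `|y - (1 - s) * x| <= 3 * e * s * X.
Proof.
move=> s'0 s's ss X0 xX; apply: contraNT; rewrite -ltNge => H.
have s0 : 0 < s by exact: lt_le_trans s's.
have d : `|(s - s') * x| <= 2 * e * s * X.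
  by rewrite normrM [`|s - s'|]ger0_norm ?subr_ge0// ler_pM// subr_ge0.
move: d; rewrite ler_norml => /andP[d1 d2].
have E : y - (1 - s') * x = (y - (1 - s) * x) - (s - s') * x by ring.
have h1 : e * s' * X <= e * s * X by rewrite ler_wpM2r ?(ltW X0)// ler_wpM2l// ltW.
have h2 : 0 < e * s * X by rewrite !mulr_gt0.
have E3 : 3 * e * s * X = 3 * (e * s * X) by ring.
have E2 : 2 * e * s * X = 2 * (e * s * X) by ring.
rewrite E3 in H; rewrite E2 in d1 d2.
move: H; rewrite lter_normr => /orP[H|H].
  by rewrite !prim_lt ?subrr//; [lra|rewrite E; lra].
by rewrite !prim_gt ?subrr//; [lra|rewrite E; lra].
Qed.

End kernel1d.

Section integral_tools.
Context {R : realType}.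

Lemma integrable_mulb d (T : measurableType d) (mu : {measure set T -> \bar R})
    (D : set T) (f h : T -> R) (M : R) :
  measurable D -> mu.-integrable D (EFin \o f) -> measurable_fun D h ->
  (forall x, D x -> `|h x| <= M) ->
  mu.-integrable D (fun x => (f x * h x)%:E).
Proof.
move=> mD fi mh hM; apply: (integrableMl mD fi mh).
exists M; split; first exact: num_real.
by move=> K MK x Dx; exact: le_trans (hM _ Dx) (ltW MK).
Qed.

Lemma fubini_setX d1 d2 (T1 : measurableType d1) (T2 : measurableType d2)
    (m1 : {sigma_finite_measure set T1 -> \bar R})
    (m2 : {sigma_finite_measure set T2 -> \bar R})
    (A : set T1) (B : set T2) (f : T1 * T2 -> \bar R) :
  measurable A -> measurable B -> (m1 \x m2)%E.-integrable (A `*` B) f ->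
  [/\ measurable_fun A (fun x => \int[m2]_(y in B) f (x, y))%E,
      measurable_fun B (fun y => \int[m1]_(x in A) f (x, y))%E,
      (\int[m1 \x m2]_(z in A `*` B) f z =
       \int[m1]_(x in A) \int[m2]_(y in B) f (x, y))%E &
      (\int[m1 \x m2]_(z in A `*` B) f z =
       \int[m2]_(y in B) \int[m1]_(x in A) f (x, y))%E].
Proof.
move=> mA mB fi.
have gi : (m1 \x m2)%E.-integrable setT (f \_ (A `*` B)).
  by apply/(integrable_mkcond f (measurableX mA mB)).
have E1 : (fun x => \int[m2]_y (f \_ (A `*` B)) (x, y))%E =
         (fun x => \int[m2]_(y in B) f (x, y))%E \_ A.
  apply/funext => x; rewrite [RHS]patchE; case: ifPn => xA.
    rewrite [RHS]integral_mkcond; apply: eq_integral => y _.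
    by rewrite !patchE in_setX xA.
  by apply: integral0_eq => y _; rewrite patchE in_setX (negbTE xA).
have E2 : (fun y => \int[m1]_x (f \_ (A `*` B)) (x, y))%E =
         (fun y => \int[m1]_(x in A) f (x, y))%E \_ B.
  apply/funext => y; rewrite [RHS]patchE; case: ifPn => yB.
    rewrite [RHS]integral_mkcond; apply: eq_integral => x _.
    by rewrite !patchE in_setX yB andbT.
  by apply: integral0_eq => x _; rewrite patchE in_setX (negbTE yB) andbF.
split.
- by apply/(measurable_restrictT _ mA); rewrite -E1; exact: (measurable_fubini_F gi).
- by apply/(measurable_restrictT _ mB); rewrite -E2; exact: (measurable_fubini_G gi).
- rewrite integral_mkcond [RHS]integral_mkcond -E1.
  exact/esym/(integral12_prod_meas1 gi).
- rewrite integral_mkcond [RHS]integral_mkcond -E2.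
  exact/esym/(integral21_prod_meas1 gi).
Qed.

End integral_tools.

Section slices.
Context {R : realType} {n : nat}.
Local Notation mu := (@spacetime_measure R n).
Local Notation leb := (lebesgue_rV R n).
Local Notation leb1 := (@lebesgue_measure R).

Lemma space_ibp (Omega : set 'rV[R]_n) (I : set R) (u : 'rV[R]_n * R -> R)
    (Du : 'rV[R]_n * R -> 'rV[R]_n) (F : 'rV[R]_n -> R) (b : R -> R) (M : R)
    (i : 'I_n) :
  measurable Omega -> measurable (I : set (measurableTypeR R)) ->
  L1W11 Omega I u Du ->
  test_function Omega F -> measurable_fun setT F ->
  measurable_fun setT ('D_(unitv i) F) ->
  measurable_fun setT (b : measurableTypeR R -> R) ->
  (forall x, `|F x| <= M) -> (forall x, `|'D_(unitv i) F x| <= M) ->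
  (forall t, `|b t| <= M) ->
  (\int[mu]_(z in Omega `*` I) (u z * ('D_(unitv i) F z.1 * b z.2))%:E =
   \int[mu]_(z in Omega `*` I) (Du z ord0 i * - (F z.1 * b z.2))%:E)%E.
Proof.
move=> mO mI [aeW ui Dui] tF mF mDF mb FM DFM bM.
have mOI : measurable (Omega `*` I : set (spacetime R n)).
  exact: measurableX.
have M0 : 0 <= M by exact: le_trans (FM 0).
have mb2 : measurable_fun setT (fun z : 'rV[R]_n * measurableTypeR R => b z.2).
  exact: (measurableT_comp mb measurable_snd).
have fi1 : mu.-integrable (Omega `*` I) (fun z => (u z * ('D_(unitv i) F z.1 * b z.2))%:E).
  apply: (integrable_mulb (M := M * M)) => //.
    apply: measurable_funTS.
    by apply: measurable_funM => //; exact: (measurableT_comp mDF measurable_fst).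
  by move=> z _; rewrite normrM ler_pM.
have fi2 : mu.-integrable (Omega `*` I) (fun z => (Du z ord0 i * - (F z.1 * b z.2))%:E).
  apply: (integrable_mulb (M := M * M)) => //; first exact: Dui.
    apply: measurable_funTS.
    apply: measurableT_comp => //.
    by apply: measurable_funM => //; exact: (measurableT_comp mF measurable_fst).
  by move=> z _; rewrite normrN normrM ler_pM.
have [_ m1 _ ->] := fubini_setX mO mI fi1.
have [_ m2 _ ->] := fubini_setX mO mI fi2.
apply: ae_eq_integral => //.
case: aeW => N [mN N0 HN]; exists N; split => //.
move=> t /= Ht; apply: HN => /= HW; apply: Ht => It.
have [vi gi wg] := HW It.
have j1 : leb.-integrable Omega (fun x => (u (x, t) * 'D_(unitv i) F x)%:E).
  apply: (integrable_mulb (M := M) mO _ _ (fun x _ => DFM x)) => //.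
  exact: measurable_funTS.
have j2 : leb.-integrable Omega (fun x => (Du (x, t) ord0 i * F x)%:E).
  apply: (integrable_mulb (M := M) mO _ _ (fun x _ => FM x)); first exact: gi.
  exact: measurable_funTS.
have := wg F tF i; rewrite /Rintegral => E.
transitivity ((b t)%:E * \int[leb]_(x in Omega) (u (x, t) * 'D_(unitv i) F x)%:E)%E.
  rewrite -integralZl//; apply: eq_integral => x _.
  by rewrite -EFinM; congr (_%:E); ring.
transitivity ((- b t)%:E * \int[leb]_(x in Omega) (Du (x, t) ord0 i * F x)%:E)%E; last first.
  rewrite -integralZl//; apply: eq_integral => x _.
  by rewrite -EFinM; congr (_%:E); ring.
rewrite -(fineK (integrable_fin_num mO j1)) -(fineK (integrable_fin_num mO j2)).
by rewrite E -!EFinM mulrN mulNr.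
Qed.

End slices.

Section space_tools.
Context {R : realType} {n : nat}.
Local Notation mu := (@spacetime_measure R n).

Lemma measurable_box (A : 'I_n -> set R) :
  (forall i, measurable (A i : set (measurableTypeR R))) ->
  measurable [set x : 'rV[R]_n | forall i, A i (x ord0 i)].
Proof.
move=> mA; rewrite (_ : mkset _ = \bigcap_(i in [set: 'I_n])
    ((fun x : 'rV[R]_n => x ord0 i) @^-1` A i)).
  apply: fin_bigcap_measurable => // i _.
  by rewrite -[X in measurable X]setTI; exact: (measurable_coord i measurableT (mA i)).
by apply/seteqP; split => x Ax; [move=> i _; exact: (Ax i)|move=> i; exact: (Ax i I)].
Qed.

Lemma measurable_cube r (x : 'rV[R]_n) : measurable (cube r x).
Proof.
apply: (@measurable_box (fun i => [set t | `|x ord0 i - t| < r])) => i.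
rewrite (_ : mkset _ = `]x ord0 i - r, x ord0 i + r[%classic).
  by [].
by apply/seteqP; split => y; rewrite /= in_itv/= ltr_distlC.
Qed.

Lemma measurable_time_itv (r t : R) :
  measurable (time_itv r t : set (measurableTypeR R)).
Proof. by rewrite /time_itv. Qed.

Lemma measurable_pcube r (z : 'rV[R]_n * R) :
  measurable (pcube r z : set (spacetime R n)).
Proof. by apply: measurableX; [exact: measurable_cube|exact: measurable_time_itv]. Qed.

Lemma enorm_ge0 (x : 'rV[R]_n) : 0 <= enorm x.
Proof. exact: sqrtr_ge0. Qed.

Lemma normr_coord_le_enorm (x : 'rV[R]_n) i : `|x ord0 i| <= enorm x.
Proof.
rewrite -sqrtr_sqr ler_wsqrtr// (bigD1 i)//= lerDl.
by apply: sumr_ge0 => j _; exact: sqr_ge0.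
Qed.

Lemma measurable_enorm : measurable_fun setT (@enorm R n).
Proof.
rewrite /enorm.
have : measurable_fun [set: R] (@Num.sqrt R).
  by apply: continuous_measurable_fun; exact: sqrt_continuous.
move/measurableT_comp; apply; apply: measurable_sum => i.
by apply: measurable_funX; exact: measurable_coord.
Qed.

Lemma measurable_tensor (g : 'I_n -> R -> R) :
  (forall l, smooth (g l : R^o -> R)) -> measurable_fun setT (tensor g).
Proof.
move=> sg; apply: measurable_prod => l _.
have : measurable_fun [set: R] (g l).
  by apply: continuous_measurable_fun; exact: (smooth_continuous (sg l)).
by move/measurableT_comp; apply; exact: measurable_coord.
Qed.

Lemma measurable_tensorD (g : 'I_n -> R -> R) i :
  (forall l, smooth (g l : R^o -> R)) -> measurable_fun setT (tensorD g i).
Proof.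
move=> sg; apply: measurable_tensor => l; case: ifP => // _.
exact: smooth_derive.
Qed.

Lemma measurable_prod_fst_snd (g : 'rV[R]_n -> R) (b : R -> R) :
  measurable_fun setT g -> measurable_fun setT (b : measurableTypeR R -> R) ->
  measurable_fun setT (fun z : 'rV[R]_n * measurableTypeR R => g z.1 * b z.2).
Proof.
move=> mg mb; apply: measurable_funM.
  exact: (measurableT_comp mg measurable_fst).
exact: (measurableT_comp mb measurable_snd).
Qed.

Lemma normr_tensor_le (g : 'I_n -> R -> R) (b : 'I_n -> R) (x : 'rV[R]_n) :
  (forall l, `|g l (x ord0 l)| <= b l) -> `|tensor g x| <= \prod_(l < n) b l.
Proof. by move=> gb; rewrite /tensor normr_prod; apply: ler_prod => l _; rewrite normr_ge0 gb. Qed.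

Lemma tensor_neq0 (g : 'I_n -> R -> R) (x : 'rV[R]_n) l :
  tensor g x != 0 -> g l (x ord0 l) != 0.
Proof. by rewrite (tensorD1 _ l) mulf_eq0 negb_or => /andP[]. Qed.

Lemma prod_if_eq (i : 'I_n) (c1 c2 : R) :
  \prod_(l < n) (if l == i then c1 else c2) = c1 * c2 ^+ n.-1.
Proof.
rewrite (bigD1 i)//= eqxx; congr (_ * _).
rewrite (eq_bigr (fun=> c2)); last by move=> l /negbTE ->.
by rewrite prodr_const cardC1 card_ord.
Qed.

Lemma integral_supp_le (C P : set (spacetime R n))
    (v phi f : 'rV[R]_n * R -> R) (b : R) :
  measurable C -> measurable P -> 0 <= b ->
  measurable_fun C v -> measurable_fun C phi -> measurable_fun C f ->
  (forall z, C z -> `|v z| <= f z) ->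
  (forall z, C z -> `|phi z| <= b) -> (forall z, C z -> phi z != 0 -> P z) ->
  (`|\int[mu]_(z in C) (v z * phi z)%:E| <=
   b%:E * \int[mu]_(z in C `&` P) (f z)%:E)%E.
Proof.
move=> mC mP b0 mv mphi mf vf phib phiP.
have f0 z : C z -> 0 <= f z by move=> /vf; exact: le_trans.
apply: (le_trans (le_abse_integral _ mC _)).
  by apply/measurable_EFinP; exact: measurable_funM.
rewrite -ge0_integralZl//; [|exact: measurableI| |].
- rewrite integral_mkcondr; apply: ge0_le_integral => //.
  + by apply/measurable_EFinP; apply: measurableT_comp => //; exact: measurable_funM.
  + apply/(measurable_restrict _ mP mC).
    apply: (measurable_funS mC); first by move=> ? [].
    by apply/measurable_EFinP; apply: measurableT_comp => //; exact: measurable_funM.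
  + move=> z Cz; rewrite patchE; case: ifPn => [_|zP].
      by rewrite -EFinM lee_fin normrM mulrC ler_pM// ?phib ?vf.
    have -> : phi z = 0.
      by apply: contraNeq zP => /(phiP _ Cz); rewrite inE.
    by rewrite mulr0 abse0.
- apply: (measurable_funS mC); first by move=> ? [].
  exact/measurable_EFinP.
- by move=> z [Cz _]; rewrite lee_fin f0.
Qed.

End space_tools.

Section star_domains.
Context {R : realType} {n : nat}.

Definition star_domain (r a : R) (Omega : set 'rV[R]_n) : Prop :=
  [/\ measurable Omega, open Omega, Omega `<=` cube r 0 &
    forall x y s, Omega x -> 0 < s -> s <= 1 -> cube (a * r) 0 y ->
      Omega ((1 - s) *: x + s *: y)].

Definition pker (e r s : R) (z : 'rV[R]_n * R) : 'rV[R]_n * R -> R :=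
  tensort (fun l => ker e s r (z.1 ord0 l)) (ker e (s ^+ 2) (r ^+ 2) z.2).

Definition avg (Omega : set 'rV[R]_n) (u : 'rV[R]_n * R -> R) (e r s : R)
    (z : 'rV[R]_n * R) : R :=
  \int[spacetime_measure]_(zeta in Omega `*` time_itv r 0) (u zeta * pker e r s z zeta).

End star_domains.

Section tensor_transport.
Context {R : realType} {n : nat}.
Local Notation mu := (@spacetime_measure R n).
Variables (Omega : set 'rV[R]_n) (I : set R) (P : set (spacetime R n)).
Variables (u : 'rV[R]_n * R -> R) (Du G : 'rV[R]_n * R -> 'rV[R]_n).
Variables (q : R) (k k' pd : 'I_n -> R -> R) (kt kt' H : R -> R).
Variables (Sx : 'I_n -> set R) (St : set R).
Local Notation C := (Omega `*` I : set (spacetime R n)).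
Hypotheses (mO : measurable Omega) (mI : measurable (I : set (measurableTypeR R)))
  (mP : measurable P).
Hypotheses (uW : L1W11 Omega I u Du) (uG : distributional_solution Omega I u G).
Hypotheses (mDu : measurable_fun C (fun z => enorm (Du z)))
  (mG : measurable_fun C (fun z => enorm (G z))).
Hypotheses (q0 : 0 <= q).
Hypotheses (sk : forall l, smooth (k l : R^o -> R))
  (sk' : forall l, smooth (k' l : R^o -> R))
  (spd : forall l, smooth (pd l : R^o -> R))
  (skt : smooth (kt : R^o -> R)) (skt' : smooth (kt' : R^o -> R))
  (sH : smooth (H : R^o -> R)).
Hypotheses (dpd : forall l y, 'D_1 (pd l : R^o -> R) y = k' l y - k l y)
  (dH : forall t, 'D_1 (H : R^o -> R) t = kt' t - kt t).
Hypotheses (kq : forall l y, `|k l y| <= q) (k'q : forall l y, `|k' l y| <= q)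
  (dkq : forall l y, `|'D_1 (k l : R^o -> R) y| <= q ^+ 2)
  (pd1 : forall l y, `|pd l y| <= 1)
  (ktq : forall t, `|kt t| <= q ^+ 2) (kt'q : forall t, `|kt' t| <= q ^+ 2)
  (H1 : forall t, `|H t| <= 1).
Hypotheses (k_supp : forall l y, k l y != 0 -> Sx l y)
  (k'_supp : forall l y, k' l y != 0 -> Sx l y)
  (pd_supp : forall l y, pd l y != 0 -> Sx l y)
  (dk_supp : forall l y, 'D_1 (k l : R^o -> R) y != 0 -> Sx l y)
  (kt'_supp : forall t, kt' t != 0 -> St t) (H_supp : forall t, H t != 0 -> St t).
Hypotheses (cSx : compact [set y : 'rV[R]_n | forall l, Sx l (y ord0 l)])
  (SxO : [set y : 'rV[R]_n | forall l, Sx l (y ord0 l)] `<=` Omega)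
  (cSt : compact St) (StI : St `<=` I)
  (SP : forall zeta : 'rV[R]_n * R, (forall l, Sx l (zeta.1 ord0 l)) -> St zeta.2 ->
     P zeta).

Let Gi (i l : 'I_n) : R -> R :=
  if (l < i)%N then k' l else if l == i then pd l else k l.

Let sG i l : smooth (Gi i l : R^o -> R).
Proof.
rewrite /Gi; case: (l < i)%N; first exact: (sk' l).
case: (l == i); [exact: (spd l)|exact: (sk l)].
Qed.

Let tensorDGi i y : tensorD (Gi i) i y =
  \prod_(l < n) (if (l < i)%N then k' l (y ord0 l) else
     if l == i then k' l (y ord0 l) - k l (y ord0 l) else k l (y ord0 l)).
Proof.
rewrite tensorDE [RHS](bigD1 i)//= ltnn eqxx {1}/Gi ltnn eqxx dpd.
congr (_ * _); apply: eq_bigr => l li.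
by rewrite /Gi (negbTE li); case: ifP.
Qed.

Let tensorB_telescope (zeta : 'rV[R]_n * R) :
  tensor k' zeta.1 * kt' zeta.2 - tensor k zeta.1 * kt zeta.2 =
  \sum_(i < n) tensorD (Gi i) i zeta.1 * kt' zeta.2 +
  tensor k zeta.1 * (kt' zeta.2 - kt zeta.2).
Proof.
under eq_bigr do rewrite tensorDGi.
rewrite -mulr_suml -(prod_telescope (fun l => k' l (zeta.1 ord0 l)) (fun l => k l (zeta.1 ord0 l))).
rewrite -/(tensor k' zeta.1) -/(tensor k zeta.1); ring.
Qed.

Let Gi_supp i l y : Gi i l y != 0 -> Sx l y.
Proof.
by rewrite /Gi; case: ifP => [_ /k'_supp//|_]; case: ifP => [_ /pd_supp//|_ /k_supp].
Qed.

Let Gi_le i l y : `|Gi i l y| <= if l == i then 1 else q.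
Proof.
rewrite /Gi; case: ifPn => [li|_]; first by rewrite ifF// -val_eqE/= ltn_eqF.
by case: ifP.
Qed.

Let mC : measurable C. Proof. exact: measurableX. Qed.

Let measurable_smooth (g : R -> R) : smooth (g : R^o -> R) ->
  measurable_fun setT (g : measurableTypeR R -> R).
Proof. by move=> sg; apply: continuous_measurable_fun; exact: (smooth_continuous sg). Qed.

Let f zeta := enorm (Du zeta) + enorm (G zeta).
Let mf : measurable_fun C f. Proof. exact: measurable_funD. Qed.

Let qn (i : 'I_n) : q ^+ n.+1 = q ^+ n.-1 * q ^+ 2.
Proof. by rewrite -exprD addn2 prednK//; exact: leq_ltn_trans (ltn_ord i). Qed.

Let prodc (K : R) : \prod_(l < n) K = K ^+ n.
Proof. by rewrite prodr_const card_ord. Qed.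

Let K : R := 1 + 2 * q.

Let tensorDGi_le i y : `|tensorD (Gi i) i y| <= K ^+ n.
Proof.
rewrite tensorDGi -prodc normr_prod.
apply: ler_prod => l _; rewrite normr_ge0/=.
case: ifP => _; first by apply: le_trans (k'q _ _) _; rewrite /K; have := q0; lra.
case: ifP => _; last by apply: le_trans (kq _ _) _; rewrite /K; have := q0; lra.
apply: le_trans (ler_normB _ _) _; rewrite /K.
by have := k'q l (y ord0 l); have := kq l (y ord0 l); lra.
Qed.

Let int_space i : mu.-integrable C
  (fun zeta => (u zeta * (tensorD (Gi i) i zeta.1 * kt' zeta.2))%:E).
Proof.
apply: (integrable_mulb (M := K ^+ n * q ^+ 2)) => //; first by case: uW.
- apply: measurable_funTS; apply: measurable_prod_fst_snd; last exact: (measurable_smooth skt').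
  exact: (measurable_tensorD i (sG i)).
- by move=> zeta _; rewrite normrM ler_pM.
Qed.

Let int_time : mu.-integrable C
  (fun zeta => (u zeta * (tensor k zeta.1 * (kt' zeta.2 - kt zeta.2)))%:E).
Proof.
apply: (integrable_mulb (M := q ^+ n * (q ^+ 2 + q ^+ 2))) => //.
- by case: uW.
- apply: measurable_funTS.
  apply: (@measurable_prod_fst_snd R n (tensor k) (fun t => kt' t - kt t)).
    exact: (measurable_tensor sk).
  exact: (measurable_funB (measurable_smooth skt') (measurable_smooth skt)).
- move=> zeta _; rewrite normrM ler_pM// -?prodc; first exact: normr_tensor_le.
  by rewrite (le_trans (ler_normB _ _))// lerD.
Qed.

Lemma space_term_le i :
  (`|\int[mu]_(zeta in C) (u zeta * (tensorD (Gi i) i zeta.1 * kt' zeta.2))%:E| <=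
   (q ^+ n.+1)%:E * \int[mu]_(zeta in C `&` P) (f zeta)%:E)%E.
Proof.
have DE : 'D_(unitv i) (tensor (Gi i)) = tensorD (Gi i) i.
  by apply/funext => y; rewrite (derive_tensor i y (sG i)).
have K0 : 0 <= K by rewrite /K; have := q0; lra.
have Kn0 : 0 <= K ^+ n by exact: exprn_ge0.
have -> : (\int[mu]_(zeta in C) (u zeta * (tensorD (Gi i) i zeta.1 * kt' zeta.2))%:E =
   \int[mu]_(zeta in C) (Du zeta ord0 i * - (tensor (Gi i) zeta.1 * kt' zeta.2))%:E)%E.
  rewrite -DE; apply: (@space_ibp R n Omega I u Du (tensor (Gi i)) kt' (K ^+ n + q ^+ 2)) => //.
  - apply: (test_function_sub (smooth_tensor (sG i)) cSx SxO).
    by move=> y y0 l; apply: (@Gi_supp i); exact: tensor_neq0 y0.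
  - exact: (measurable_tensor (sG i)).
  - by rewrite DE; exact: (measurable_tensorD i (sG i)).
  - exact: (measurable_smooth skt').
  - move=> x; rewrite (@le_trans _ _ (K ^+ n)) ?lerDl ?sqr_ge0// -prodc.
    apply: normr_tensor_le => l; apply: (le_trans (Gi_le i l _)); rewrite /K.
    by have := q0; case: ifP => _; lra.
  - by move=> x; rewrite (derive_tensor i x (sG i)) (@le_trans _ _ (K ^+ n)) ?lerDl ?sqr_ge0.
  - by move=> t; rewrite (le_trans (kt'q t))// lerDr.
apply: (@integral_supp_le R n C P (fun zeta => Du zeta ord0 i)) => //.
- by rewrite exprn_ge0.
- by case: uW => _ _ /(_ i)/measurable_int /measurable_EFinP.
- apply: measurable_funTS; apply: measurableT_comp => //.
  apply: measurable_prod_fst_snd; last exact: (measurable_smooth skt').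
  exact: (measurable_tensor (sG i)).
- by move=> zeta _; rewrite (le_trans (normr_coord_le_enorm _ _))// lerDl enorm_ge0.
- move=> zeta _; rewrite normrN normrM (qn i) ler_pM//.
  by rewrite -[X in _ <= X]mul1r -(prod_if_eq i); exact: normr_tensor_le.
- move=> zeta _; rewrite oppr_eq0 mulf_eq0 negb_or => /andP[y0 y1].
  apply: SP; last exact: kt'_supp.
  by move=> l; apply: (@Gi_supp i); exact: tensor_neq0 y0.
Qed.

Lemma time_term_le :
  (`|\int[mu]_(zeta in C) (u zeta * (tensor k zeta.1 * (kt' zeta.2 - kt zeta.2)))%:E| <=
   \sum_(i < n) ((q ^+ n.+1)%:E * \int[mu]_(zeta in C `&` P) (f zeta)%:E))%E.
Proof.
have [GL1 uD] := uG.
have th : test_function C (tensort k H).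
  apply: (test_function_sub (smooth_tensort sk sH) (compact_setX cSx cSt)).
  - by move=> y [y1 y2]; split; [exact: SxO|exact: StI].
  - move=> y; rewrite /tensort mulf_eq0 negb_or => /andP[y0 y1]; split => /=.
      by move=> l; apply: k_supp; exact: tensor_neq0 y0.
    exact: H_supp.
have dkn i x : `|tensorD k i x| <= q ^+ n.+1.
  rewrite (qn i) mulrC -(prod_if_eq i); apply: normr_tensor_le => l.
  by case: ifP.
have qn0 : 0 <= q ^+ n.+1 by rewrite exprn_ge0.
have mdk i : measurable_fun C (fun zeta => tensorD k i zeta.1 * H zeta.2).
  apply: measurable_funTS; apply: measurable_prod_fst_snd; last exact: (measurable_smooth sH).
  exact: (measurable_tensorD i sk).
have ig i : mu.-integrable C (fun zeta => (G zeta ord0 i * (tensorD k i zeta.1 * H zeta.2))%:E).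
  apply: (integrable_mulb (M := q ^+ n.+1)) => //; first exact: GL1.
  by move=> zeta _; rewrite normrM -[leRHS]mulr1 ler_pM.
have := uD _ th; rewrite /Rintegral.
have -> : (\int[mu]_(zeta in C) (u zeta * Dt (tensort k H) zeta)%:E =
   \int[mu]_(zeta in C) (u zeta * (tensor k zeta.1 * (kt' zeta.2 - kt zeta.2)))%:E)%E.
  by apply: eq_integral => zeta _; rewrite (Dt_tensort _ _ sH) dH.
have -> : (\int[mu]_(zeta in C) (dotv (G zeta) (Dx (tensort k H) zeta))%:E =
   \sum_(i < n) \int[mu]_(zeta in C) (G zeta ord0 i * (tensorD k i zeta.1 * H zeta.2))%:E)%E.
  rewrite -integral_sum//; apply: eq_integral => zeta _.
  rewrite sumEFin /dotv; congr (_%:E); apply: eq_bigr => i _.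
  by rewrite (Dx_tensort _ _ _ sk).
move=> E; rewrite -(fineK (integrable_fin_num mC int_time)) E fineK; last first.
  by apply/sum_fin_numP => i _ _; exact: integrable_fin_num.
apply: (le_trans (lee_abs_sum _ _ _)).
apply: lee_sum => i _.
apply: (@integral_supp_le R n C P (fun zeta => G zeta ord0 i)) => //.
- by have := GL1 i => /measurable_int /measurable_EFinP.
- by move=> zeta _; rewrite (le_trans (normr_coord_le_enorm _ i))// lerDr enorm_ge0.
- by move=> zeta _; rewrite normrM -[leRHS]mulr1 ler_pM.
- move=> zeta _; rewrite mulf_eq0 negb_or => /andP[y0 y1].
  apply: SP; last exact: H_supp.
  move=> l; have := tensor_neq0 l y0.
  by case: ifP => _; [exact: dk_supp|exact: k_supp].
Qed.

(* The difference of the two product kernels is a spatial divergence plus a time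
   derivative of test functions; the former is paid for by [Du], the latter by
   the flux [G]. *)
Lemma tensor_transport_le :
  (`|\int[mu]_(zeta in C) (u zeta *
      (tensor k' zeta.1 * kt' zeta.2 - tensor k zeta.1 * kt zeta.2))%:E| <=
   (2 * n%:R * q ^+ n.+1)%:E *
     \int[mu]_(zeta in C `&` P) (enorm (Du zeta) + enorm (G zeta))%:E)%E.
Proof.
have -> : (\int[mu]_(zeta in C) (u zeta *
      (tensor k' zeta.1 * kt' zeta.2 - tensor k zeta.1 * kt zeta.2))%:E =
  \int[mu]_(zeta in C)
    (\sum_(i < n) (u zeta * (tensorD (Gi i) i zeta.1 * kt' zeta.2))%:E +
     (u zeta * (tensor k zeta.1 * (kt' zeta.2 - kt zeta.2)))%:E))%E.
  by apply: eq_integral => zeta _; rewrite tensorB_telescope mulrDr EFinD mulr_sumr -sumEFin.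
rewrite integralD//; last exact: integrable_sum.
rewrite integral_sum//.
apply: (le_trans (lee_abs_add _ _)).
apply: (@le_trans _ _ (\sum_(i < n) ((q ^+ n.+1)%:E * \int[mu]_(zeta in C `&` P) (f zeta)%:E) +
  \sum_(i < n) ((q ^+ n.+1)%:E * \int[mu]_(zeta in C `&` P) (f zeta)%:E))%E).
  apply: leeD; last exact: time_term_le.
  apply: (le_trans (lee_abs_sum _ _ _)).
  by apply: lee_sum => i _; exact: space_term_le.
have F0 : (0 <= \int[mu]_(zeta in C `&` P) (f zeta)%:E)%E.
  by apply: integral_ge0 => zeta _; rewrite lee_fin addr_ge0 ?enorm_ge0.
have qn0 : (0 <= (q ^+ n.+1)%:E)%E by rewrite lee_fin exprn_ge0.
rewrite -!ge0_sume_distrl// -ge0_muleDl ?sume_ge0//.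
rewrite sumEFin sumr_const card_ord -EFinD.
have -> : q ^+ n.+1 *+ n + q ^+ n.+1 *+ n = 2 * n%:R * q ^+ n.+1 by ring.
by [].
Qed.

End tensor_transport.

Section step_estimate.
Context {R : realType} {n : nat}.
Local Notation mu := (@spacetime_measure R n).
Variables (Omega : set 'rV[R]_n) (r a e M : R) (u : 'rV[R]_n * R -> R).
Variables (Du G : 'rV[R]_n * R -> 'rV[R]_n).
Hypotheses (r0 : 0 < r) (e0 : 0 < e) (ea : 8 * e <= a) (a1 : a <= 1).
Hypothesis star : star_domain r a Omega.
Hypotheses (M1 : 1 <= M) (bM : forall x : R, bump1 x <= M)
  (dbM : forall x, `|'D_1 (bump1 : R^o -> R) x| <= M).
Local Notation I := (time_itv r 0).
Local Notation C := (Omega `*` I : set (spacetime R n)).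
Hypotheses (uW : L1W11 Omega I u Du) (uG : distributional_solution Omega I u G).
Hypotheses (mDu : measurable_fun C (fun z => enorm (Du z)))
  (mG : measurable_fun C (fun z => enorm (G z))).

Definition kbound : R := 4 * M / e ^+ 2.
Local Notation B := kbound.

Let e1 : 8 * e <= 1. Proof. exact: le_trans a1. Qed.

Let M0 : 0 < M. Proof. exact: lt_le_trans M1. Qed.

Lemma kbound_ge1 : 1 <= B.
Proof.
rewrite /kbound ler_pdivlMr ?exprn_gt0// mul1r.
have : e ^+ 2 <= 1 by rewrite expr_le1//; have := e0; have := e1; lra.
have := M1; lra.
Qed.

Lemma ker_le (s t X x y : R) : 0 < s -> s <= 4 * t -> 0 < X ->
  `|ker e t X x y| <= B / (s * X).
Proof.
move=> s0 st X0; have t0 : 0 < t by lra.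
rewrite ger0_norm; last by apply: ker_ge0 => //; exact: ltW.
apply: (@le_trans _ _ ((e * t * X)^-1 * M)).
  by rewrite ler_wpM2l ?bM// invr_ge0 !mulr_ge0// ltW.
rewrite mulrC ler_pdivrMr ?mulr_gt0// /kbound.
have -> : 4 * M / e ^+ 2 / (s * X) * (e * t * X) = M * ((4 * t) / s) / e.
  by field; rewrite !gt_eqF.
rewrite -mulrA ler_peMr ?(ltW M0)// ler_pdivlMr// mul1r.
apply: (@le_trans _ _ 1); first by have := e0; have := e1; lra.
by rewrite ler_pdivlMr// mul1r.
Qed.

Lemma dker_le (s X x y : R) : 0 < s -> 0 < X ->
  `|'D_1 (ker e s X x : R^o -> R) y| <= B / (s * X) ^+ 2.
Proof.
move=> s0 X0; rewrite derive_ker// normrM [`|_ ^+ 2|]ger0_norm ?sqr_ge0//.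
apply: (@le_trans _ _ ((e * s * X)^-1 ^+ 2 * M)); first by rewrite ler_wpM2l ?dbM ?sqr_ge0.
have -> : (e * s * X)^-1 ^+ 2 * M = M / e ^+ 2 / (s * X) ^+ 2.
  by field; rewrite !gt_eqF.
rewrite ler_wpM2r ?invr_ge0 ?sqr_ge0// /kbound ler_wpM2r ?invr_ge0 ?sqr_ge0//.
by have := M0; lra.
Qed.

Lemma primB_le (s t X x y : R) : `|prim e s X x y - prim e t X x y| <= 1.
Proof.
have /andP[p0 p1] := prim_itv e s X x y; have /andP[q0 q1] := prim_itv e t X x y.
by rewrite ler_norml; apply/andP; split; lra.
Qed.

Lemma dker_supp (s X x y : R) : 0 < s -> 0 < X ->
  'D_1 (ker e s X x : R^o -> R) y != 0 -> `|y - (1 - s) * x| <= e * s * X.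
Proof.
move=> s0 X0; apply: contraNT; rewrite -ltNge => H; rewrite derive_ker//.
rewrite derive_bump_out ?mulr0// /kpos normrM [X in _ * X]gtr0_norm ?invr_gt0 ?mulr_gt0//.
by rewrite ltr_pdivlMr ?mul1r ?mulr_gt0.
Qed.

Lemma coord_dist (s X x y : R) : 0 < s -> s <= 1 -> 0 < X -> `|x| <= X ->
  `|y - (1 - s) * x| <= 3 * e * s * X -> `|x - y| < 2 * (s * X).
Proof.
move=> s0 s1 X0 xX H.
have -> : x - y = s * x - (y - (1 - s) * x) by ring.
apply: (le_lt_trans (ler_normB _ _)).
rewrite normrM (gtr0_norm s0).
have : s * `|x| <= s * X by rewrite ler_wpM2l// ltW.
have : 3 * e * s * X < s * X.
  by rewrite -mulrA gtr_pMl ?mulr_gt0//; have := e0; have := e1; lra.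
lra.
Qed.

Lemma star_box (s : R) (x y : 'rV[R]_n) : 0 < s -> s <= 1 -> Omega x ->
  (forall l, `|y ord0 l - (1 - s) * x ord0 l| <= 3 * e * s * r) -> Omega y.
Proof.
move=> s0 s1 Ox H; have [_ _ _ st] := star.
have -> : y = (1 - s) *: x + s *: (s^-1 *: (y - (1 - s) *: x)).
  by rewrite scalerA divff ?gt_eqF// scale1r addrC subrK.
apply: st => // i; rewrite mxE sub0r normrN !mxE normrM ger0_norm ?invr_ge0 ?ltW//.
rewrite mulrC ltr_pdivrMr//; apply: (le_lt_trans (H i)).
rewrite -mulrA [s * r]mulrC mulrA ltr_pM2r// ltr_pM2r//.
by have := e0; have := ea; lra.
Qed.

Section one_step.
Variables (s : R) (z : 'rV[R]_n * R).
Hypotheses (s0 : 0 < s) (s1 : s <= 1) (Cz : C z).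

Let s' : R := (1 - e) * s.
Let rho := s * r.
Let q := B / rho.
Let P : set (spacetime R n) := pcube (2 * rho) z.

Let s'0 : 0 < s'. Proof. by rewrite /s' mulr_gt0//; move: e0 e1; lra. Qed.
Let s's : s' <= s. Proof. by rewrite /s' ger_pMl//; have := e0; lra. Qed.
Let ss' : s - s' <= 2 * e * s.
Proof.
have -> : s - s' = e * s by rewrite /s'; ring.
by rewrite ler_wpM2r ?(ltW s0)//; have := e0; lra.
Qed.
Let s4 : s <= 4 * s'.
Proof. by rewrite /s' mulrA ler_peMl ?(ltW s0)//; have := e0; have := e1; lra. Qed.
Let t0 : 0 < s ^+ 2. Proof. exact: exprn_gt0. Qed.
Let t'0 : 0 < s' ^+ 2. Proof. exact: exprn_gt0. Qed.
Let t't : s' ^+ 2 <= s ^+ 2. Proof. by rewrite ler_sqr ?nnegrE ?(ltW s0) ?(ltW s'0). Qed.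
Let tt' : s ^+ 2 - s' ^+ 2 <= 2 * e * s ^+ 2.
Proof.
have -> : s ^+ 2 - s' ^+ 2 = (2 * e - e ^+ 2) * s ^+ 2 by rewrite /s'; ring.
by rewrite ler_wpM2r ?sqr_ge0// gerBl sqr_ge0.
Qed.
Let t4 : s ^+ 2 <= 4 * s' ^+ 2.
Proof.
have -> : 4 * s' ^+ 2 = (2 * (1 - e)) ^+ 2 * s ^+ 2 by rewrite /s'; ring.
rewrite ler_peMl ?sqr_ge0// exprn_ege1//.
by have := e0; have := e1; lra.
Qed.
Let R0 : 0 < r ^+ 2. Proof. exact: exprn_gt0. Qed.
Let rho0 : 0 < rho. Proof. exact: mulr_gt0. Qed.
Let q0 : 0 < q. Proof. by rewrite divr_gt0// (lt_le_trans _ kbound_ge1). Qed.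
Let q2 : B / (s ^+ 2 * r ^+ 2) <= q ^+ 2.
Proof.
rewrite -exprMn /q expr_div_n ler_wpM2r ?invr_ge0 ?sqr_ge0// expr2 ler_peMl//.
- by rewrite (le_trans ler01 kbound_ge1).
- exact: kbound_ge1.
Qed.

Let xr l : `|z.1 ord0 l| <= r.
Proof.
have [_ _ Ocube _] := star.
by have := Ocube _ Cz.1 l; rewrite mxE sub0r normrN; exact: ltW.
Qed.
Let tr : `|z.2| <= r ^+ 2.
Proof.
have := Cz.2; rewrite /time_itv /= in_itv/= sub0r add0r => /andP[h1 h2].
by rewrite ler_norml; apply/andP; split; exact: ltW.
Qed.

Let k l := ker e s r (z.1 ord0 l).
Let k' l := ker e s' r (z.1 ord0 l).
Let p l := prim e s r (z.1 ord0 l).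
Let p' l := prim e s' r (z.1 ord0 l).
Let kt := ker e (s ^+ 2) (r ^+ 2) z.2.
Let kt' := ker e (s' ^+ 2) (r ^+ 2) z.2.
Let H t := prim e (s' ^+ 2) (r ^+ 2) z.2 t - prim e (s ^+ 2) (r ^+ 2) z.2 t.

Let sk l : smooth (k l : R^o -> R). Proof. exact: smooth_ker. Qed.
Let sk' l : smooth (k' l : R^o -> R). Proof. exact: smooth_ker. Qed.
Let sp l : smooth (p l : R^o -> R). Proof. exact: smooth_prim. Qed.
Let sp' l : smooth (p' l : R^o -> R). Proof. exact: smooth_prim. Qed.

Let sH : smooth (H : R^o -> R).
Proof.
apply: (@smoothB R R^o (prim e (s' ^+ 2) (r ^+ 2) z.2) (prim e (s ^+ 2) (r ^+ 2) z.2));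
  exact: smooth_prim.
Qed.

Let derive_primB t t' X x y :
  'D_1 ((fun y => prim e t X x y - prim e t' X x y) : R^o -> R) y =
  ker e t X x y - ker e t' X x y.
Proof.
rewrite [LHS](@deriveB R R^o R (prim e t X x : R^o -> R) (prim e t' X x : R^o -> R)).
- by rewrite !derive_prim.
- exact: smooth_derivable (@smooth_prim _ _ _ _ _).
- exact: smooth_derivable (@smooth_prim _ _ _ _ _).
Qed.

Let kq l y : `|k l y| <= q.
Proof. by apply: ker_le => //; have := s0; lra. Qed.
Let k'q l y : `|k' l y| <= q. Proof. exact: ker_le. Qed.
Let ktq t : `|kt t| <= q ^+ 2.
Proof. by apply: le_trans q2; apply: ker_le => //; have := t0; lra. Qed.
Let kt'q t : `|kt' t| <= q ^+ 2.
Proof. by apply: le_trans q2; exact: ker_le. Qed.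

Let k_supp l y : k l y != 0 -> `|y - (1 - s) * z.1 ord0 l| <= 3 * e * s * r.
Proof.
move/ker_supp => /(_ e0 s0 r0)/le_trans; apply.
by rewrite -!mulrA ler_peMl ?mulr_ge0 ?ltW//; lra.
Qed.

Let dk_supp l y : 'D_1 (k l : R^o -> R) y != 0 ->
  `|y - (1 - s) * z.1 ord0 l| <= 3 * e * s * r.
Proof.
move/dker_supp => /(_ s0 r0)/le_trans; apply.
by rewrite -!mulrA ler_peMl ?mulr_ge0 ?ltW//; lra.
Qed.

Let kt'_supp t : kt' t != 0 -> `|t - (1 - s ^+ 2) * z.2| <= 3 * e * s ^+ 2 * r ^+ 2.
Proof. exact: ker_supp2. Qed.

Let H_supp t : H t != 0 -> `|t - (1 - s ^+ 2) * z.2| <= 3 * e * s ^+ 2 * r ^+ 2.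
Proof. exact: primB_supp. Qed.

Let in_P (zeta : 'rV[R]_n * R) :
  (forall l, `|zeta.1 ord0 l - (1 - s) * z.1 ord0 l| <= 3 * e * s * r) ->
  `|zeta.2 - (1 - s ^+ 2) * z.2| <= 3 * e * s ^+ 2 * r ^+ 2 -> P zeta.
Proof.
move=> Hx Ht; split=> /=.
  by move=> l; apply: coord_dist => //; exact: Hx.
have : `|z.2 - zeta.2| < 2 * (s ^+ 2 * r ^+ 2).
  by apply: coord_dist => //; rewrite expr_le1// ltW.
rewrite /time_itv/= in_itv/= ltr_distlC.
have -> : (2 * rho) ^+ 2 = 4 * (s ^+ 2 * r ^+ 2) by rewrite /rho; ring.
have : 0 < s ^+ 2 * r ^+ 2 by rewrite mulr_gt0.
by move=> h /andP[h1 h2]; apply/andP; split; lra.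
Qed.

Let pd l y := p' l y - p l y.

Let k'_supp l y : k' l y != 0 -> `|y - (1 - s) * z.1 ord0 l| <= 3 * e * s * r.
Proof. exact: ker_supp2. Qed.

Let pd_supp l y : pd l y != 0 -> `|y - (1 - s) * z.1 ord0 l| <= 3 * e * s * r.
Proof. exact: primB_supp. Qed.

Let dkq l y : `|'D_1 (k l : R^o -> R) y| <= q ^+ 2.
Proof. by apply: le_trans q2; rewrite -exprMn; exact: dker_le. Qed.

Let spd l : smooth (pd l : R^o -> R).
Proof. exact (@smoothB R R^o (p' l) (p l) (sp' l) (sp l)). Qed.

Let time_sub (t : R) : `|t - (1 - s ^+ 2) * z.2| <= 3 * e * s ^+ 2 * r ^+ 2 -> I t.
Proof.
move=> ht; rewrite /= /time_itv/= in_itv/= sub0r add0r -ltr_norml.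
have -> : t = (t - (1 - s ^+ 2) * z.2) + (1 - s ^+ 2) * z.2 by rewrite subrK.
apply: (le_lt_trans (ler_normD _ _)).
have s21 : 0 <= 1 - s ^+ 2 by rewrite subr_ge0 expr_le1// ltW.
rewrite normrM (ger0_norm s21).
have h1 : (1 - s ^+ 2) * `|z.2| <= (1 - s ^+ 2) * r ^+ 2 by rewrite ler_wpM2l.
have h2 : 3 * e * s ^+ 2 * r ^+ 2 < s ^+ 2 * r ^+ 2.
  by rewrite -mulrA gtr_pMl ?mulr_gt0//; have := e0; have := e1; lra.
move: h1; rewrite mulrBl [(1 - _) * r ^+ 2]mulrBl !mul1r => h1; lra.
Qed.

Lemma pker_transport :
  (`|\int[mu]_(zeta in C) (u zeta * (pker e r s' z zeta - pker e r s z zeta))%:E| <=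
   (2 * n%:R * q ^+ n.+1)%:E *
     \int[mu]_(zeta in C `&` P) (enorm (Du zeta) + enorm (G zeta))%:E)%E.
Proof.
have mO : measurable Omega by case: star.
have cX := @box_compact R n (fun l => (1 - s) * z.1 ord0 l) (3 * e * s * r).
have SO (y : 'rV[R]_n) := @star_box s z.1 y s0 s1 Cz.1.
exact (@tensor_transport_le R n Omega I P u Du G q k k' pd kt kt' H
  (fun l => [set y : R | `|y - (1 - s) * z.1 ord0 l| <= 3 * e * s * r])
  [set t : R | `|t - (1 - s ^+ 2) * z.2| <= 3 * e * s ^+ 2 * r ^+ 2]
  mO (measurable_time_itv _ _) (measurable_pcube _ _) uW uG mDu mG (ltW q0)
  sk sk' spd (smooth_ker _ _ _ _) (smooth_ker _ _ _ _) sH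
  (fun l y => derive_primB _ _ _ _ _) (fun t => derive_primB _ _ _ _ _)
  kq k'q dkq (fun l y => primB_le _ _ _ _ _) ktq kt'q (fun t => primB_le _ _ _ _ _)
  k_supp k'_supp pd_supp dk_supp kt'_supp H_supp cX SO
  (@interval_compact R _ _) time_sub in_P).
Qed.

End one_step.

Lemma measurable_pker (s : R) (z : 'rV[R]_n * R) : measurable_fun setT
  (pker e r s z : 'rV[R]_n * measurableTypeR R -> R).
Proof.
apply: measurable_prod_fst_snd.
  by apply: measurable_tensor => l; exact: smooth_ker.
by apply: continuous_measurable_fun; exact: (smooth_continuous (@smooth_ker _ _ _ _ _)).
Qed.

Lemma pker_bound (s : R) (z zeta : 'rV[R]_n * R) : 0 < s ->
  `|pker e r s z zeta| <= (B / (s * r)) ^+ n * (B / (s ^+ 2 * r ^+ 2)).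
Proof.
move=> s0; rewrite /pker /tensort normrM ler_pM//; last first.
  apply: ker_le; rewrite ?exprn_gt0//.
  by have : 0 < s ^+ 2 by [rewrite exprn_gt0]; lra.
have -> : (B / (s * r)) ^+ n = \prod_(l < n) (B / (s * r)).
  by rewrite prodr_const card_ord.
by apply: normr_tensor_le => l; apply: ker_le => //; lra.
Qed.

Lemma integrable_pker (s : R) (z : 'rV[R]_n * R) : 0 < s ->
  mu.-integrable C (fun zeta => (u zeta * pker e r s z zeta)%:E).
Proof.
move=> s0; apply: (integrable_mulb (M := (B / (s * r)) ^+ n * (B / (s ^+ 2 * r ^+ 2)))).
- by apply: measurableX; [case: star|exact: measurable_time_itv].
- by case: uW.
- by apply: measurable_funTS; exact: measurable_pker.
- by move=> zeta _; exact: pker_bound.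
Qed.

Lemma avg_step (s : R) (z : 'rV[R]_n * R) : 0 < s -> s <= 1 -> C z ->
  (`|avg Omega u e r ((1 - e) * s) z - avg Omega u e r s z|%:E <=
   (2 * n%:R * (B / (s * r)) ^+ n.+1)%:E *
     \int[mu]_(zeta in C `&` pcube (2 * (s * r)) z)
       (enorm (Du zeta) + enorm (G zeta))%:E)%E.
Proof.
move=> s0 s1 Cz; apply: le_trans (pker_transport s0 s1 Cz).
have s'0 : 0 < (1 - e) * s by rewrite mulr_gt0//; have := e0; have := e1; lra.
have mC : measurable C.
  by apply: measurableX; [case: star|exact: measurable_time_itv].
have i1 := integrable_pker z s'0; have i2 := integrable_pker z s0.
have <- : ((avg Omega u e r ((1 - e) * s) z - avg Omega u e r s z)%:E =
   \int[mu]_(zeta in C) (u zeta * (pker e r ((1 - e) * s) z zeta - pker e r s z zeta))%:E)%E.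
  have a1' : ((avg Omega u e r ((1 - e) * s) z)%:E =
     \int[mu]_(zeta in C) (u zeta * pker e r ((1 - e) * s) z zeta)%:E)%E.
    exact (fineK (integrable_fin_num mC i1)).
  have a2' : ((avg Omega u e r s z)%:E =
     \int[mu]_(zeta in C) (u zeta * pker e r s z zeta)%:E)%E.
    exact (fineK (integrable_fin_num mC i2)).
  refine (etrans (congr2 (fun a b => a - b)%E a1' a2') _).
  refine (etrans (esym (integralB mC i1 i2)) _).
  by apply: eq_integral => zeta _; rewrite mulrBr EFinB.
exact: lexx.
Qed.

End step_estimate.

Section parabolic_cubes.
Context {R : realType} {n : nat}.
Local Notation T := (spacetime R n).
Local Notation mu := (@spacetime_measure R n).

Definition pvol (rho : R) : R := (2 * rho) ^+ n * (2 * rho ^+ 2).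

Lemma pvol_gt0 rho : 0 < rho -> 0 < pvol rho.
Proof. by move=> r0; rewrite /pvol mulr_gt0 ?exprn_gt0 ?mulr_gt0// exprn_gt0. Qed.

Lemma pvolZ c rho : pvol (c * rho) = c ^+ n.+2 * pvol rho.
Proof.
rewrite /pvol; have -> : 2 * (c * rho) = c * (2 * rho) by ring.
by rewrite exprMn -[n.+2]addn2 exprD; ring.
Qed.

Lemma measure_pcube (rho : R) (z : T) : 0 < rho -> mu (pcube rho z) = (pvol rho)%:E.
Proof.
move=> r0; rewrite /pcube.
have mc := measurable_cube rho z.1; have mt := measurable_time_itv rho z.2.
rewrite [LHS](product_measure1E _ _ mc mt).
rewrite [X in (X * _)%E = _](_ : _ = ((2 * rho) ^+ n)%:E).
  rewrite [X in (_ * X)%E = _](_ : _ = (2 * rho ^+ 2)%:E) ?EFinM//.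
  rewrite /time_itv [LHS]lebesgue_measure_itv/= lte_fin ifT.
    by rewrite -EFinB; congr (_%:E); ring.
  by rewrite ltrD2l gtrN// exprn_gt0.
rewrite [LHS](@lebesgue_rV_box R n (fun i => [set y | `|z.1 ord0 i - y| < rho])).
  rewrite (eq_bigr (fun=> (2 * rho)%:E)); last first.
    move=> i _; rewrite (_ : mkset _ = `]z.1 ord0 i - rho, z.1 ord0 i + rho[%classic).
      rewrite [LHS]lebesgue_measure_itv/= lte_fin ifT; last lra.
      by rewrite -EFinB; congr (_%:E); ring.
    by apply/seteqP; split => y; rewrite /= in_itv/= ltr_distlC.
  by rewrite prodEFin prodr_const card_ord.
move=> i; rewrite (_ : mkset _ = `]z.1 ord0 i - rho, z.1 ord0 i + rho[%classic)//.
by apply/seteqP; split => y; rewrite /= in_itv/= ltr_distlC.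
Qed.

Definition sf_spacetime_fun (A : set T) : \bar R := mu A.

HB.instance Definition _ := isMeasure.Build _ _ _ sf_spacetime_fun
  (measure0 mu) (measure_ge0 mu) (@measure_semi_sigma_additive _ _ _ mu).

Let sf_spacetime_sigma_finite : sigma_finite setT sf_spacetime_fun.
Proof.
exists (fun k => pcube k.+1%:R (0, 0)).
  apply/esym; rewrite -subTset => z _.
  pose m := \sum_(i < n) `|z.1 ord0 i| + `|z.2 : R|.
  have m0 : 0 <= m by rewrite addr_ge0// sumr_ge0.
  exists (Num.truncn m) => //.
  have mk : m < (Num.truncn m).+1%:R by rewrite truncnS_gt.
  split => /=.
    move=> i; rewrite mxE sub0r normrN; apply: le_lt_trans mk.
    rewrite /m (bigD1 i)//= -addrA lerDl addr_ge0// sumr_ge0//.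
  rewrite /time_itv/= in_itv/= sub0r add0r -ltr_norml.
  apply: (@lt_le_trans _ _ (Num.truncn m).+1%:R).
    by apply: le_lt_trans mk; rewrite /m lerDr sumr_ge0.
  by rewrite expr2 ler_peMl// ler1n.
move=> k; split; first exact: measurable_pcube.
by rewrite [X in (X < _)%E](measure_pcube _ (ltr0Sn _ _)) ltry.
Qed.

HB.instance Definition _ := Measure_isSigmaFinite.Build _ _ _ sf_spacetime_fun
  sf_spacetime_sigma_finite.

(* In the library the canonical sigma-finiteness of [m1 \x m2] is only found for
   subprobabilities, hence this copy of [mu] carrying its own instance. *)
Definition sf_spacetime : {sigma_finite_measure set T -> \bar R} := sf_spacetime_fun.

Lemma pcubeC (rho : R) (z zeta : T) : pcube rho z zeta = pcube rho zeta z.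
Proof.
apply/propext; rewrite /pcube /cube /time_itv/=; split => -[h1 h2]; split.
- by move=> i; rewrite distrC.
- by move: h2; rewrite !in_itv/= => /andP[h2 h3]; apply/andP; split; lra.
- by move=> i; rewrite distrC.
- by move: h2; rewrite !in_itv/= => /andP[h2 h3]; apply/andP; split; lra.
Qed.

Lemma measurable_pcube_rel (rho : R) :
  measurable [set zz : T * T | pcube rho zz.1 zz.2].
Proof.
have mlt (f : T * T -> R) (c : R) : measurable_fun setT f ->
    measurable [set zz | `|f zz| < c].
  move=> mf; rewrite (_ : mkset _ = setT `&` ((fun zz => `|f zz|) @^-1` `]-oo, c[)).
    have mn : measurable_fun setT (fun zz => `|f zz|) by exact: measurableT_comp.
    exact: mn.
  by rewrite setTI; apply/seteqP; split => zz; rewrite /= in_itv.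
rewrite (_ : mkset _ =
    (\bigcap_(i in [set: 'I_n]) [set zz : T * T | `|zz.1.1 ord0 i - zz.2.1 ord0 i| < rho])
    `&` [set zz : T * T | `|(zz.2.2 : R) - zz.1.2| < rho ^+ 2]).
  apply: measurableI.
    apply: fin_bigcap_measurable => // i _; apply: mlt.
    apply: measurable_funB.
      apply: (measurableT_comp (measurable_coord i)).
      exact: (measurableT_comp measurable_fst measurable_fst).
    apply: (measurableT_comp (measurable_coord i)).
    exact: (measurableT_comp measurable_fst measurable_snd).
  apply: mlt; apply: measurable_funB.
    exact: (measurableT_comp measurable_snd measurable_snd).
  exact: (measurableT_comp measurable_snd measurable_fst).
apply/seteqP; split => zz.
  move=> [h1 h2]; split; first by move=> i _; exact: h1.
  by move: h2; rewrite /time_itv/= in_itv/= ltr_distl.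
move=> [h1 h2]; split; first by move=> i; exact: (h1 i I).
by move: h2; rewrite /time_itv/= in_itv/= ltr_distl.
Qed.

Section tonelli.
Variables (rho : R) (g h : T -> \bar R).
Hypotheses (mg : measurable_fun setT g) (mh : measurable_fun setT h)
  (g0 : forall z, (0 <= g z)%E) (h0 : forall z, (0 <= h z)%E).

Let D := [set zz : T * T | pcube rho zz.1 zz.2].
Let F := (fun zz : T * T => h zz.1 * g zz.2)%E \_ D.

Let F0 zz : (0 <= F zz)%E.
Proof. by rewrite /F patchE; case: ifP => // _; exact: mule_ge0. Qed.

Let mF : measurable_fun setT F.
Proof.
apply/(measurable_restrictT _ (measurable_pcube_rel rho)).
apply: measurable_funTS; apply: emeasurable_funM.
  exact: (measurableT_comp mh measurable_fst).
exact: (measurableT_comp mg measurable_snd).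
Qed.

Let F1 z : (\int[mu]_zeta F (z, zeta) = h z * \int[mu]_(zeta in pcube rho z) g zeta)%E.
Proof.
rewrite [in RHS]integral_mkcond -ge0_integralZl//.
- apply: eq_integral => zeta _; rewrite /F !patchE.
  have -> : ((z, zeta) \in D) = (zeta \in (pcube rho z : set T)).
    by apply/idP/idP; rewrite !inE.
  by case: ifP => _ //; rewrite mule0.
- apply/(measurable_restrictT _ (measurable_pcube rho z)).
  exact: measurable_funTS.
- by move=> zeta _; exact: erestrict_ge0.
Qed.

Let F2 zeta : (\int[mu]_z F (z, zeta) = g zeta * \int[mu]_(z in pcube rho zeta) h z)%E.
Proof.
rewrite [in RHS]integral_mkcond -ge0_integralZl//.
- apply: eq_integral => z _; rewrite /F !patchE.
  have -> : ((z, zeta) \in D) = (z \in (pcube rho zeta : set T)).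
    by apply/idP/idP; rewrite !inE /D/= pcubeC.
  by case: ifP => _; rewrite ?mule0// muleC.
- apply/(measurable_restrictT _ (measurable_pcube rho zeta)).
  exact: measurable_funTS.
- by move=> z _; exact: erestrict_ge0.
Qed.

Lemma tonelli_pcube :
  (\int[mu]_z (h z * \int[mu]_(zeta in pcube rho z) g zeta) =
   \int[mu]_zeta (g zeta * \int[mu]_(z in pcube rho zeta) h z))%E.
Proof.
under eq_integral do rewrite -F1.
under [RHS]eq_integral do rewrite -F2.
exact: (@fubini_tonelli _ _ T T R sf_spacetime sf_spacetime F mF F0).
Qed.

Lemma measurable_integral_pcubeM : measurable_fun setT
  (fun z => h z * \int[mu]_(zeta in pcube rho z) g zeta)%E.
Proof.
have := @measurable_fun_fubini_tonelli_F _ _ T T R sf_spacetime F mF F0.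
by rewrite /fubini_F; apply: eq_measurable_fun => z _; exact: F1.
Qed.

End tonelli.

Lemma measurable_integral_pcube (rho : R) (g : T -> \bar R) :
  measurable_fun setT g -> (forall z, (0 <= g z)%E) ->
  measurable_fun setT (fun z => \int[mu]_(zeta in pcube rho z) g zeta)%E.
Proof.
move=> mg g0.
have := @measurable_integral_pcubeM rho g (cst 1%E) mg (measurable_cst _) g0 (fun=> lee01).
by apply: eq_measurable_fun => z _; rewrite mul1e.
Qed.

End parabolic_cubes.

Section tensor_integral.
Context {R : realType}.
Local Notation leb1 := (@lebesgue_measure R).

Lemma integral_tensor n (g : 'I_n -> R -> R) :
  (forall l, measurable_fun setT (g l : measurableTypeR R -> R)) ->
  (forall l t, 0 <= g l t) ->
  (\int[lebesgue_rV R n]_x (tensor g x)%:E =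
   \prod_(l < n) \int[leb1]_t (g l t)%:E)%E.
Proof.
have mt m (h : 'I_m -> R -> R) :
    (forall l, measurable_fun setT (h l : measurableTypeR R -> R)) ->
    measurable_fun setT (tensor h).
  move=> mh; apply: measurable_prod => l _.
  exact: (measurableT_comp (mh l) (measurable_coord l)).
have t0 m (h : 'I_m -> R -> R) : (forall l t, 0 <= h l t) -> forall x, 0 <= tensor h x.
  by move=> h0 x; apply: prodr_ge0.
elim: n g => [|n IH] g mg g0.
  rewrite big_ord0 /= integral_dirac//.
    by rewrite diracE in_setT mul1e /tensor big_ord0.
  by apply/measurable_EFinP; exact: mt.
rewrite big_ord_recl -(IH (fun l => g (lift ord0 l)))//.
transitivity (\int[(lebesgue_measure \x lebesgue_rV R n)%E]_z
   (g ord0 z.1 * tensor (fun l => g (lift ord0 l)) z.2)%:E)%E.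
  transitivity (\int[pushforward (lebesgue_measure \x lebesgue_rV R n)%E cons_rV]_x (tensor g x)%:E)%E.
    by [].
  rewrite (ge0_integral_pushforward (measurable_cons_rV)).
  - rewrite preimage_setT; apply: eq_integral => z _ /=.
    rewrite /tensor big_ord_recl cons_rVE unlift_none; congr (_ * _)%:E.
    by apply: eq_bigr => l _; rewrite cons_rVE liftK.
  - exact: measurableT.
  - by apply/measurable_EFinP; exact: mt.
  - by move=> x _; rewrite lee_fin t0.
rewrite fubini_tonelli1.
- rewrite /fubini_F /=.
  under eq_integral => t _.
    under eq_integral do rewrite EFinM.
    rewrite ge0_integralZl ?lee_fin//; last 2 first.
      by apply/measurable_EFinP; exact: mt.
      by move=> x _; rewrite lee_fin t0.
    over.
  rewrite ge0_integralZr//.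
  + by apply/measurable_EFinP; exact: (mg ord0).
  + by move=> t _; rewrite lee_fin.
  + by apply: integral_ge0 => x _; rewrite lee_fin t0.
- apply/measurable_EFinP; apply: measurable_funM.
    exact: (measurableT_comp (mg ord0) measurable_fst).
  exact: (measurableT_comp (mt _ _ (fun l => mg (lift ord0 l))) measurable_snd).
- by move=> z; rewrite lee_fin mulr_ge0// t0.
Qed.

Lemma integral_tensort n (g : 'I_n -> R -> R) (b : R -> R) :
  (forall l, measurable_fun setT (g l : measurableTypeR R -> R)) ->
  measurable_fun setT (b : measurableTypeR R -> R) ->
  (forall l t, 0 <= g l t) -> (forall t, 0 <= b t) ->
  (\int[@spacetime_measure R n]_z (tensort g b z)%:E =
   (\prod_(l < n) \int[leb1]_t (g l t)%:E) * \int[leb1]_t (b t)%:E)%E.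
Proof.
move=> mg mb g0 b0; rewrite -integral_tensor//.
have mt : measurable_fun setT (tensor g).
  apply: measurable_prod => l _.
  exact: (measurableT_comp (mg l) (measurable_coord l)).
have t0 x : 0 <= tensor g x by apply: prodr_ge0.
rewrite [LHS]fubini_tonelli1.
- rewrite /fubini_F /tensort /=.
  under eq_integral => x _.
    under eq_integral do rewrite EFinM.
    rewrite ge0_integralZl ?lee_fin//; last 2 first.
      by apply/measurable_EFinP; exact: mb.
      by move=> t _; rewrite lee_fin.
    over.
  rewrite ge0_integralZr//.
  + by apply/measurable_EFinP.
  + by move=> x _; rewrite lee_fin.
  + by apply: integral_ge0 => x _; rewrite lee_fin.
- apply/measurable_EFinP; exact: measurable_prod_fst_snd.
- by move=> z; rewrite lee_fin mulr_ge0.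
Qed.

(* Here the kernel is integrated with respect to its center, not to its argument. *)
Lemma integral_ker_center (e s X y : R) : 0 < e -> 0 < s -> s < 1 -> 0 < X ->
  (\int[leb1]_x (ker e s X x y)%:E = ((1 - s)^-1)%:E)%E.
Proof.
move=> e0 s0 s1 X0.
have h0 : 0 < e * s * X by rewrite !mulr_gt0.
have l0 : 0 < 1 - s by rewrite subr_gt0.
pose al := (y - 2 * (e * s * X)) / (1 - s); pose be := (y + 2 * (e * s * X)) / (1 - s).
have alE : (1 - s) * al = y - 2 * (e * s * X) by rewrite /al mulrC divfK// gt_eqF.
have beE : (1 - s) * be = y + 2 * (e * s * X) by rewrite /be mulrC divfK// gt_eqF.
have ab : al < be by rewrite ltr_pM2r ?invr_gt0//; lra.
pose k1 := - (1 - s) / (e * s * X); pose c1 := y / (e * s * X).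
have kE x : kpos e s X x y = k1 * x + c1.
  rewrite /kpos /k1 /c1; move: h0; move: (e * s * X) => h h0.
  by field; rewrite gt_eqF.
pose F x := - (1 - s)^-1 * step (k1 * x + c1).
have sker : (fun x => ker e s X x y) = (fun x => (e * s * X)^-1 * bump1 (k1 * x + c1)).
  by apply/funext => x; rewrite /ker kE.
have cker : continuous (fun x => ker e s X x y).
  have sb : smooth ((fun x => bump1 (k1 * x + c1)) : R^o -> R).
    apply: (@smooth_comp_affine R R^o bump1 id k1 c1 _ _ smooth_bump).
      by move=> a x z.
    by move=> z; exact: cvg_id.
  rewrite sker => x; apply: cvgM; first exact: cvg_cst.
  exact: (smooth_continuous sb).
have dF (x : R) : is_derive x 1 F (ker e s X x y).
  have da : is_derive x 1 (fun x : R => k1 * x + c1) (k1 * 1 + 0).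
    exact: is_deriveD (is_deriveZ _ (is_derive_id x 1)) (is_derive_cst c1 x 1).
  have ds := is_derive1_comp
    (is_derive_step (k1 * x + c1) : is_derive ((fun x => k1 * x + c1) x) 1 step _) da.
  apply: (is_derive_eq (is_deriveZ (- (1 - s)^-1) ds)).
  rewrite /ker kE /k1 addr0 mulr1; change (_ *: _) with (- (1 - s)^-1 *
    (bump1 (k1 * x + c1) * (- (1 - s) / (e * s * X)))).
  have l1 : 1 - s != 0 by rewrite gt_eqF.
  move: (bump1 _) (gt_eqF h0); move: (e * s * X) => h b hn0.
  by field; rewrite l1 hn0.
have FTC := @continuous_FTC2 R (fun x => ker e s X x y) F al be ab.
have ker_out x : x \notin `[al, be]%classic -> ker e s X x y = 0.
  move=> xab; apply: contraNeq xab => /(ker_supp e0 s0 X0); rewrite ler_norml => /andP[h1 h2].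
  rewrite inE/= in_itv/=; apply/andP; split.
    by rewrite -(ler_pM2l l0) alE; lra.
  by rewrite -(ler_pM2l l0) beE; lra.
transitivity (\int[leb1]_(x in `[al, be]) (ker e s X x y)%:E)%E.
  rewrite [RHS]integral_mkcond; apply: eq_integral => x _.
  by rewrite patchE; case: ifPn => [_|/ker_out ->].
rewrite FTC.
- rewrite /F.
  have -> : step (k1 * al + c1) = 1.
    by apply: step_ge; rewrite -kE /kpos alE ler_pdivlMr//; lra.
  have -> : step (k1 * be + c1) = 0.
    by apply: step_le; rewrite -kE /kpos beE ler_pdivrMr//; lra.
  by rewrite mulr0 mulr1 sub0e -EFinN opprK.
- exact: continuous_subspaceT.
- have cF : continuous F.
    by move=> x; apply/differentiable_continuous/derivable1_diffP; exact: (@ex_derive _ _ _ _ _ _ _ (dF x)).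
  split.
  + by move=> x _; exact: (@ex_derive _ _ _ _ _ _ _ (dF x)).
  + by apply: cvg_at_right_filter; exact: cF.
  + by apply: cvg_at_left_filter; exact: cF.
- by move=> x _; rewrite derive1E (@derive_val _ _ _ _ _ _ _ (dF x)).
Qed.

End tensor_integral.

Section rays.
Context {R : realType} {n : nat}.
Local Notation T := (spacetime R n).

Definition rays (c : T) : set T :=
  [set z : T | (forall i, c.1 ord0 i < z.1 ord0 i) /\ (c.2 : R) < z.2].

Lemma raysI (c c' : T) : rays c `&` rays c' =
  rays (\row_i Num.max (c.1 ord0 i) (c'.1 ord0 i), Num.max (c.2 : R) c'.2).
Proof.
apply/seteqP; split => z.
  move=> [[h1 h2] [h3 h4]]; split => /=; last by rewrite gt_max h2 h4.
  by move=> i; rewrite mxE gt_max h1 h3.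
move=> [h1 h2]; move: h2; rewrite /= gt_max => /andP[h2 h4].
split; split => // i; have := h1 i; rewrite mxE gt_max => /andP[].
  by [].
by [].
Qed.

Lemma measurable_rays (c : T) : measurable (rays c).
Proof.
rewrite (_ : rays c = [set x : 'rV[R]_n | forall i, `]c.1 ord0 i, +oo[%classic (x ord0 i)]
    `*` (`](c.2 : R), +oo[%classic : set (measurableTypeR R))).
  apply: measurableX => //.
  by apply: (@measurable_box R n (fun i => `]c.1 ord0 i, +oo[%classic)) => i.
apply/seteqP; split => z [h1 h2]; split => /=.
- by move=> i; rewrite in_itv/= andbT; exact: h1.
- by rewrite in_itv/= andbT.
- by move=> i; have := h1 i; rewrite /= in_itv/= andbT.
- by move: h2; rewrite /= in_itv/= andbT.
Qed.

Lemma rays_exhaust (z : T) : exists m : nat, rays (const_mx (- m%:R), - m%:R) z.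
Proof.
pose b := \sum_(i < n) `|z.1 ord0 i| + `|z.2 : R|.
have b0 : 0 <= b by rewrite addr_ge0// sumr_ge0.
exists (Num.truncn b).+1.
have mk : b < (Num.truncn b).+1%:R by rewrite truncnS_gt.
split => [i|] /=; rewrite ?mxE ltrNl; apply: le_lt_trans mk; rewrite /b.
  rewrite (le_trans _ (_ : `|z.1 ord0 i| <= _))//.
    by rewrite -normrN ler_norm.
  by rewrite (bigD1 i)//= -addrA lerDl addr_ge0// sumr_ge0.
rewrite (le_trans _ (_ : `|z.2 : R| <= _))//.
  by rewrite -normrN ler_norm.
by rewrite lerDr sumr_ge0.
Qed.

Lemma measurable_rays_generated : (@measurable _ T) `<=` <<s range rays >>.
Proof.
pose TG := g_sigma_algebraType (range rays).
have coordG (h : T -> R) (hc : R -> nat -> T) :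
    (forall a, h @^-1` `]a, +oo[ = \bigcup_m rays (hc a m)) ->
    measurable_fun (setT : set TG) (h : TG -> measurableTypeR R).
  move=> hE; apply: (@measurability _ _ TG (measurableTypeR R) setT h _ (RGenOInfty.measurableE R)).
  move=> _ [_ [a ->] <-]; rewrite setTI hE.
  apply: bigcupT_measurable => m; apply: sub_sigma_algebra.
  by exists (hc a m).
have c1 i : measurable_fun (setT : set TG) ((fun z : T => z.1 ord0 i) : TG -> R).
  apply: (coordG _ (fun a m => (\row_j (if j == i then a else - m%:R), - m%:R))) => a.
  apply/seteqP; split => z /=.
    rewrite in_itv/= andbT => az; have [m [h1 h2]] := rays_exhaust z.
    exists m => //; split => //= j; rewrite mxE; case: ifPn => [/eqP ->//|_].
    by have := h1 j; rewrite mxE.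
  by move=> [m _ [/(_ i)]]; rewrite /= mxE eqxx in_itv/= andbT.
have c2 : measurable_fun (setT : set TG) ((fun z : T => z.2) : TG -> measurableTypeR R).
  apply: (coordG (fun z => z.2) (fun a m => (const_mx (- m%:R), a))) => a.
  apply/seteqP; split => z /=.
    rewrite in_itv/= andbT => az; have [m [h1 h2]] := rays_exhaust z.
    by exists m.
  by move=> [m _ [_]]; rewrite /= in_itv/= andbT.
have c1' : measurable_fun (setT : set TG) ((fun z : T => z.1) : TG -> 'rV[R]_n).
  exact: (@measurable_fun_rV R n _ TG _ c1).
have cid : measurable_fun (setT : set TG) (id : TG -> T).
  by have := measurable_fun_pair c1' c2; apply: eq_measurable_fun => -[].
by move=> A mA; have := cid measurableT A mA; rewrite setTI.
Qed.

Lemma ae_eq_rays (mu : {measure set T -> \bar R}) (C : set T) (f g : T -> \bar R) (c0 : T) :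
  measurable C -> C `<=` rays c0 ->
  mu.-integrable C f -> mu.-integrable C g ->
  (forall c, \int[mu]_(z in C `&` rays c) f z = \int[mu]_(z in C `&` rays c) g z)%E ->
  ae_eq mu C f g.
Proof.
move=> mC Cc0 fi gi fg.
pose H := [set E : set T | measurable E /\
  (\int[mu]_(z in C `&` E) f z = \int[mu]_(z in C `&` E) g z)%E].
have fgC : (\int[mu]_(z in C) f z = \int[mu]_(z in C) g z)%E.
  by have := fg c0; rewrite (setIidl Cc0).
have intS (h : T -> \bar R) E : mu.-integrable C h -> measurable E ->
    mu.-integrable (C `&` E) h.
  move=> hi mE; apply: (@integrableS _ _ _ mu C) hi => //; exact: measurableI.
have splitE (h : T -> \bar R) E : mu.-integrable C h -> measurable E ->
    (\int[mu]_(z in C `&` ~` E) h z =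
     \int[mu]_(z in C) h z - \int[mu]_(z in C `&` E) h z)%E.
  move=> hi mE.
  have CE : C `&` E `|` C `&` ~` E = C by rewrite -setIUr setUv setIT.
  rewrite -{2}CE.
  rewrite integral_setU//; first last.
  - by apply/disj_setPS => z [[_ ?] [_ ?]].
  - by rewrite CE; exact: measurable_int hi.
  - by apply: measurableI => //; exact: measurableC.
  - exact: measurableI.
  rewrite addeAC subee ?add0e//.
  by apply: integrable_fin_num; [exact: measurableI|exact: intS].
have dH : dynkin H.
  split.
  - by split => //; rewrite setIT.
  - move=> E [mE fgE]; split; first exact: measurableC.
    by rewrite !splitE// fgE fgC.
  - move=> F tF HF; split; first by apply: bigcupT_measurable => k; exact: (HF k).1.
    rewrite setI_bigcupr !integral_bigcup//.
    + by apply: eq_eseriesr => k _; exact: (HF k).2.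
    + by apply: trivIset_setIl.
    + by move=> k; apply: measurableI => //; exact: (HF k).1.
    + rewrite -setI_bigcupr; apply: intS => //.
      by apply: bigcupT_measurable => k; exact: (HF k).1.
    + by apply: trivIset_setIl.
    + by move=> k; apply: measurableI => //; exact: (HF k).1.
    + rewrite -setI_bigcupr; apply: intS => //.
      by apply: bigcupT_measurable => k; exact: (HF k).1.
have HG : range rays `<=` H.
  by move=> _ [c _ <-]; split; [exact: measurable_rays|exact: fg].
have IG : setI_closed (range rays).
  by move=> _ _ [c _ <-] [c' _ <-]; rewrite raysI; eexists.
have mH E : measurable E -> H E.
  move/measurable_rays_generated; rewrite -setI_closed_g_dynkin_g_sigma_algebra//.
  by apply; split.
apply: integral_ae_eq => //; first exact: measurable_int gi.
move=> E EC mE; have [_] := mH _ mE.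
by rewrite (setIidr EC).
Qed.

End rays.

Section kernel_limit.
Context {R : realType} {n : nat}.
Local Notation T := (spacetime R n).
Local Notation mu := (@spacetime_measure R n).
Variables (e r : R).
Hypotheses (e0 : 0 < e) (e1 : 8 * e <= 1) (r0 : 0 < r).

Lemma measurable_ker d (S : measurableType d) (s X : R) (f g : S -> R) :
  measurable_fun setT f -> measurable_fun setT g ->
  measurable_fun setT (fun p => ker e s X (f p) (g p)).
Proof.
move=> mf mg; rewrite /ker; apply: measurable_funM; first exact: measurable_cst.
have : measurable_fun setT (bump1 : R -> R).
  by apply: continuous_measurable_fun; exact: (smooth_continuous smooth_bump).
move/measurableT_comp; apply; rewrite /kpos.
apply: measurable_funM; last exact: measurable_cst.
apply: measurable_funB => //; apply: measurable_funM => //.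
Qed.

Lemma measurable_pker2 (s : R) :
  measurable_fun setT (fun zz : T * T => pker e r s zz.1 zz.2).
Proof.
rewrite /pker /tensort /tensor; apply: measurable_funM.
  apply: measurable_prod => l _; apply: measurable_ker.
    apply: (measurableT_comp (measurable_coord l)).
    exact: (measurableT_comp measurable_fst measurable_fst).
  apply: (measurableT_comp (measurable_coord l)).
  exact: (measurableT_comp measurable_fst measurable_snd).
apply: measurable_ker.
  exact: (measurableT_comp measurable_snd measurable_fst).
exact: (measurableT_comp measurable_snd measurable_snd).
Qed.

Lemma pker_ge0 (s : R) (z zeta : T) : 0 <= s -> 0 <= pker e r s z zeta.
Proof.
move=> s0; rewrite /pker /tensort mulr_ge0//.
  by apply: prodr_ge0 => l _; apply: ker_ge0 => //; exact: ltW.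
by apply: ker_ge0 => //; exact: sqr_ge0.
Qed.

Lemma measurable_pker_center (s : R) (zeta : T) :
  measurable_fun setT (fun z : T => pker e r s z zeta).
Proof.
exact: (measurableT_comp (measurable_pker2 s) (measurable_pair2 zeta)).
Qed.

Definition pker_mass (s : R) : R := ((1 - s)^-1) ^+ n * (1 - s ^+ 2)^-1.

Lemma integral_pker_center (s : R) (zeta : T) : 0 < s -> s < 1 ->
  (\int[mu]_z (pker e r s z zeta)%:E = (pker_mass s)%:E)%E.
Proof.
move=> s0 s1.
have s20 : 0 < s ^+ 2 by rewrite exprn_gt0.
have s21 : s ^+ 2 < 1 by rewrite expr_lt1// ltW.
have mk (t X y : R) : measurable_fun setT ((fun x => ker e t X x y) : measurableTypeR R -> R).
  by apply: measurable_ker.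
transitivity (\int[mu]_z (tensort (fun l x => ker e s r x (zeta.1 ord0 l))
   (fun t => ker e (s ^+ 2) (r ^+ 2) t zeta.2) z)%:E)%E; first by [].
rewrite integral_tensort//.
- rewrite (eq_bigr (fun=> ((1 - s)^-1)%:E)); last first.
    by move=> l _; exact: integral_ker_center.
  rewrite integral_ker_center//; last exact: exprn_gt0.
  by rewrite prodEFin prodr_const card_ord -EFinM.
- by move=> l t; apply: ker_ge0 => //; exact: ltW.
- by move=> t; apply: ker_ge0 => //; exact: sqr_ge0.
Qed.

Lemma center_dist (s X x y : R) : 0 < s -> s <= 1 - e -> 0 < X -> `|y| <= X ->
  ker e s X x y != 0 -> `|x - y| <= s * (2 * X / e).
Proof.
move=> s0 s1 X0 yX /(ker_supp e0 s0 X0) H.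
have l0 : 0 < 1 - s by have := e0; lra.
have : (1 - s) * `|x - y| <= 2 * (s * X).
  rewrite -{1}(gtr0_norm l0) -normrM.
  have -> : (1 - s) * (x - y) = - (y - (1 - s) * x) + s * y by ring.
  rewrite (le_trans (ler_normD _ _))// normrN normrM (gtr0_norm s0).
  have -> : 2 * (s * X) = s * X + s * X by ring.
  apply: lerD; last by rewrite ler_wpM2l// ltW.
  by apply: (le_trans H); rewrite -mulrA ler_piMl ?mulr_ge0 ?(ltW s0) ?(ltW X0)//; have := e0; have := e1; lra.
move=> H2; have -> : s * (2 * X / e) = 2 * (s * X) / e by ring.
rewrite ler_pdivlMr//; apply: le_trans H2; rewrite mulrC ler_wpM2r//.
by lra.
Qed.

Let scale_cvg (c : R) : 0 <= c -> (1 - e) ^+ j * c @[j --> \oo] --> (0 : R).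
Proof.
move=> c0; rewrite -[X in _ --> X](mul0r c); apply: cvgM; last exact: cvg_cst.
apply: cvg_expr; rewrite ger0_norm; have := e0; have := e1; lra.
Qed.

Lemma pker_near (zeta : T) (d : R) : 0 < d ->
  (forall l, `|zeta.1 ord0 l| <= r) -> `|zeta.2 : R| <= r ^+ 2 ->
  \forall j \near \oo, forall z : T, pker e r ((1 - e) ^+ j.+1) z zeta != 0 ->
    (forall l, `|z.1 ord0 l - zeta.1 ord0 l| < d) /\ `|(z.2 : R) - zeta.2| < d.
Proof.
move=> d0 zr ztr.
have R0 : 0 < r ^+ 2 by rewrite exprn_gt0.
have k01 : 0 < 1 - e < 1 by have := e0; have := e1; lra.
case/andP : k01 => k0 k1.
near=> j => z.
have sj0 : 0 < (1 - e) ^+ j.+1 by rewrite exprn_gt0.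
have sj1 : (1 - e) ^+ j.+1 <= 1 - e by rewrite exprS ger_pMr// exprn_ile1// ltW.
have h1 : (1 - e) ^+ j * (2 * r / e) < d.
  near: j.
  apply: (cvgr_lt _ (scale_cvg _)) => //.
  by rewrite divr_ge0 ?mulr_ge0// ltW.
have h2 : (1 - e) ^+ j * (2 * r ^+ 2 / e) < d.
  near: j.
  apply: (cvgr_lt _ (scale_cvg _)) => //.
  by rewrite divr_ge0 ?mulr_ge0// ltW.
have sjj : (1 - e) ^+ j.+1 <= (1 - e) ^+ j by rewrite exprS ger_pMl ?exprn_gt0// ltW.
rewrite /pker /tensort mulf_eq0 negb_or => /andP[n1 n2]; split.
  move=> l; have := tensor_neq0 l n1.
  move/(center_dist sj0 sj1 r0 (zr l)) => H; apply: le_lt_trans H _.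
  by apply: le_lt_trans h1; rewrite ler_wpM2r// divr_ge0 ?mulr_ge0// ltW.
have s20 : 0 < ((1 - e) ^+ j.+1) ^+ 2 by rewrite exprn_gt0.
have s2s : ((1 - e) ^+ j.+1) ^+ 2 <= (1 - e) ^+ j.+1.
  by rewrite expr2 ger_pMl// (le_trans sj1)// ltW.
move/(center_dist s20 (le_trans s2s sj1) R0 ztr) : n2 => H; apply: le_lt_trans H _.
apply: le_lt_trans h2; rewrite ler_wpM2r//; last exact: le_trans s2s sjj.
by rewrite divr_ge0 ?mulr_ge0// ltW.
Unshelve. all: by end_near. Qed.

Lemma pker_mass_cvg : pker_mass ((1 - e) ^+ j.+1) @[j --> \oo] --> (1 : R).
Proof.
have k01 : `|1 - e| < 1 by rewrite ger0_norm; have := e0; have := e1; lra.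
have s : (1 - e) ^+ j.+1 @[j --> \oo] --> (0 : R).
  by rewrite (cvg_shiftS (fun j => (1 - e) ^+ j)); exact: cvg_expr.
have cX (f : nat -> R) (a : R) m : f j @[j --> \oo] --> a ->
    f j ^+ m @[j --> \oo] --> a ^+ m.
  move=> fa; elim: m => [|m IH]; first by under eq_fun do rewrite expr0; exact: cvg_cst.
  by under eq_fun do rewrite exprS; rewrite exprS; exact: cvgM.
have E : (1 : R) = ((1 - 0)^-1) ^+ n * (1 - 0 ^+ 2)^-1.
  by rewrite expr0n/= !subr0 invr1 expr1n mulr1.
rewrite [X in _ --> X]E; apply: cvgM.
  apply: cX; apply: cvgV; first by rewrite subr0 oner_eq0.
  by apply: cvgB => //; exact: cvg_cst.
apply: cvgV; first by rewrite expr0n/= subr0 oner_eq0.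
apply: cvgB; first exact: cvg_cst.
exact: cX.
Qed.

Lemma pker_mass_le (s : R) : 0 <= s -> s <= 1 - e -> pker_mass s <= e^-1 ^+ n.+1.
Proof.
move=> s0 s1; rewrite /pker_mass [e^-1 ^+ _]exprSr.
have h1 : (1 - s)^-1 <= e^-1 by rewrite lef_pV2 ?posrE//; have := e0; lra.
have s21 : s ^+ 2 <= s by rewrite expr2 ler_piMl//; have := e0; lra.
have h2 : (1 - s ^+ 2)^-1 <= e^-1.
  by rewrite lef_pV2 ?posrE//; have := e0; lra.
rewrite ler_pM//.
- by rewrite exprn_ge0// invr_ge0; have := e0; lra.
- by rewrite invr_ge0; have := e0; lra.
- by rewrite lerXn2r// nnegrE invr_ge0; have := e0; lra.
Qed.

Section limit.
Variable (C : set T).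
Hypotheses (mC : measurable C)
  (openC : forall z, C z -> \forall w \near (z : 'rV[R]_n * R), C w)
  (Cr : forall z, C z -> (forall l, `|z.1 ord0 l| <= r) /\ `|z.2 : R| <= r ^+ 2).

Definition pker_local (c : T) (j : nat) (zeta : T) : \bar R :=
  (\int[mu]_(z in C `&` rays c) (pker e r ((1 - e) ^+ j.+1) z zeta)%:E)%E.

Let sj j : 0 < (1 - e) ^+ j.+1 /\ (1 - e) ^+ j.+1 <= 1 - e.
Proof.
split; first by rewrite exprn_gt0//; have := e0; have := e1; lra.
have h : 0 <= 1 - e by have := e0; have := e1; lra.
by rewrite exprS ler_piMr// exprn_ile1//; have := e0; lra.
Qed.

Let sj1 j : (1 - e) ^+ j.+1 < 1. Proof. by have [_] := sj j; have := e0; lra. Qed.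

Lemma pker_local_ge0 c j zeta : (0 <= pker_local c j zeta)%E.
Proof.
by apply: integral_ge0 => z _; rewrite lee_fin pker_ge0//; have [/ltW] := sj j.
Qed.

Lemma pker_local_le c j zeta : (pker_local c j zeta <= (e^-1 ^+ n.+1)%:E)%E.
Proof.
have [s0 s1] := sj j.
apply: (@le_trans _ _ (pker_mass ((1 - e) ^+ j.+1))%:E).
  rewrite -(integral_pker_center zeta s0 (sj1 j)).
  apply: ge0_subset_integral => //.
  - by apply: measurableI => //; exact: measurable_rays.
  - by apply/measurable_EFinP; exact: measurable_pker_center.
  - by move=> z _; rewrite lee_fin pker_ge0// ltW.
by rewrite lee_fin pker_mass_le// ltW.
Qed.

Lemma pker_local_cvg (c zeta : T) : C zeta ->
  (forall l, zeta.1 ord0 l != c.1 ord0 l) -> (zeta.2 : R) != c.2 ->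
  pker_local c j zeta @[j --> \oo] --> ((\1_(rays c) zeta : R)%:E).
Proof.
move=> Cz nl nt; have [zr ztr] := Cr Cz.
have : \forall w \near (zeta : 'rV[R]_n * R), C w /\ (rays c w <-> rays c zeta).
  have n1 l : \forall w \near (zeta : 'rV[R]_n * R),
      (c.1 ord0 l < (w : 'rV[R]_n * R).1 ord0 l) = (c.1 ord0 l < zeta.1 ord0 l).
    have ct : (fun w : 'rV[R]_n * R => w.1 ord0 l) @ (zeta : 'rV[R]_n * R) --> zeta.1 ord0 l.
      apply: (@continuous_comp _ _ _ fst (fun y : 'rV[R]_n => y ord0 l)).
        exact: cvg_fst.
      exact: coord_continuous.
    have [h|h|h] := ltgtP (c.1 ord0 l) (zeta.1 ord0 l).
    - near=> w; have -> : c.1 ord0 l < w.1 ord0 l by near: w; exact: (cvgr_gt _ ct _ h).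
      by [].
    - near=> w; apply/negbTE; rewrite -leNgt; apply: ltW.
      by near: w; exact: (cvgr_lt _ ct _ h).
    - by have := nl l; rewrite h eqxx.
  have n2 : \forall w \near (zeta : 'rV[R]_n * R),
      ((c.2 : R) < (w : 'rV[R]_n * R).2) = ((c.2 : R) < zeta.2).
    have ct : (fun w : 'rV[R]_n * R => w.2) @ (zeta : 'rV[R]_n * R) --> (zeta.2 : R).
      exact: cvg_snd.
    have [h|h|h] := ltgtP (c.2 : R) (zeta.2 : R).
    - near=> w; have -> : (c.2 : R) < w.2 by near: w; exact: (cvgr_gt _ ct _ h).
      by [].
    - near=> w; apply/negbTE; rewrite -leNgt; apply: ltW.
      by near: w; exact: (cvgr_lt _ ct _ h).
    - by have := nt; rewrite h eqxx.
  have n1' := filter_forall _ n1.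
  near=> w; split; first by near: w; exact: openC.
  have e2 : ((c.2 : R) < w.2) = ((c.2 : R) < zeta.2).
    by near: w; exact: n2.
  have e3 : forall l, (c.1 ord0 l < w.1 ord0 l) = (c.1 ord0 l < zeta.1 ord0 l).
    by near: w; exact: n1'.
  rewrite /rays/= e2; split => -[h1 h2]; split => // l.
    by rewrite -e3.
  by rewrite e3.
move=> /nbhs_ballP[d /= d0 Hd].
have near0 := pker_near d0 zr ztr.
have inball (z : T) : (forall l, `|z.1 ord0 l - zeta.1 ord0 l| < d) /\ `|(z.2 : R) - zeta.2| < d ->
    C z /\ (rays c z <-> rays c zeta).
  move=> [h1 h2]; apply: Hd; split => /=.
    by split => // i l; rewrite (ord1 i) /ball/= distrC.
  by rewrite /ball/= distrC.
have [rz|rz] := pselect (rays c zeta).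
  rewrite indicE mem_set//.
  apply: (@cvg_trans _ ((pker_mass ((1 - e) ^+ j.+1))%:E @[j --> \oo])); last first.
    by apply: cvg_EFin; [exact: nearW|exact: pker_mass_cvg].
  apply: near_eq_cvg; near=> j.
  have Hj : forall z : T, pker e r ((1 - e) ^+ j.+1) z zeta != 0 ->
    (forall l, `|z.1 ord0 l - zeta.1 ord0 l| < d) /\ `|(z.2 : R) - zeta.2| < d by near: j.
  have [s0 _] := sj j.
  rewrite -(integral_pker_center zeta s0 (sj1 j)) /pker_local [in RHS]integral_mkcond.
  apply: eq_integral => z _; rewrite patchE; case: ifPn => // zC.
  congr EFin; apply/eqP; apply: contraNT zC => /Hj/inball[Cz' rr].
  by rewrite inE; split => //; exact/rr.
rewrite indicE memNset//.
apply: cvg_near_cst; near=> j.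
have Hj : forall z : T, pker e r ((1 - e) ^+ j.+1) z zeta != 0 ->
  (forall l, `|z.1 ord0 l - zeta.1 ord0 l| < d) /\ `|(z.2 : R) - zeta.2| < d by near: j.
apply: integral0_eq => z [_ rz'].
congr EFin; apply/eqP; apply/negPn/negP => /Hj/inball[_ rr].
by apply: rz; exact/rr.
Unshelve. all: by end_near. Qed.

End limit.
End kernel_limit.

Section fubini_more.
Context {R : realType} d1 d2 (T1 : measurableType d1) (T2 : measurableType d2).
Variables (m1 : {sigma_finite_measure set T1 -> \bar R})
  (m2 : {sigma_finite_measure set T2 -> \bar R}).

Lemma integrable_snd (A : set T1) (B : set T2) (f : T2 -> R) :
  measurable A -> measurable B -> (m1 A < +oo)%E -> m2.-integrable B (EFin \o f) ->
  (m1 \x m2)%E.-integrable (A `*` B) (fun z => (f z.2)%:E).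
Proof.
move=> mA mB Aoo fi.
have mAB : measurable (A `*` B) by exact: measurableX.
apply/(integrable_mkcond _ mAB).
pose g := (EFin \o f) \_ B.
have mg : measurable_fun setT g.
  by apply/(measurable_restrictT _ mB); exact: measurable_int fi.
have E : (fun z => (f z.2)%:E) \_ (A `*` B) = (fun z => (\1_A z.1 : R)%:E * g z.2)%E.
  apply/funext => -[x y]; rewrite /g !patchE in_setX indicE /=.
  by case: (x \in A); case: (y \in B); rewrite ?mul1e ?mul0e ?mule0.
rewrite E; apply/integrable12ltyP.
  apply: emeasurable_funM; last exact: (measurableT_comp mg measurable_snd).
  apply/measurable_EFinP.
  by apply: (measurableT_comp _ measurable_fst); exact: measurable_indic.
have I0 : (\int[m2]_y `|g y| = \int[m2]_(y in B) `|(f y)%:E|)%E.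
  by rewrite [RHS]integral_mkcond; apply: eq_integral => y _; rewrite /g !patchE; case: ifP => // _; rewrite abse0.
rewrite (eq_integral (fun x => (\1_A x : R)%:E * \int[m2]_(y in B) `|(f y)%:E|)%E); last first.
  move=> x _; rewrite -I0 -ge0_integralZl//; last exact: measurableT_comp.
  by apply: eq_integral => y _; rewrite abseM gee0_abs// lee_fin.
rewrite ge0_integralZr//.
- rewrite integral_indic// setIT lte_mul_pinfty//; last by case/integrableP : fi.
  by rewrite ge0_fin_numE.
- by apply/measurable_EFinP; exact: measurable_indic.
- by apply: integral_ge0.
Qed.

End fubini_more.

Section identification.
Context {R : realType} {n : nat}.
Local Notation T := (spacetime R n).
Local Notation mu := (@spacetime_measure R n).
Variables (Omega : set 'rV[R]_n) (r a e M : R) (u : 'rV[R]_n * R -> R).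
Hypotheses (r0 : 0 < r) (e0 : 0 < e) (ea : 8 * e <= a) (a1 : a <= 1).
Hypothesis star : star_domain r a Omega.
Hypotheses (M1 : 1 <= M) (bM : forall x : R, bump1 x <= M).
Local Notation I := (time_itv r 0).
Local Notation C := (Omega `*` I : set T).
Hypothesis ui : mu.-integrable C (EFin \o u).

Let e1 : 8 * e <= 1. Proof. exact: le_trans a1. Qed.

Lemma measurable_star_cylinder : measurable C.
Proof. by apply: measurableX; [case: star|exact: measurable_time_itv]. Qed.
Let mC := measurable_star_cylinder.

Lemma star_cylinder_sub : C `<=` pcube r (0, 0).
Proof. by case: star => _ _ OK _ z [h1 h2]; split => //; exact: OK. Qed.

Lemma star_cylinder_lty : (mu C < +oo)%E.
Proof.
apply: (@le_lt_trans _ _ (mu (pcube r (0, 0)))).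
  by apply: le_measure; rewrite ?inE//; [exact: measurable_pcube|exact: star_cylinder_sub].
by rewrite measure_pcube// ltry.
Qed.

Let Cr (z : T) : C z -> (forall l, `|z.1 ord0 l| <= r) /\ `|z.2 : R| <= r ^+ 2.
Proof.
move=> /star_cylinder_sub [h1 h2]; split.
  by move=> l; have := h1 l; rewrite mxE sub0r normrN; exact: ltW.
move: h2; rewrite /time_itv/= in_itv/= sub0r add0r => /andP[h2 h3].
by rewrite ler_norml; apply/andP; split; exact: ltW.
Qed.

Let openC (z : T) : C z -> \forall w \near (z : 'rV[R]_n * R), C w.
Proof.
move=> [h1 h2]; have [_ oO _ _] := star.
have n1 : \forall x \near z.1, Omega x by apply: open_nbhs_nbhs.
have n2 : \forall t \near (z.2 : R), I t.
  by apply: open_nbhs_nbhs; split => //; exact: itv_open.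
exists ([set x | Omega x], [set t | I t]) => //=.
Qed.

Let A j (z : T) : R := avg Omega u e r ((1 - e) ^+ j) z.

Let sj j : 0 < (1 - e) ^+ j /\ (1 - e) ^+ j <= 1.
Proof.
split; first by rewrite exprn_gt0//; have := e0; have := e1; lra.
by rewrite exprn_ile1//; have := e0; have := e1; lra.
Qed.

Let pker_meas s z : measurable_fun setT (pker e r s z : T -> R).
Proof. exact: (measurableT_comp (measurable_pker2 e r s) (measurable_pair1 z)). Qed.

Let Kj j : R := (4 * M / e ^+ 2 / ((1 - e) ^+ j * r)) ^+ n *
   (4 * M / e ^+ 2 / (((1 - e) ^+ j) ^+ 2 * r ^+ 2)).

Let pker_le j (z zeta : T) : `|pker e r ((1 - e) ^+ j) z zeta| <= Kj j.
Proof. by apply: (@pker_bound R n r a e M) => //; exact: (sj j).1. Qed.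

Let int_pker j (z : T) :
  mu.-integrable C (fun zeta => (u zeta * pker e r ((1 - e) ^+ j) z zeta)%:E).
Proof.
apply: (integrable_mulb mC ui) => [|zeta _]; last exact: pker_le.
exact: measurable_funTS.
Qed.

Let AE j (z : T) : ((A j z)%:E =
  \int[mu]_(zeta in C) (u zeta * pker e r ((1 - e) ^+ j) z zeta)%:E)%E.
Proof. exact (fineK (integrable_fin_num mC (int_pker j z))). Qed.

Let int2 j (P : set T) : measurable P ->
  (@sf_spacetime R n \x @sf_spacetime R n)%E.-integrable ((C `&` P) `*` C)
    (fun zz : T * T => (u zz.2 * pker e r ((1 - e) ^+ j) zz.1 zz.2)%:E).
Proof.
move=> mP; have mCP : measurable (C `&` P) by exact: measurableI.
apply: (integrable_mulb (M := Kj j)).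
- exact: measurableX.
- apply: integrable_snd => //; apply: le_lt_trans star_cylinder_lty.
  by apply: le_measure; rewrite ?inE.
- apply: measurable_funTS; exact: measurable_pker2.
- by move=> zz _; exact: pker_le.
Qed.

Lemma measurable_avg j : measurable_fun C (A j : T -> R).
Proof.
have [m _ _ _] := fubini_setX (measurableI _ _ mC measurableT) mC (int2 j measurableT).
rewrite setIT in m; apply/measurable_EFinP.
by apply: eq_measurable_fun m => z _ /=; rewrite AE.
Qed.

Let mlocal c j : measurable_fun setT (pker_local e r C c j).
Proof.
have mCP : measurable (C `&` rays c) by apply: measurableI => //; exact: measurable_rays.
pose D := (C `&` rays c) `*` (setT : set T).
have mD : measurable D by exact: measurableX.
pose F := (fun zz : T * T => (pker e r ((1 - e) ^+ j.+1) zz.1 zz.2)%:E) \_ D.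
have mF : measurable_fun setT F.
  apply/(measurable_restrictT _ mD); apply: measurable_funTS.
  by apply/measurable_EFinP; exact: measurable_pker2.
have F0 zz : (0 <= F zz)%E.
  rewrite /F patchE; case: ifP => // _; rewrite lee_fin.
  by apply: pker_ge0 => //; exact: ltW (sj j.+1).1.
have := @measurable_fun_fubini_tonelli_G _ _ T T R (@sf_spacetime R n) F mF F0.
apply: eq_measurable_fun => zeta _; rewrite /fubini_G /pker_local.
rewrite [RHS]integral_mkcond; apply: eq_integral => z _.
by rewrite /F !patchE /D in_setX in_setT andbT.
Qed.

Let avg_local c j : (\int[mu]_(z in C `&` rays c) (A j.+1 z)%:E =
  \int[mu]_(zeta in C) ((u zeta)%:E * pker_local e r C c j zeta))%E.
Proof.
have mP := measurable_rays c.
have mCP : measurable (C `&` rays c) by exact: measurableI.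
have [_ _ H12 H21] := fubini_setX mCP mC (int2 j.+1 mP).
transitivity (\int[mu]_(z in C `&` rays c)
   \int[mu]_(zeta in C) (u zeta * pker e r ((1 - e) ^+ j.+1) z zeta)%:E)%E.
  by apply: eq_integral => z _; rewrite AE.
transitivity (\int[mu]_(zeta in C)
   \int[mu]_(z in C `&` rays c) (u zeta * pker e r ((1 - e) ^+ j.+1) z zeta)%:E)%E.
  exact: (etrans (esym H12) H21).
apply: eq_integral => zeta _.
rewrite /pker_local -integralZl//.
apply/integrableP; split.
  by apply/measurable_EFinP; apply: measurable_funTS; exact: measurable_pker_center.
rewrite (eq_integral (fun z : T => (pker e r ((1 - e) ^+ j.+1) z zeta)%:E)); last first.
  move=> z _; rewrite gee0_abs// lee_fin.
  by apply: pker_ge0 => //; exact: ltW (sj j.+1).1.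
exact: le_lt_trans (pker_local_le e0 e1 r0 mC c j zeta) (ltry _).
Qed.

Let null_coord (c : R) l : mu [set z : T | z.1 ord0 l = c] = 0%E.
Proof.
rewrite (_ : mkset _ = [set x : 'rV[R]_n | forall i,
    (if i == l then [set c] else setT) (x ord0 i)] `*` setT); last first.
  apply/seteqP; split => z /=; first by move=> zc; split => // i; case: eqP => [->|].
  by move=> [/(_ l)]; rewrite eqxx.
have mA i : measurable ((if i == l then [set c] else setT) : set (measurableTypeR R)).
  by case: ifP => _ //; exact: measurable_set1.
have mB := @measurable_box R n (fun i => if i == l then [set c] else setT) mA.
rewrite [LHS](product_measure1E _ _ mB measurableT).
rewrite [X in (X * _)%E](_ : _ = 0%E) ?mul0e//.
rewrite [LHS](@lebesgue_rV_box R n (fun i => if i == l then [set c] else setT))//.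
by rewrite (bigD1 l)//= eqxx lebesgue_measure_set1 mul0e.
Qed.

Let null_time (c : R) : mu [set z : T | (z.2 : R) = c] = 0%E.
Proof.
rewrite (_ : mkset _ = setT `*` ([set c] : set (measurableTypeR R))); last first.
  by apply/seteqP; split => z /=; [move=> ->|case].
have ms : measurable ([set c] : set (measurableTypeR R)) by exact: measurable_set1.
rewrite [LHS](product_measure1E _ _ measurableT ms).
by rewrite [X in (_ * X)%E]lebesgue_measure_set1 mule0.
Qed.

Let mset_coord (c : R) l : measurable [set z : T | z.1 ord0 l = c].
Proof.
rewrite (_ : mkset _ = setT `&` (fun z : T => z.1 ord0 l) @^-1` [set c]); last by rewrite setTI.
exact: (measurableT_comp (measurable_coord l) measurable_fst).
Qed.

Let mset_time (c : R) : measurable [set z : T | (z.2 : R) = c].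
Proof.
rewrite (_ : mkset _ = setT `&` (fun z : T => (z.2 : R)) @^-1` [set c]); last by rewrite setTI.
exact: measurable_snd.
Qed.

Lemma weak_cvg c : (\int[mu]_(z in C `&` rays c) (A j.+1 z)%:E)%E @[j --> \oo] -->
  (\int[mu]_(z in C `&` rays c) (u z)%:E)%E.
Proof.
under eq_fun do rewrite avg_local.
have mP := measurable_rays c.
have -> : (\int[mu]_(z in C `&` rays c) (u z)%:E =
   \int[mu]_(z in C) ((u z)%:E * (\1_(rays c) z : R)%:E))%E.
  rewrite integral_mkcondr; apply: eq_integral => z _; rewrite patchE indicE.
  by case: (z \in rays c); rewrite ?mule1 ?mule0.
have mu_ : measurable_fun C (EFin \o u) by exact: measurable_int ui.
have [] // := @dominated_convergence _ _ _ mu C mC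
  (fun j z => ((u z)%:E * pker_local e r C c j z)%E)
  (fun z => ((u z)%:E * (\1_(rays c) z : R)%:E)%E)
  (fun z => ((e^-1 ^+ n.+1)%:E * `|(u z)%:E|)%E).
- by move=> j; apply: emeasurable_funM => //; exact: measurable_funTS.
- apply: emeasurable_funM => //; apply/measurable_EFinP.
  by apply: measurable_funTS; exact: measurable_indic.
- have ae1 : {ae mu, forall z : T, forall l, z.1 ord0 l != c.1 ord0 l}.
    apply: filter_forall => l; exists [set z : T | z.1 ord0 l = c.1 ord0 l]; split => //.
    by move=> z /= /negP/negbNE/eqP.
  have ae2 : {ae mu, forall z : T, (z.2 : R) != c.2}.
    exists [set z : T | (z.2 : R) = c.2]; split => //.
    by move=> z /= /negP/negbNE/eqP.
  apply: filterS2 ae1 ae2 => z h1 h2 Cz.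
  apply: cvgeZl => //.
  exact: (pker_local_cvg e0 e1 r0 openC Cr).
- by apply: integrableZl => //; exact: integrable_abse.
- apply: aeW => z j Cz; rewrite abseM muleC lee_wpmul2r//.
  rewrite gee0_abs; first exact: pker_local_le.
  exact: pker_local_ge0.
Qed.

Lemma avg1_cst (z : T) : avg Omega u e r 1 z = avg Omega u e r 1 (0, 0).
Proof.
have kE (s X x x' y : R) : s = 1 -> ker e s X x y = ker e s X x' y.
  by move=> ->; rewrite /ker /kpos subrr !mul0r.
have E : pker e r 1 z = pker e r 1 (0, 0).
  apply/funext => zeta; rewrite /pker /tensort /tensor.
  rewrite (kE (1 ^+ 2) (r ^+ 2) z.2 0 zeta.2 (expr1n _ 2)).
  f_equal; apply: eq_bigr => l _; exact: kE erefl.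
by rewrite /avg E.
Qed.

Lemma avg_cvg_ae (S : T -> \bar R) : measurable_fun C S ->
  (\int[mu]_(z in C) S z < +oo)%E -> (forall z, C z -> (0 <= S z)%E) ->
  (forall z j, C z -> (`|A j z - A 0 z|%:E <= S z)%E) ->
  (forall z, C z -> (S z < +oo)%E -> cvgn (fun j => A j z)) ->
  {ae mu, forall z, C z -> A j z @[j --> \oo] --> u z}.
Proof.
move=> mS Soo S0 AS Acvg.
have mA := measurable_avg.
have Si : mu.-integrable C S.
  apply/integrableP; split => //; rewrite (eq_integral S)// => z; rewrite inE => Cz.
  by rewrite gee0_abs// S0.
have Sfin : {ae mu, forall z, C z -> (S z < +oo)%E}.
  have := integrable_ae mC Si; apply: filterS => z H Cz.
  by have := H Cz; rewrite fin_numE => /andP[_]; rewrite ltey.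
pose A0 := avg Omega u e r 1 (0, 0).
have A0E z : A 0%N z = A0 by rewrite /A expr0 avg1_cst.
pose ut z := limn_esup (fun j => (A j.+1 z)%:E).
have mut : measurable_fun C ut.
  by apply: measurable_fun_limn_esup => j; apply/measurable_EFinP.
have utcvg z : C z -> (S z < +oo)%E -> (A j.+1 z)%:E @[j --> \oo] --> ut z.
  move=> Cz Sz; have cA := Acvg _ Cz Sz.
  have cA1 : cvgn (fun j => (A j.+1 z)%:E).
    apply/cvg_ex; exists (limn (fun j => A j z))%:E; apply: cvg_EFin; first exact: nearW.
    by rewrite (cvg_shiftS (fun j => A j z)).
  by rewrite /ut is_cvg_limn_esupE.
pose g z := (`|A0|%:E + S z)%E.
have A0i : mu.-integrable C (fun=> `|A0|%:E).
  apply/integrableP; split; first exact: measurable_cst.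
  rewrite integral_cst// lte_mul_pinfty ?star_cylinder_lty// ?fin_numE//.
have gi : mu.-integrable C g by exact: integrableD.
have DCT c : mu.-integrable (C `&` rays c) ut /\
   (\int[mu]_(z in C `&` rays c) (A j.+1 z)%:E)%E @[j --> \oo] -->
   (\int[mu]_(z in C `&` rays c) ut z)%E.
  have mCP : measurable (C `&` rays c) by apply: measurableI => //; exact: measurable_rays.
  have sub : C `&` rays c `<=` C by move=> ? [].
  have [] // := @dominated_convergence _ _ _ mu _ mCP (fun j z => (A j.+1 z)%:E) ut g.
  - by move=> j; apply: measurable_funS (mC) sub _; apply/measurable_EFinP.
  - exact: measurable_funS (mC) sub _.
  - by apply: filterS Sfin => z H [Cz _]; exact: utcvg (H Cz).
  - exact: integrableS gi.
  - apply: aeW => z j [Cz _]; rewrite /g.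
    have tri (x y b : R) : b = y -> `|x| <= `|y| + `|x - b|.
      by move=> ->; rewrite -lerBlDl lerB_dist.
    apply: (@le_trans _ _ (`|A0| + `|A j.+1 z - A 0%N z|)%:E).
      by rewrite lee_fin; exact: (tri _ _ _ (A0E z)).
    by rewrite EFinD leeD2l// AS.
pose c0 : T := (const_mx (- r), - r ^+ 2).
have Cc0 : C `<=` rays c0.
  move=> z /star_cylinder_sub [h1 h2]; split => /=.
    move=> i; rewrite mxE; have := h1 i; rewrite mxE sub0r normrN ltr_norml.
    by case/andP.
  by move: h2; rewrite /time_itv/= in_itv/= sub0r => /andP[].
have ui_t : mu.-integrable C ut by have [] := DCT c0; rewrite (setIidl Cc0).
have aeq : ae_eq mu C ut (EFin \o u).
  apply: (ae_eq_rays mC Cc0) => // c.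
  have [_ h] := DCT c; rewrite -(cvg_lim _ h)// -(cvg_lim _ (@weak_cvg c))//.
apply: filterS2 Sfin aeq => z H1 H2 Cz.
have H := utcvg z Cz (H1 Cz); rewrite (H2 Cz) in H.
have H' : A j.+1 z @[j --> \oo] --> u z by exact: fine_cvg H.
have sh (f : nat -> R) (l : R) : f j.+1 @[j --> \oo] --> l -> f j @[j --> \oo] --> l.
  by rewrite cvg_shiftS.
exact: (sh (fun j => A j z) _ H').
Qed.

End identification.

Section powR_lemmas.
Context {R : realType}.

Lemma powR_pred (p x : R) : 0 < x -> x `^ p = x `^ (p - 1) * x.
Proof.
move=> x0; rewrite -{3}(powRr1 (ltW x0)) -powRD ?subrK//.
by apply/implyP => _; rewrite gt_eqF.
Qed.

Lemma powR_invl (p x : R) : 0 <= x -> x^-1 `^ p = (x `^ p)^-1.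
Proof. by move=> x0; rewrite -powR_inv1// powRAC powR_inv1// powR_ge0. Qed.

(* The optimal choice is [t = J / (2 * Y)]. *)
Lemma powR_split_opt (p J X Y : R) : 1 < p -> 0 <= J -> 0 <= X -> 0 <= Y ->
  (forall t, 0 < t -> J <= (t `^ (p - 1))^-1 * X + t * Y) ->
  J `^ p <= 2 `^ p * X * Y `^ (p - 1).
Proof.
move=> hp J0 X0 Y0 H.
have p10 : 0 < p - 1 by lra.
have [->|Jn0] := eqVneq J 0.
  by rewrite powR0 ?mulr_ge0 ?powR_ge0//; lra.
have Jp : 0 < J by rewrite lt_neqAle eq_sym Jn0.
have [Y00|Yn0] := eqVneq Y 0.
  exfalso; have [X00|Xn0] := eqVneq X 0.
    by have := H 1 ltr01; rewrite X00 Y00 !mulr0 addr0; lra.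
  have Xp : 0 < X by rewrite lt_neqAle eq_sym Xn0.
  have q0 : 0 < 2 * X / J by rewrite divr_gt0 ?mulr_gt0.
  have := H _ (powR_gt0 (p - 1)^-1 q0).
  rewrite Y00 mulr0 addr0 -powRrM mulVf ?gt_eqF// powRr1 ?(ltW q0)//.
  have -> : (2 * X / J)^-1 * X = J / 2 by field; rewrite Xn0 Jn0.
  lra.
have Yp : 0 < Y by rewrite lt_neqAle eq_sym Yn0.
pose t := J / (2 * Y).
have t0 : 0 < t by rewrite divr_gt0 ?mulr_gt0.
have tp : 0 < t `^ (p - 1) by exact: powR_gt0.
have := H t t0; have -> : t * Y = J / 2 by rewrite /t; field.
move=> h; have h2 : J / 2 <= (t `^ (p - 1))^-1 * X by lra.
have h3 : t `^ (p - 1) * J <= 2 * X.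
  by move: h2; rewrite ler_pdivlMl//; lra.
have -> : J `^ p = t `^ (p - 1) * J * (2 * Y) `^ (p - 1).
  rewrite mulrAC -powRM ?(ltW t0) ?mulr_ge0//.
  by have -> : t * (2 * Y) = J; [rewrite /t; field|rewrite -powR_pred].
apply: (le_trans (ler_wpM2r (powR_ge0 _ _) h3)).
by rewrite powRM// (powR_pred p (ltr0Sn R 1)) le_eqVlt; apply/orP; left; apply/eqP; ring.
Qed.

End powR_lemmas.

Section weighted_hoelder.
Context {R : realType} {n : nat}.
Local Notation T := (spacetime R n).
Local Notation mu := (@spacetime_measure R n).
Variables (p : R) (w : 'rV[R]_n * R -> R).
Hypotheses (hp : 1 < p) (w0 : forall z, 0 <= w z)
  (mw : measurable_fun setT (w : T -> R)).

Lemma dual_weight_ge0 z : (0 <= dual_weight p w z)%E.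
Proof. by rewrite /dual_weight; case: ifP => // _; rewrite lee_fin powR_ge0. Qed.

Lemma measurable_dual_weight : measurable_fun setT (dual_weight p w : T -> \bar R).
Proof.
have mp : measurable_fun setT (fun z : T => w z `^ (- (p - 1)^-1)).
  exact: (measurableT_comp (measurable_powR _) mw).
apply: measurable_fun_ifT => //; last exact/measurable_EFinP.
exact: measurable_fun_eqr.
Qed.

Lemma le_dual_split (z : T) (x t : R) : 0 <= x -> 0 < t ->
  (x%:E <= ((t `^ (p - 1))^-1)%:E * (x `^ p * w z)%:E + t%:E * dual_weight p w z)%E.
Proof.
move=> x0 t0; have p10 : 0 < p - 1 by have := hp; lra.
have tp := powR_gt0 (p - 1) t0.
rewrite /dual_weight; case: eqP => [wz|/eqP wz].
  by rewrite gt0_muley ?lte_fin// addey ?leey.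
have wp : 0 < w z by rewrite lt_neqAle eq_sym wz w0.
rewrite -!EFinM -EFinD lee_fin.
have [h|h] := leP x (t * w z `^ (- (p - 1)^-1)).
  by apply: (le_trans h); rewrite lerDr !mulr_ge0 ?invr_ge0 ?powR_ge0.
apply: ler_wpDr; first by rewrite mulr_ge0 ?powR_ge0// ltW.
have xp : 0 < x by apply: le_lt_trans h; rewrite mulr_ge0 ?powR_ge0// ltW.
rewrite ler_pdivlMl// (powR_pred p xp) mulrAC ler_wpM2r//.
rewrite -ler_pdivrMr//.
have -> : t `^ (p - 1) / w z = (t * w z `^ (- (p - 1)^-1)) `^ (p - 1).
  rewrite powRM ?powR_ge0 ?ltW// -powRrM mulNr mulVf ?gt_eqF//.
  by rewrite powR_inv1// ltW.
by apply: ge0_ler_powR; rewrite ?nnegrE ?mulr_ge0 ?powR_ge0 ?ltW.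
Qed.

Lemma weighted_hoelder (E : set T) (f : T -> R) (X Y : R) :
  measurable E -> measurable_fun E f -> (forall z, E z -> 0 <= f z) ->
  (\int[mu]_(z in E) (f z `^ p * w z)%:E <= X%:E)%E ->
  (\int[mu]_(z in E) dual_weight p w z <= Y%:E)%E ->
  (\int[mu]_(z in E) (f z)%:E < +oo)%E /\
  (fine (\int[mu]_(z in E) (f z)%:E)%E) `^ p <= 2 `^ p * X * Y `^ (p - 1).
Proof.
move=> mE mf f0 hX hY.
have mw' : measurable_fun E w by exact: measurable_funTS.
have md : measurable_fun E (dual_weight p w).
  by apply: measurable_funTS; exact: measurable_dual_weight.
have mfw : measurable_fun E (fun z => (f z `^ p * w z)%:E).
  apply/measurable_EFinP; apply: measurable_funM => //.
  exact: (measurableT_comp (measurable_powR _) mf).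
have fw0 z : E z -> (0 <= (f z `^ p * w z)%:E)%E.
  by move=> _; rewrite lee_fin mulr_ge0 ?powR_ge0.
have X0 : 0 <= X by rewrite -lee_fin; apply: le_trans hX; exact: integral_ge0.
have Y0 : 0 <= Y.
  by rewrite -lee_fin; apply: le_trans hY; apply: integral_ge0 => z _; exact: dual_weight_ge0.
have H t : 0 < t -> (\int[mu]_(z in E) (f z)%:E <= ((t `^ (p - 1))^-1 * X + t * Y)%:E)%E.
  move=> t0; have ti : 0 <= (t `^ (p - 1))^-1 by rewrite invr_ge0 powR_ge0.
  apply: (@le_trans _ _ (\int[mu]_(z in E) (((t `^ (p - 1))^-1)%:E * (f z `^ p * w z)%:E
     + t%:E * dual_weight p w z))%E).
    apply: ge0_le_integral => //.
    - by apply/measurable_EFinP.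
    - by apply: emeasurable_funD; exact: measurable_funeM.
    - by move=> z Ez; apply: le_dual_split => //; exact: f0.
  rewrite ge0_integralD//=.
  - rewrite ge0_integralZl_EFin// ge0_integralZl_EFin//; last exact: ltW.
      by rewrite EFinD !EFinM leeD// lee_wpmul2l// lee_fin// ltW.
    by move=> z _; exact: dual_weight_ge0.
  - by move=> z Ez; apply: mule_ge0; [rewrite lee_fin|exact: fw0].
  - exact: measurable_funeM.
  - by move=> z _; apply: mule_ge0; [rewrite lee_fin ltW|exact: dual_weight_ge0].
  - exact: measurable_funeM.
have i0 : (0 <= \int[mu]_(z in E) (f z)%:E)%E by exact: integral_ge0.
have ioo : (\int[mu]_(z in E) (f z)%:E < +oo)%E.
  exact: le_lt_trans (H 1 ltr01) (ltry _).
split => //; apply: powR_split_opt => //; first exact: fine_ge0.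
by move=> t t0; rewrite -lee_fin fineK ?H// ge0_fin_numE.
Qed.

End weighted_hoelder.

Lemma powR_exprn {R : realType} (x p : R) j : 0 <= x -> (x ^+ j) `^ p = (x `^ p) ^+ j.
Proof. by move=> x0; rewrite -powR_mulrn// powRAC powR_mulrn// powR_ge0. Qed.

Section Ap_consequences.
Context {R : realType} {n : nat}.
Local Notation T := (spacetime R n).
Local Notation mu := (@spacetime_measure R n).
Local Notation pv := (@pvol R n).
Variables (p A : R) (w : 'rV[R]_n * R -> R).
Hypotheses (hp : 1 < p) (A1 : 1 <= A) (wAp : Ap_weight p w)
  (wA : (Ap_const p w <= A%:E)%E).

Definition wmass (z : T) (rho : R) : R := fine (\int[mu]_(zeta in pcube rho z) (w zeta)%:E)%E.
Definition dmass (z : T) (rho : R) : R :=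
  fine (\int[mu]_(zeta in pcube rho z) dual_weight p w zeta)%E.

Let w0 z : 0 <= w z. Proof. by have [[]] := wAp. Qed.
Let mw : measurable_fun setT (w : T -> R). Proof. by have [[]] := wAp. Qed.
Let p10 : 0 < p - 1. Proof. by have := hp; lra. Qed.
Let p0 : 0 <= p. Proof. by have := hp; lra. Qed.
Let pv0 rho : 0 < rho -> 0 < pv rho. Proof. exact: pvol_gt0. Qed.
Let A0 : 0 < A. Proof. exact: lt_le_trans A1. Qed.

Lemma emean_lty_integral (z : T) rho (f : T -> \bar R) : 0 < rho ->
  (emean (pcube rho z) f < +oo)%E -> (\int[mu]_(zeta in pcube rho z) f zeta < +oo)%E.
Proof.
move=> r0; rewrite /emean measure_pcube//= !ltNge !leye_eq; apply: contra => /eqP ->.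
by rewrite gt0_muley// lte_fin invr_gt0 pv0.
Qed.

Lemma wmassE z rho : 0 < rho ->
  (\int[mu]_(zeta in pcube rho z) (w zeta)%:E)%E = (wmass z rho)%:E.
Proof.
move=> r0; rewrite /wmass fineK// ge0_fin_numE.
  by have [_ h _] := wAp; apply: emean_lty_integral => //; exact: (h z rho r0).1.
by apply: integral_ge0 => x _; rewrite lee_fin.
Qed.

Lemma dmassE z rho : 0 < rho ->
  (\int[mu]_(zeta in pcube rho z) dual_weight p w zeta)%E = (dmass z rho)%:E.
Proof.
move=> r0; rewrite /dmass fineK// ge0_fin_numE.
  by have [_ h _] := wAp; apply: emean_lty_integral => //; exact: (h z rho r0).2.
by apply: integral_ge0 => x _; exact: dual_weight_ge0.
Qed.

Lemma dmass_ge0 z rho : 0 <= dmass z rho.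
Proof. by apply: fine_ge0; apply: integral_ge0 => x _; exact: dual_weight_ge0. Qed.

Lemma wmass_dmass_le z rho : 0 < rho ->
  wmass z rho * dmass z rho `^ (p - 1) <= A * pv rho `^ p.
Proof.
move=> r0; have v0 := pv0 r0.
have : (emean (pcube rho z) (EFin \o w) *
    emean (pcube rho z) (dual_weight p w) `^ (p - 1) <= A%:E)%E.
  by apply: le_trans wA; apply: ereal_sup_ubound; exists z, rho.
rewrite /emean measure_pcube//= wmassE// dmassE// -!EFinM lee_fin.
rewrite powRM ?dmass_ge0 ?invr_ge0 ?(ltW v0)//.
have vp : 0 < pv rho `^ (p - 1) by exact: powR_gt0.
rewrite (powR_invl _ (ltW v0)) (powR_pred p v0) => h.
have -> : wmass z rho * dmass z rho `^ (p - 1) = pv rho `^ (p - 1) * pv rho *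
    ((pv rho)^-1 * wmass z rho * ((pv rho `^ (p - 1))^-1 * dmass z rho `^ (p - 1))).
  by field; rewrite !gt_eqF.
by rewrite mulrC ler_wpM2r// mulr_ge0// ltW.
Qed.

Lemma measure_le_wmass_dmass (E : set T) (X Y : R) : measurable E ->
  (\int[mu]_(z in E) (w z)%:E <= X%:E)%E ->
  (\int[mu]_(z in E) dual_weight p w z <= Y%:E)%E ->
  fine (mu E) `^ p <= 2 `^ p * X * Y `^ (p - 1).
Proof.
move=> mE hX hY.
have [] // := @weighted_hoelder R n p w hp w0 mw E (fun=> 1) X Y mE.
  by under eq_integral do rewrite powR1 mul1r.
by move=> _; rewrite integral_cst// mul1e.
Qed.

Lemma pvol_le_wmass_dmass z rho : 0 < rho ->
  pv rho `^ p <= 2 `^ p * wmass z rho * dmass z rho `^ (p - 1).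
Proof.
move=> r0; have := @measure_le_wmass_dmass (pcube rho z) (wmass z rho) (dmass z rho).
rewrite measure_pcube//; apply; first exact: measurable_pcube.
  by rewrite wmassE.
by rewrite dmassE.
Qed.

Lemma wmass_ge0 z rho : 0 <= wmass z rho.
Proof. by apply: fine_ge0; apply: integral_ge0 => x _; rewrite lee_fin. Qed.

Lemma wmass_gt0 z rho : 0 < rho -> 0 < wmass z rho.
Proof.
move=> r0; rewrite lt_neqAle wmass_ge0 andbT eq_sym; apply/eqP => h.
have := pvol_le_wmass_dmass z r0; rewrite h mulr0 mul0r leNgt powR_gt0//.
exact: pv0.
Qed.

Lemma dmass_gt0 z rho : 0 < rho -> 0 < dmass z rho.
Proof.
move=> r0; rewrite lt_neqAle dmass_ge0 andbT eq_sym; apply/eqP => h.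
have := pvol_le_wmass_dmass z r0; rewrite h powR0 ?gt_eqF// mulr0 leNgt powR_gt0//.
exact: pv0.
Qed.

Lemma wmass_compare z rho z' rho' : 0 < rho -> 0 < rho' ->
  pcube rho' z' `<=` pcube rho z ->
  wmass z rho * pv rho' `^ p <= 2 `^ p * A * pv rho `^ p * wmass z' rho'.
Proof.
move=> r0 r'0 sub.
have d0 := dmass_gt0 z r0; have d'0 := dmass_gt0 z' r'0.
have dd : dmass z' rho' <= dmass z rho.
  rewrite -lee_fin -!dmassE//; apply: ge0_subset_integral => //.
  - exact: measurable_pcube.
  - exact: measurable_pcube.
  - by apply: measurable_funTS; exact: measurable_dual_weight.
  - by move=> x _; exact: dual_weight_ge0.
have dp : 0 < dmass z rho `^ (p - 1) by exact: powR_gt0.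
have dd' : dmass z' rho' `^ (p - 1) <= dmass z rho `^ (p - 1).
  by apply: ge0_ler_powR; rewrite ?nnegrE ?dmass_ge0// ltW.
rewrite -(ler_pM2r dp).
apply: (@le_trans _ _ (A * pv rho `^ p * pv rho' `^ p)).
  by rewrite mulrAC ler_wpM2r ?powR_ge0// wmass_dmass_le.
have -> : 2 `^ p * A * pv rho `^ p * wmass z' rho' * dmass z rho `^ (p - 1) =
   A * pv rho `^ p * (2 `^ p * wmass z' rho' * dmass z rho `^ (p - 1)) by ring.
apply: ler_wpM2l; first by rewrite mulr_ge0 ?powR_ge0 ?ltW.
apply: (le_trans (pvol_le_wmass_dmass z' r'0)).
by rewrite ler_wpM2l// mulr_ge0 ?powR_ge0 ?wmass_ge0.
Qed.

Definition doubling_const : R := 2 `^ p * A * (2 ^+ n.+2) `^ p.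

Lemma pcube_center_sub rho (z zeta : T) : 0 < rho -> pcube rho zeta z ->
  pcube rho z `<=` pcube (2 * rho) zeta.
Proof.
move=> r0 [h1 h2] y [h3 h4]; split.
  move=> i; apply: le_lt_trans (ler_distD (z.1 ord0 i) _ _) _.
  by have := h1 i; have := h3 i; lra.
move: h2 h4; rewrite /time_itv/= !in_itv/= exprMn => /andP[a1 a2] /andP[a3 a4].
have : 0 < rho ^+ 2 by rewrite exprn_gt0.
by move=> ?; apply/andP; split; lra.
Qed.

Lemma wmass_sub z rho z' rho' : 0 < rho -> 0 < rho' ->
  pcube rho' z' `<=` pcube rho z -> wmass z' rho' <= wmass z rho.
Proof.
move=> r0 r'0 sub; rewrite -lee_fin -!wmassE//; apply: ge0_subset_integral => //.
- exact: measurable_pcube.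
- exact: measurable_pcube.
- by apply/measurable_EFinP; exact: measurable_funTS.
- by move=> x _; rewrite lee_fin.
Qed.

Lemma wmass_doubling rho (z zeta : T) : 0 < rho -> pcube rho zeta z ->
  wmass zeta rho <= doubling_const * wmass z rho.
Proof.
move=> r0 zz; have r20 : 0 < 2 * rho by rewrite mulr_gt0.
have v0 : 0 < pv rho `^ p by rewrite powR_gt0// pv0.
have := wmass_compare r20 r0 (pcube_center_sub r0 zz).
rewrite pvolZ powRM ?exprn_ge0 ?(ltW (pv0 r0))// => h.
apply: (@le_trans _ _ (wmass zeta (2 * rho))).
  apply: wmass_sub => // y [h1 h2]; split.
    by move=> i; apply: (lt_trans (h1 i)); lra.
  move: h2; rewrite /time_itv/= !in_itv/= exprMn => /andP[a1 a2].
  have : 0 < rho ^+ 2 by rewrite exprn_gt0.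
  by move=> ?; apply/andP; split; lra.
rewrite -(ler_pM2r v0); apply: (le_trans h).
by rewrite le_eqVlt; apply/orP; left; apply/eqP; rewrite /doubling_const; ring.
Qed.

Section reverse_doubling.
Variable e : R.
Hypotheses (e0 : 0 < e) (e1 : 2 * e <= 1).

Definition dual_decay : R := 1 - (e `^ p / (2 `^ p * A)) `^ ((p - 1)^-1).

Let ratio_itv : 0 < e `^ p / (2 `^ p * A) < 1.
Proof.
have h2 : 1 < 2 `^ p.
  apply: (@le_lt_trans _ _ (1 `^ p)); first by rewrite powR1.
  apply: gt0_ltr_powR; rewrite ?nnegrE//; have := hp; lra.
have h1 : 1 < 2 `^ p * A by apply: (lt_le_trans h2); rewrite ler_peMr// powR_ge0.
have h0 : 0 < 2 `^ p * A by exact: lt_trans h1.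
rewrite divr_gt0 ?powR_gt0//= ltr_pdivrMr// mul1r; apply: le_lt_trans h1.
apply: (@le_trans _ _ (1 `^ p)); last by rewrite powR1.
by apply: ge0_ler_powR; rewrite ?nnegrE//; have := e1; have := e0; lra.
Qed.

Lemma dual_decay_itv : 0 < dual_decay < 1.
Proof.
have /andP[h1 h2] := ratio_itv; rewrite /dual_decay subr_gt0 ltrBlDr ltrDl powR_gt0//.
rewrite andbT; apply: (@lt_le_trans _ _ (1 `^ (p - 1)^-1)); last by rewrite powR1.
by apply: gt0_ltr_powR; rewrite ?nnegrE ?invr_gt0// ltW.
Qed.

Lemma dmass_shrink z rho : 0 < rho -> dmass z ((1 - e) * rho) <= dual_decay * dmass z rho.
Proof.
move=> r0; have k0 : 0 < 1 - e by have := e1; have := e0; lra.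
have r'0 : 0 < (1 - e) * rho by rewrite mulr_gt0.
pose E : set T := pcube rho z `\` pcube ((1 - e) * rho) z.
have mQ := @measurable_pcube R n rho z.
have mQ' := @measurable_pcube R n ((1 - e) * rho) z.
have mE : measurable E by exact: measurableD.
have v0 := pv0 r0; have vp : 0 < pv rho `^ p by exact: powR_gt0.
have sub : pcube ((1 - e) * rho) z `<=` (pcube rho z : set T).
  have l1 : (1 - e) * rho <= rho by rewrite ger_pMl//; have := e0; lra.
  have l2 : ((1 - e) * rho) ^+ 2 <= rho ^+ 2 by rewrite lerXn2r// nnegrE ltW.
  move=> y [h1 h2]; split; first by move=> i; exact: lt_le_trans l1.
  move: h2; rewrite /time_itv/= !in_itv/= => /andP[a1 a2].
  by apply/andP; split; lra.
have QE : pcube rho z = pcube ((1 - e) * rho) z `|` E by rewrite /E setDUK.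
have dj : [disjoint pcube ((1 - e) * rho) z & E].
  by rewrite disj_set2E /E; apply/eqP/seteqP; split => y // [h [_ nh]].
have dE : (\int[mu]_(y in E) dual_weight p w y =
    (dmass z rho - dmass z ((1 - e) * rho))%:E)%E.
  have : (\int[mu]_(y in pcube rho z) dual_weight p w y =
     \int[mu]_(y in pcube ((1 - e) * rho) z) dual_weight p w y +
     \int[mu]_(y in E) dual_weight p w y)%E.
    rewrite {1}QE ge0_integral_setU// -?QE.
      by apply: measurable_funTS; exact: measurable_dual_weight.
    by move=> x _; exact: dual_weight_ge0.
  by rewrite !dmassE// EFinB => ->; rewrite addeAC subee ?add0e.
have mEE : (mu E = (pv rho - pv ((1 - e) * rho))%:E)%E.
  have : (mu (pcube rho z) = mu (pcube ((1 - e) * rho) z) + mu E)%E.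
    by rewrite {1}QE; apply: (measureU mu mQ' mE); apply/eqP; rewrite -disj_set2E.
  by rewrite !measure_pcube// EFinB => ->; rewrite addeAC subee ?add0e.
have wE : (\int[mu]_(y in E) (w y)%:E <= (wmass z rho)%:E)%E.
  rewrite -wmassE//; apply: ge0_subset_integral => //.
  - by apply/measurable_EFinP; exact: measurable_funTS.
  - by move=> x _; rewrite lee_fin.
  - by move=> x [].
have dE' : (\int[mu]_(y in E) dual_weight p w y <=
    (dmass z rho - dmass z ((1 - e) * rho))%:E)%E by rewrite dE.
have := measure_le_wmass_dmass mE wE dE'; rewrite mEE /=.
set d := dmass z rho - dmass z ((1 - e) * rho) => H.
have d0 : 0 <= d.
  by rewrite -lee_fin -dE; apply: integral_ge0 => y _; exact: dual_weight_ge0.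
have ev : e * pv rho <= pv rho - pv ((1 - e) * rho).
  have h : (1 - e) ^+ n.+2 <= 1 - e by rewrite exprS ger_pMr// exprn_ile1 ?ltW//; have := e0; lra.
  have h' := ler_wpM2r (ltW v0) h.
  by rewrite pvolZ; lra.
have H2 : (e * pv rho) `^ p <= 2 `^ p * wmass z rho * d `^ (p - 1).
  apply: le_trans H; apply: ge0_ler_powR; rewrite ?nnegrE//.
    by rewrite mulr_ge0// ltW.
  by apply: le_trans ev; rewrite mulr_ge0// ltW.
have Vp0 : 0 <= dmass z rho `^ (p - 1) by exact: powR_ge0.
have dp0 : 0 <= d `^ (p - 1) by exact: powR_ge0.
have tA : 0 < 2 `^ p * A by rewrite mulr_gt0// powR_gt0.
have H3 : e `^ p / (2 `^ p * A) * dmass z rho `^ (p - 1) <= d `^ (p - 1).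
  rewrite mulrAC ler_pdivrMr// -(ler_pM2r vp).
  have -> : e `^ p * dmass z rho `^ (p - 1) * pv rho `^ p =
     (e * pv rho) `^ p * dmass z rho `^ (p - 1).
    by rewrite powRM ?(ltW e0) ?(ltW v0)//; ring.
  apply: (le_trans (ler_wpM2r Vp0 H2)).
  have -> : 2 `^ p * wmass z rho * d `^ (p - 1) * dmass z rho `^ (p - 1) =
     2 `^ p * d `^ (p - 1) * (wmass z rho * dmass z rho `^ (p - 1)) by ring.
  have -> : d `^ (p - 1) * (2 `^ p * A) * pv rho `^ p =
     2 `^ p * d `^ (p - 1) * (A * pv rho `^ p) by ring.
  by apply: ler_wpM2l; [rewrite mulr_ge0 ?powR_ge0|exact: wmass_dmass_le].
have /andP[q0 _] := ratio_itv.
have : (e `^ p / (2 `^ p * A) * dmass z rho `^ (p - 1)) `^ (p - 1)^-1 <= (d `^ (p - 1)) `^ (p - 1)^-1.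
  by apply: ge0_ler_powR; rewrite ?nnegrE ?invr_ge0 ?(ltW p10)// mulr_ge0// ltW.
rewrite (powRM _ (ltW q0) Vp0) -!powRrM divff ?gt_eqF// !powRr1 ?dmass_ge0//.
by rewrite /d /dual_decay; lra.
Qed.

Lemma dmass_shrinkX z rho j : 0 < rho ->
  dmass z ((1 - e) ^+ j * rho) <= dual_decay ^+ j * dmass z rho.
Proof.
move=> r0; have k0 : 0 < 1 - e by have := e1; have := e0; lra.
have /andP[q0 _] := dual_decay_itv.
elim: j => [|j IH]; first by rewrite !expr0 !mul1r.
rewrite !exprS -!mulrA; apply: le_trans (dmass_shrink z _) _.
  by rewrite mulr_gt0// exprn_gt0.
by apply: ler_wpM2l => //; exact: ltW.
Qed.

Definition wgrowth : R := ((1 - e) ^+ n.+2) `^ p / dual_decay `^ (p - 1).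

Lemma wgrowthE : wgrowth = ((1 - e) ^+ n.+2) `^ p / dual_decay `^ (p - 1).
Proof. by []. Qed.

Lemma wgrowth_gt0 : 0 < wgrowth.
Proof.
have k0 : 0 < 1 - e by have := e1; have := e0; lra.
have /andP[q0 _] := dual_decay_itv.
by rewrite /wgrowth divr_gt0 ?powR_gt0// exprn_gt0.
Qed.

Lemma wmass_lower z rho j : 0 < rho ->
  wgrowth ^+ j * wmass z rho <= 2 `^ p * A * wmass z ((1 - e) ^+ j * rho).
Proof.
move=> r0; have k0 : 0 < 1 - e by have := e1; have := e0; lra.
have kj0 : 0 < (1 - e) ^+ j by rewrite exprn_gt0.
have /andP[q0 _] := dual_decay_itv.
have v0 := pv0 r0; have vp : 0 < pv rho `^ p by exact: powR_gt0.
have qp : 0 < dual_decay `^ (p - 1) by exact: powR_gt0.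
have r'0 : 0 < (1 - e) ^+ j * rho by rewrite mulr_gt0.
have V0 := dmass_gt0 z r0; have Vp : 0 < dmass z rho `^ (p - 1) by exact: powR_gt0.
have h1 := pvol_le_wmass_dmass z r'0.
have h2 : dmass z ((1 - e) ^+ j * rho) `^ (p - 1) <=
    (dual_decay `^ (p - 1)) ^+ j * dmass z rho `^ (p - 1).
  have qj : 0 <= dual_decay ^+ j by rewrite exprn_ge0// ltW.
  rewrite -(powR_exprn (p - 1) j (ltW q0)) -(powRM (p - 1) qj (ltW V0)).
  apply: (ge0_ler_powR (ltW p10)); last exact: dmass_shrinkX.
    by rewrite nnegrE dmass_ge0.
  by rewrite nnegrE mulr_ge0// ltW.
set Wj := wmass z ((1 - e) ^+ j * rho) in h1 *.
have Wj0 : 0 <= Wj by exact: wmass_ge0.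
have h5 := wmass_dmass_le z r0.
clearbody Wj; set W := wmass z rho in h5 *; have W0 : 0 <= W by exact: wmass_ge0.
clearbody W.
have h3 : pv ((1 - e) ^+ j * rho) `^ p <=
    2 `^ p * Wj * ((dual_decay `^ (p - 1)) ^+ j * dmass z rho `^ (p - 1)).
  exact: (le_trans h1 (ler_wpM2l (mulr_ge0 (powR_ge0 _ _) Wj0) h2)).
have -> : wgrowth ^+ j = (((1 - e) ^+ j) ^+ n.+2) `^ p / (dual_decay `^ (p - 1)) ^+ j.
  rewrite /wgrowth expr_div_n; congr (_ / _).
  by rewrite -(powR_exprn p j (exprn_ge0 n.+2 (ltW k0))) exprAC.
rewrite mulrAC ler_pdivrMr ?exprn_gt0// -(ler_pM2r vp).
move: h3; rewrite pvolZ (powRM p (exprn_ge0 n.+2 (ltW kj0)) (ltW v0)) => h3.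
have h4 := ler_wpM2r W0 h3.
rewrite mulrAC; apply: (le_trans h4).
have -> : 2 `^ p * Wj * ((dual_decay `^ (p - 1)) ^+ j * dmass z rho `^ (p - 1)) * W
  = 2 `^ p * Wj * (dual_decay `^ (p - 1)) ^+ j * (W * dmass z rho `^ (p - 1)) by ring.
have -> : 2 `^ p * A * Wj * (dual_decay `^ (p - 1)) ^+ j * pv rho `^ p =
  2 `^ p * Wj * (dual_decay `^ (p - 1)) ^+ j * (A * pv rho `^ p) by ring.
by apply: ler_wpM2l => //; rewrite !mulr_ge0 ?exprn_ge0 ?powR_ge0.
Qed.

End reverse_doubling.
End Ap_consequences.

Lemma powR_pred0 {R : realType} (p x : R) : p != 0 -> 0 <= x -> x `^ p = x `^ (p - 1) * x.
Proof.
move=> p0; rewrite le_eqVlt => /predU1P[<-|]; last exact: powR_pred.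
by rewrite powR0// mulr0.
Qed.

Lemma exponent_gain {R : realType} (n : nat) (p kap q : R) :
  1 < p -> 0 < kap -> kap < 1 -> 0 < q -> q < 1 ->
  exists2 delta, 0 < delta & let k := (n%:R + 2) / (n%:R + 1) + delta in
    1 < k /\ kap `^ (p * k) / ((kap ^+ n.+2) `^ p / q `^ (p - 1)) `^ (k - 1) < 1.
Proof.
move=> hp k0 k1 q0 q1.
have n0 : 0 <= n%:R :> R by [].
have a0 : ln kap < 0 by rewrite ln_lt0// k0.
have b0 : ln q < 0 by rewrite ln_lt0// q0.
pose delta := ((p - 1) * ln q) / (2 * (n%:R + 1) ^+ 2 * p * ln kap).
have d0 : 0 < delta.
  rewrite /delta -[X in 0 < X]mulrNN -invrN divr_gt0//.
    by rewrite -mulrN mulr_gt0; lra.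
  by rewrite -mulrN !mulr_gt0 ?exprn_gt0//; lra.
exists delta => //=; set k := _ + delta.
have kE : k = 1 + ((n%:R + 1)^-1 + delta) by rewrite /k; field; lra.
have ni : 0 < (n%:R + 1 : R)^-1 by rewrite invr_gt0; lra.
split; first by rewrite kE; lra.
set g := (X in X < 1).
have kp : 0 < (kap ^+ n.+2) `^ p by rewrite powR_gt0// exprn_gt0.
have qp : 0 < q `^ (p - 1) by rewrite powR_gt0.
have g0 : 0 < g by rewrite /g divr_gt0 ?powR_gt0 ?divr_gt0.
have xp : 0 < (kap ^+ n.+2) `^ p / q `^ (p - 1) by rewrite divr_gt0.
have -> : (g < 1) = (ln g < ln 1) by rewrite ltr_ln// ?posrE.
have -> : ln g = (p - 1) * ln q * ((2 * (n%:R + 1))^-1 + delta).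
  rewrite /g ln_div ?posrE ?powR_gt0// !ln_powR ln_div ?posrE// !ln_powR lnXn//.
  rewrite -[ln kap *+ _]mulr_natr (_ : n.+2%:R = n%:R + 2) ?kE /delta; last first.
    by rewrite -addn2 natrD.
  field.
  have p_0 : p != 0 by rewrite gt_eqF//; lra.
  have n_0 : n%:R + 1 != 0 :> R by rewrite gt_eqF//; lra.
  by rewrite p_0 n_0 lt_eqF.
have h : 0 < (2 * (n%:R + 1))^-1 + delta by rewrite addr_gt0// invr_gt0; lra.
by rewrite ln1 pmulr_llt0// nmulr_llt0//; lra.
Qed.

Section level_estimate.
Context {R : realType} {n : nat}.
Local Notation T := (spacetime R n).
Local Notation mu := (@spacetime_measure R n).
Local Notation pv := (@pvol R n).
Variables (p A : R) (w : 'rV[R]_n * R -> R).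
Hypotheses (hp : 1 < p) (A1 : 1 <= A) (wAp : Ap_weight p w)
  (wA : (Ap_const p w <= A%:E)%E).
Variables (f : T -> R) (X : R).
Hypotheses (mf : measurable_fun setT f) (f0 : forall z, 0 <= f z)
  (fX : (\int[mu]_z (f z `^ p * w z)%:E <= X%:E)%E).

Let w0 z : 0 <= w z. Proof. by have [[]] := wAp. Qed.
Let mw : measurable_fun setT (w : T -> R). Proof. by have [[]] := wAp. Qed.
Let p10 : 0 < p - 1. Proof. by have := hp; lra. Qed.
Let A0 : 0 < A. Proof. exact: lt_le_trans A1. Qed.

Definition cube_mass (rho : R) (z : T) : R := fine (\int[mu]_(zeta in pcube rho z) (f zeta)%:E)%E.

Let g (z : T) : \bar R := (f z `^ p * w z)%:E.
Let g0 z : (0 <= g z)%E. Proof. by rewrite lee_fin mulr_ge0 ?powR_ge0. Qed.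
Let mg : measurable_fun setT g.
Proof.
apply/measurable_EFinP; apply: measurable_funM => //.
exact: (measurableT_comp (measurable_powR _) mf).
Qed.

Let Phi (rho : R) (z : T) : R := fine (\int[mu]_(zeta in pcube rho z) g zeta)%E.

Let Phi_le (rho : R) z : (\int[mu]_(zeta in pcube rho z) g zeta <= X%:E)%E.
Proof.
apply: le_trans fX; apply: ge0_subset_integral => //; exact: measurable_pcube.
Qed.

Let PhiE (rho : R) z : (\int[mu]_(zeta in pcube rho z) g zeta)%E = (Phi rho z)%:E.
Proof.
rewrite /Phi fineK// ge0_fin_numE; first exact: le_lt_trans (Phi_le _ _) (ltry _).
exact: integral_ge0.
Qed.

Lemma cube_massP (rho : R) z : 0 < rho ->
  (\int[mu]_(zeta in pcube rho z) (f zeta)%:E)%E = (cube_mass rho z)%:E /\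
  cube_mass rho z `^ p <=
    2 `^ p * A * pv rho `^ p * (Phi rho z / wmass w z rho).
Proof.
move=> r0; have W0 := wmass_gt0 hp wAp z r0.
have h1 : (\int[mu]_(zeta in pcube rho z) (f zeta `^ p * w zeta)%:E <= (Phi rho z)%:E)%E.
  by rewrite -PhiE.
have h2 : (\int[mu]_(zeta in pcube rho z) dual_weight p w zeta <= (dmass p w z rho)%:E)%E.
  by rewrite (dmassE wAp).
have [foo H] := @weighted_hoelder R n p w hp w0 mw _ f _ _ (measurable_pcube rho z)
  (measurable_funTS mf) (fun z _ => f0 z) h1 h2.
split.
  by rewrite /cube_mass fineK// ge0_fin_numE//; apply: integral_ge0 => x _; rewrite lee_fin.
apply: (le_trans H).
have Phi0 : 0 <= Phi rho z by apply: fine_ge0; exact: integral_ge0.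
have h3 := wmass_dmass_le wAp wA z r0.
have -> : 2 `^ p * A * pv rho `^ p * (Phi rho z / wmass w z rho) =
  2 `^ p * Phi rho z * (A * pv rho `^ p / wmass w z rho) by ring.
apply: ler_wpM2l; first by rewrite mulr_ge0 ?powR_ge0.
by rewrite ler_pdivlMr// mulrC.
Qed.

Lemma cube_mass_powR_le (rho : R) z : 0 < rho ->
  cube_mass rho z `^ p <= 2 `^ p * A * pv rho `^ p * (X / wmass w z rho).
Proof.
move=> r0; apply: le_trans (cube_massP z r0).2 _.
have c0 : 0 <= 2 `^ p * A * pv rho `^ p.
  by apply: mulr_ge0; rewrite ?powR_ge0//; apply: mulr_ge0; rewrite ?powR_ge0// ltW.
apply: ler_wpM2l => //; rewrite ler_pM2r ?invr_gt0; last exact: (wmass_gt0 hp wAp z r0).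
by rewrite -lee_fin -PhiE.
Qed.

Lemma cube_mass_ge0 rho z : 0 <= cube_mass rho z.
Proof. by apply: fine_ge0; apply: integral_ge0 => x _; rewrite lee_fin. Qed.

Lemma measurable_cube_mass rho : measurable_fun setT (cube_mass rho).
Proof.
apply: (measurableT_comp (fine_measurable measurableT)).
apply: (@measurable_integral_pcube R n rho (EFin \o f)).
  exact/measurable_EFinP.
by move=> z; rewrite lee_fin.
Qed.

Let mwmass rho : measurable_fun setT (fun z => wmass w z rho).
Proof.
apply: (measurableT_comp (fine_measurable measurableT)).
apply: (@measurable_integral_pcube R n rho (fun z => (w z)%:E)).
  exact/measurable_EFinP.
by move=> z; rewrite lee_fin.
Qed.

Lemma level_estimate (C : set T) (rho k mlow : R) : measurable C ->
  0 < rho -> 1 < k -> 0 < mlow -> (forall z, C z -> mlow <= wmass w z rho) ->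
  (\int[mu]_(z in C) (cube_mass rho z `^ (p * k) * w z)%:E <=
   ((2 `^ p * A * pv rho `^ p) `^ k * (X / mlow) `^ (k - 1) * X *
     @doubling_const R n p A)%:E)%E.
Proof.
move=> mC r0 k1 ml0 low.
have W0 z : 0 < wmass w z rho by exact: (wmass_gt0 hp wAp z r0).
set B1 := 2 `^ p * A * pv rho `^ p; set D := @doubling_const R n p A.
have B0 : 0 <= B1 by rewrite !mulr_ge0 ?powR_ge0 ?(ltW A0).
have X0 : 0 <= X by rewrite -lee_fin; apply: le_trans fX; apply: integral_ge0 => z _; exact: g0.
have Phi0 z : 0 <= Phi rho z by apply: fine_ge0; exact: integral_ge0.
have PhiX z : Phi rho z <= X by rewrite -lee_fin -PhiE.
set K := B1 `^ k * (X / mlow) `^ (k - 1).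
have K0 : 0 <= K by rewrite mulr_ge0 ?powR_ge0.
pose h (z : T) := (w z / wmass w z rho)%:E.
have h0 z : (0 <= h z)%E by rewrite lee_fin divr_ge0// ltW.
have mh : measurable_fun setT h.
  apply/measurable_EFinP; apply: measurable_funM => //.
  have E : (fun z => wmass w z rho `^ (-1)) = (fun z => (wmass w z rho)^-1).
    by apply/funext => z; rewrite powR_inv1// ltW.
  by rewrite -E; exact: (measurableT_comp (measurable_powR _) (mwmass rho)).
have pt z : C z -> cube_mass rho z `^ (p * k) * w z <= K * (w z / wmass w z rho * Phi rho z).
  move=> Cz; have [_ H] := cube_massP z r0.
  have -> : K * (w z / wmass w z rho * Phi rho z) = K * (Phi rho z / wmass w z rho) * w z by ring.
  apply: ler_wpM2r => //; rewrite powRrM.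
  have r1 : 0 <= Phi rho z / wmass w z rho by rewrite divr_ge0// ltW.
  apply: (@le_trans _ _ ((B1 * (Phi rho z / wmass w z rho)) `^ k)).
    apply: ge0_ler_powR; rewrite ?nnegrE ?powR_ge0//; first by lra.
    by rewrite mulr_ge0.
  rewrite powRM// /K -mulrA ler_wpM2l ?powR_ge0//.
  rewrite (powR_pred0 (_ : k != 0) r1); last by rewrite gt_eqF//; lra.
  apply: ler_wpM2r => //; apply: ge0_ler_powR; rewrite ?nnegrE//; first by lra.
    by rewrite divr_ge0// ltW.
  rewrite ler_pM ?invr_ge0 ?(ltW (W0 z))//.
  by rewrite lef_pV2 ?posrE//; exact: low.
apply: (@le_trans _ _ (\int[mu]_(z in C) (K%:E * (h z * \int[mu]_(zeta in pcube rho z) g zeta)))%E).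
  apply: ge0_le_integral => //.
  - by move=> z _; rewrite lee_fin mulr_ge0 ?powR_ge0.
  - apply/measurable_EFinP; apply: measurable_funTS; apply: measurable_funM => //.
    exact: (measurableT_comp (measurable_powR _) (measurable_cube_mass rho)).
  - apply: measurable_funTS; apply: measurable_funeM.
    exact: measurable_integral_pcubeM.
  - by move=> z Cz; rewrite PhiE -!EFinM lee_fin; exact: pt.
apply: (@le_trans _ _ (\int[mu]_z (K%:E * (h z * \int[mu]_(zeta in pcube rho z) g zeta)))%E).
  apply: ge0_subset_integral => //.
  - by apply: measurable_funeM; exact: measurable_integral_pcubeM.
  - by move=> z _; apply: mule_ge0; [rewrite lee_fin|apply: mule_ge0 => //; exact: integral_ge0].
rewrite ge0_integralZl_EFin//; first last.
  - exact: measurable_integral_pcubeM.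
  - by move=> z _; apply: mule_ge0 => //; exact: integral_ge0.
rewrite tonelli_pcube//.
have inner zeta : (\int[mu]_(z in pcube rho zeta) h z <= D%:E)%E.
  apply: (@le_trans _ _ (\int[mu]_(z in pcube rho zeta) ((D / wmass w zeta rho)%:E * (w z)%:E))%E).
    apply: ge0_le_integral => //.
    - exact: measurable_pcube.
    - exact: measurable_funTS.
    - by apply: measurable_funTS; apply: measurable_funeM; exact/measurable_EFinP.
    - move=> z zz; rewrite -EFinM lee_fin mulrC ler_wpM2r//.
      rewrite ler_pdivlMr// mulrC ler_pdivrMr//.
      exact: (wmass_doubling hp A1 wAp wA r0 zz).
  rewrite ge0_integralZl_EFin//.
  - by rewrite (wmassE wAp)// -EFinM lee_fin divfK// gt_eqF.
  - exact: measurable_pcube.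
  - by move=> z _; rewrite lee_fin.
  - by apply: measurable_funTS; exact/measurable_EFinP.
  - by rewrite divr_ge0 ?(ltW (W0 _))// /D /doubling_const !mulr_ge0 ?powR_ge0// ltW.
apply: (@le_trans _ _ (K%:E * (D%:E * X%:E))%E); last first.
  by rewrite -!EFinM lee_fin le_eqVlt; apply/orP; left; apply/eqP; rewrite /K; ring.
have D0 : 0 <= D by rewrite /D /doubling_const !mulr_ge0 ?powR_ge0// ltW.
apply: lee_wpmul2l; first by rewrite lee_fin.
apply: (@le_trans _ _ (\int[mu]_z (D%:E * g z))%E).
  apply: ge0_le_integral => //.
  - by move=> z _; apply: mule_ge0 => //; exact: integral_ge0.
  - have := @measurable_integral_pcubeM R n rho h g mh mg h0 g0.
    by apply: eq_measurable_fun.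
  - exact: measurable_funeM.
  - by move=> z _; rewrite muleC lee_wpmul2r.
rewrite ge0_integralZl_EFin//.
by apply: lee_wpmul2l; [rewrite lee_fin|exact: fX].
Qed.

End level_estimate.

Section telescoping.
Context {R : realType}.
Variables (A g : nat -> R).
Hypothesis Ag : forall j, `|A j.+1 - A j| <= g j.

Lemma telescope_bound j : `|A j - A 0%N| <= \sum_(0 <= i < j) g i.
Proof.
elim: j => [|j IH]; first by rewrite subrr normr0 big_nil.
rewrite big_nat_recr//=.
have -> : A j.+1 - A 0%N = (A j - A 0%N) + (A j.+1 - A j) by ring.
by apply: le_trans (ler_normD _ _) _; exact: lerD.
Qed.

Lemma telescope_boundE j : (`|A j - A 0%N|%:E <= \sum_(i <oo) (g i)%:E)%E.
Proof.
apply: (@le_trans _ _ (\sum_(0 <= i < j) (g i)%:E)%E).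
  by rewrite sumEFin lee_fin telescope_bound.
apply: (@nneseries_lim_ge R (fun i => (g i)%:E) xpredT 0%N j) => i _ _.
by rewrite lee_fin (le_trans _ (Ag i)).
Qed.

Lemma telescope_cvg : (\sum_(i <oo) (g i)%:E < +oo)%E -> cvgn A.
Proof.
move=> goo; have g0 i : 0 <= g i by apply: le_trans (Ag i).
have gs : cvgn (series g).
  apply: nondecreasing_is_cvgn.
    by apply: nondecreasing_series.
  exists (fine (\sum_(i <oo) (g i)%:E)%E) => _ [j _ <-].
  rewrite -lee_fin fineK; last first.
    by rewrite ge0_fin_numE// nneseries_ge0// => i _ _; rewrite lee_fin.
  rewrite /series/= -sumEFin.
  by apply: (@nneseries_lim_ge R (fun i => (g i)%:E) xpredT 0%N j) => i _ _; rewrite lee_fin.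
have cs : cvgn (series (fun i => A i.+1 - A i)).
  apply: normed_cvg.
  by apply: (@series_le_cvg _ (fun i => `|A i.+1 - A i|) g _ g0 Ag gs) => i.
have -> : A = (fun j => series (fun i => A i.+1 - A i) j + A 0%N).
  apply/funext => j; rewrite /series/=; elim: j => [|j IH]; first by rewrite big_nil add0r.
  by rewrite big_nat_recr//= addrAC -IH; ring.
apply/cvg_ex; exists (limn (series (fun i => A i.+1 - A i)) + A 0%N).
by apply: cvgD; [exact: cs|exact: cvg_cst].
Qed.

(* A Hoelder-free summation: each term is at most [b^(1/Q) m^j]. *)
Lemma telescope_limit_bound (v b m Q : R) : 0 < Q -> 0 < m -> m < 1 -> 0 <= b ->
  A j @[j --> \oo] --> v -> (forall j, g j `^ Q <= b * (m `^ Q) ^+ j) ->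
  `|v - A 0%N| `^ Q <= b / (1 - m) `^ Q.
Proof.
move=> Q0 m0 m1 b0 Av gb; have g0 i : 0 <= g i by apply: le_trans (Ag i).
have gj j : g j <= b `^ Q^-1 * m ^+ j.
  rewrite -(powRr1 (g0 j)) -(divff (lt0r_neq0 Q0)) powRrM.
  apply: (@le_trans _ _ ((b * (m `^ Q) ^+ j) `^ Q^-1)).
    apply: ge0_ler_powR; rewrite ?nnegrE ?powR_ge0 ?invr_ge0 ?(ltW Q0)//.
    by rewrite mulr_ge0// exprn_ge0// powR_ge0.
  rewrite powRM// ?exprn_ge0 ?powR_ge0// -powR_exprn ?(ltW m0)// -powRrM divff ?gt_eqF//.
  by rewrite powRr1// exprn_ge0// ltW.
have m1' : 0 < 1 - m by lra.
have H j : `|A j - A 0%N| <= b `^ Q^-1 / (1 - m).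
  apply: le_trans (telescope_bound j) _.
  apply: (@le_trans _ _ (\sum_(0 <= i < j) b `^ Q^-1 * m ^+ i)).
    by apply: ler_sum => i _.
  have -> : \sum_(0 <= i < j) b `^ Q^-1 * m ^+ i = series (geometric (b `^ Q^-1) m) j by [].
  rewrite geometric_seriesE ?lt_eqF//= ler_pM2r ?invr_gt0// ler_piMr ?powR_ge0//.
  by rewrite lerBlDr lerDl exprn_ge0// ltW.
have h : `|v - A 0%N| <= b `^ Q^-1 / (1 - m).
  have c1 : `|A j - A 0%N| @[j --> \oo] --> `|v - A 0%N|.
    by apply: cvg_norm; apply: cvgB => //; exact: cvg_cst.
  by apply: (cvgr_to_le c1); exact: nearW.
apply: (@le_trans _ _ ((b `^ Q^-1 / (1 - m)) `^ Q)).
  apply: ge0_ler_powR; rewrite ?nnegrE ?(ltW Q0)//.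
  by rewrite divr_ge0 ?powR_ge0// ltW.
rewrite powRM ?powR_ge0 ?invr_ge0 ?(ltW m1')// -powRrM mulVf ?gt_eqF// powRr1//.
by rewrite powR_invl ?(ltW m1').
Qed.

End telescoping.

Lemma geometric_eseries_le {R : realType} (c z : R) : 0 <= c -> 0 <= z -> z < 1 ->
  (\sum_(j <oo) (c * z ^+ j)%:E <= (c / (1 - z))%:E)%E.
Proof.
move=> c0 z0 z1; apply: lime_le.
  by apply: is_cvg_nneseries => j _ _; rewrite lee_fin mulr_ge0// exprn_ge0.
apply: nearW => j; rewrite sumEFin lee_fin.
have -> : \sum_(0 <= i < j) c * z ^+ i = series (geometric c z) j by [].
rewrite geometric_seriesE ?lt_eqF//= ler_pM2r ?invr_gt0 ?subr_gt0// ler_piMr//.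
by rewrite lerBlDr lerDl exprn_ge0.
Qed.

Section scale_sum.
Context {R : realType} {n : nat}.
Local Notation T := (spacetime R n).
Local Notation mu := (@spacetime_measure R n).
Local Notation pv := (@pvol R n).
Variables (Omega : set 'rV[R]_n) (r a e M : R) (u : 'rV[R]_n * R -> R).
Variables (Du G : 'rV[R]_n * R -> 'rV[R]_n).
Hypotheses (r0 : 0 < r) (e0 : 0 < e) (ea : 8 * e <= a) (a1 : a <= 1).
Hypothesis star : star_domain r a Omega.
Hypotheses (M1 : 1 <= M) (bM : forall x : R, bump1 x <= M)
  (dbM : forall x, `|'D_1 (bump1 : R^o -> R) x| <= M).
Local Notation I := (time_itv r 0).
Local Notation C := (Omega `*` I : set T).
Hypotheses (uW : L1W11 Omega I u Du) (uG : distributional_solution Omega I u G).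
Hypotheses (mDu : measurable_fun C (fun z => enorm (Du z)))
  (mG : measurable_fun C (fun z => enorm (G z))).
Local Notation B := (kbound e M).
Local Notation s j := ((1 - e) ^+ j).

Let e1 : 8 * e <= 1. Proof. exact: le_trans a1. Qed.
Let k0 : 0 < 1 - e. Proof. by have := e1; have := e0; lra. Qed.
Let B0 : 0 < B. Proof. exact: lt_le_trans (kbound_ge1 e0 ea a1 M1). Qed.
Let mC : measurable C. Proof. exact: measurable_star_cylinder star. Qed.
Let s0 j : 0 < s j. Proof. by rewrite exprn_gt0. Qed.

Definition dens : T -> R := (fun z => enorm (Du z) + enorm (G z)) \_ C.

Lemma dens_ge0 z : 0 <= dens z.
Proof. by rewrite /dens patchE; case: ifP => // _; rewrite addr_ge0 ?enorm_ge0. Qed.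

Lemma measurable_dens : measurable_fun setT dens.
Proof.
apply/(measurable_restrictT _ mC).
by apply: measurable_funD.
Qed.

Definition scale_coeff j : R := 2 * n%:R * (B / (s j * r)) ^+ n.+1.
Definition scale_term j (z : T) : R :=
  scale_coeff j * cube_mass dens (2 * (s j * r)) z.

Lemma scale_coeff_ge0 j : 0 <= scale_coeff j.
Proof.
have q : 0 <= B / (s j * r) by rewrite ltW// divr_gt0// mulr_gt0.
exact (mulr_ge0 (mulr_ge0 (ler0n R 2) (ler0n R n)) (exprn_ge0 n.+1 q)).
Qed.

Lemma scale_term_ge0 j z : 0 <= scale_term j z.
Proof. exact (mulr_ge0 (scale_coeff_ge0 j) (cube_mass_ge0 dens_ge0 _ _)). Qed.

Lemma measurable_scale_term j : measurable_fun setT (scale_term j).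
Proof.
apply: measurable_funM; first exact: measurable_cst.
exact: (measurable_cube_mass measurable_dens dens_ge0).
Qed.

Hypothesis dens_loc : forall rho (z : T), 0 < rho ->
  (\int[mu]_(zeta in pcube rho z) (dens zeta)%:E = (cube_mass dens rho z)%:E)%E.

Lemma avg_step_dens j (z : T) : C z ->
  `|avg Omega u e r (s j.+1) z - avg Omega u e r (s j) z| <= scale_term j z.
Proof.
move=> Cz; have s1 : s j <= 1 by rewrite exprn_ile1 ?(ltW k0)//; have := e0; lra.
have H := avg_step r0 e0 ea a1 star M1 bM dbM uW uG mDu mG (s0 j) s1 Cz.
rewrite -lee_fin exprS; apply: (le_trans H).
have rho0 : 0 < 2 * (s j * r) by rewrite !mulr_gt0.
have -> : ((scale_term j z)%:E = (scale_coeff j)%:E *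
    \int[mu]_(zeta in pcube (2 * (s j * r)) z) (dens zeta)%:E)%E.
  by rewrite dens_loc// -EFinM.
rewrite integral_mkcondl /scale_coeff le_eqVlt; apply/orP; left; apply/eqP.
f_equal; apply: eq_integral => zeta _.
by rewrite /dens !patchE; case: ifP.
Qed.

Definition mass_const : R := 2 * n%:R * B ^+ n.+1 * pv 2.

Lemma scale_coeff_pvol j : scale_coeff j * pv (2 * (s j * r)) = mass_const * r * s j.
Proof.
have -> : 2 * (s j * r) = (s j * r) * 2 by ring.
rewrite pvolZ /scale_coeff /mass_const exprMn exprVn [(s j * r) ^+ n.+2]exprS.
have h : (s j * r) ^+ n.+1 != 0 by rewrite gt_eqF// exprn_gt0// mulr_gt0.
by move: h; set y := _ ^+ n.+1 => h; field.
Qed.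

Lemma mass_const_ge0 : 0 <= mass_const.
Proof.
have v : 0 <= pv 2 by rewrite ltW// pvol_gt0.
exact (mulr_ge0 (mulr_ge0 (mulr_ge0 (ler0n R 2) (ler0n R n)) (exprn_ge0 n.+1 (ltW B0))) v).
Qed.

Lemma integral_scale_sum (F : R) : (\int[mu]_z (dens z)%:E <= F%:E)%E ->
  (\int[mu]_(z in C) (\sum_(j <oo) (scale_term j z)%:E) <= (mass_const / e * r * F)%:E)%E.
Proof.
move=> hF.
have md : measurable_fun setT (EFin \o dens) by apply/measurable_EFinP; exact: measurable_dens.
have F0 : 0 <= F.
  by rewrite -lee_fin; apply: le_trans hF; apply: integral_ge0 => z _; rewrite lee_fin dens_ge0.
rewrite integral_nneseries//; last 2 first.
- by move=> j; apply/measurable_EFinP; apply: measurable_funTS; exact: measurable_scale_term.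
- by move=> j z _; rewrite lee_fin scale_term_ge0.
have -> : mass_const / e * r * F = (mass_const * r * F) / (1 - (1 - e)).
  by have := e0; move=> ?; field; rewrite ?gt_eqF//; lra.
apply: le_trans (geometric_eseries_le _ _ _); last first.
- by have := e0; lra.
- exact: ltW.
- by rewrite mulr_ge0// mulr_ge0 ?mass_const_ge0// ltW.
apply: lee_nneseries => [j _ _|j _].
  by apply: integral_ge0 => z _; rewrite lee_fin scale_term_ge0.
have rho0 : 0 < 2 * (s j * r) by rewrite !mulr_gt0.
apply: (@le_trans _ _ (\int[mu]_z ((scale_coeff j)%:E *
    (cst 1 z * \int[mu]_(zeta in pcube (2 * (s j * r)) z) (dens zeta)%:E)))%E).
  apply: (@le_trans _ _ (\int[mu]_z (scale_term j z)%:E)%E).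
    apply: ge0_subset_integral => //.
    - by apply/measurable_EFinP; exact: measurable_scale_term.
    - by move=> z _; rewrite lee_fin scale_term_ge0.
  rewrite le_eqVlt; apply/orP; left; apply/eqP; apply: eq_integral => z _.
  by rewrite mul1e dens_loc.
have d0 z : (0 <= (dens z)%:E)%E by rewrite lee_fin dens_ge0.
have m1 := @measurable_integral_pcubeM R n (2 * (s j * r)) (EFin \o dens) (cst 1%E)
  md (measurable_cst _) d0 (fun=> lee01).
rewrite ge0_integralZl_EFin//; first last.
- exact: scale_coeff_ge0.
- by move=> z _; apply: mule_ge0 => //; exact: integral_ge0.
rewrite (@tonelli_pcube R n (2 * (s j * r)) (EFin \o dens) (cst 1%E))//.
have -> : (\int[mu]_zeta ((EFin \o dens) zeta * \int[mu]_(z in pcube (2 * (s j * r)) zeta) cst 1 z)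
   = \int[mu]_zeta ((pv (2 * (s j * r)))%:E * (dens zeta)%:E))%E.
  apply: eq_integral => zeta _; rewrite integral_cst//; last exact: measurable_pcube.
  by rewrite mul1e measure_pcube// muleC.
rewrite ge0_integralZl_EFin//; last exact: ltW (pvol_gt0 _).
rewrite muleA -EFinM scale_coeff_pvol.
apply: (@le_trans _ _ ((mass_const * r * s j)%:E * F%:E)%E).
  by apply: lee_wpmul2l => //; rewrite lee_fin mulr_ge0 ?(ltW (s0 j))// mulr_ge0 ?mass_const_ge0// ltW.
by rewrite -EFinM lee_fin mulrAC.
Qed.

End scale_sum.

#[local] Opaque wgrowth doubling_const mass_const scale_coeff cube_mass wmass dmass pvol.

Lemma powRD_le {R : realType} (x y Q : R) : 0 <= Q -> 0 <= x -> 0 <= y ->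
  (x + y) `^ Q <= 2 `^ Q * (x `^ Q + y `^ Q).
Proof.
move=> Q0; wlog xy : x y / x <= y => [H x0 y0|x0 y0].
  have [xy|/ltW yx] := leP x y; first exact: H.
  by rewrite addrC [X in _ * X]addrC; exact: H.
apply: (@le_trans _ _ ((2 * y) `^ Q)).
  by apply: ge0_ler_powR; rewrite ?nnegrE; lra.
by rewrite powRM// ler_wpM2l ?powR_ge0// lerDr powR_ge0.
Qed.

Section star_estimate.
Context {R : realType} {n : nat}.
Local Notation T := (spacetime R n).
Local Notation mu := (@spacetime_measure R n).
Local Notation pv := (@pvol R n).
Variables (Omega : set 'rV[R]_n) (r a e M : R) (u : 'rV[R]_n * R -> R).
Variables (Du G : 'rV[R]_n * R -> 'rV[R]_n).
Variables (p A : R) (w : 'rV[R]_n * R -> R).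
Hypotheses (r0 : 0 < r) (e0 : 0 < e) (ea : 8 * e <= a) (a1 : a <= 1).
Hypotheses (star : star_domain r a Omega) (Omega0 : Omega 0).
Hypotheses (M1 : 1 <= M) (bM : forall x : R, bump1 x <= M)
  (dbM : forall x, `|'D_1 (bump1 : R^o -> R) x| <= M).
Local Notation I := (time_itv r 0).
Local Notation C := (Omega `*` I : set T).
Hypotheses (uW : L1W11 Omega I u Du) (uG : distributional_solution Omega I u G).
Hypotheses (hp : 1 < p) (A1 : 1 <= A) (wAp : Ap_weight p w)
  (wA : (Ap_const p w <= A%:E)%E).
Hypotheses (LDu : Lpw_vec p w C Du) (LG : Lpw_vec p w C G).
Variable k : R.
Hypotheses (k1 : 1 < k).
Local Notation s j := ((1 - e) ^+ j).
Local Notation Q := (p * k).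
Local Notation growth := (@wgrowth R n p A e).
Local Notation gam := ((1 - e) `^ Q / growth `^ (k - 1)).
Hypothesis gam1 : gam < 1.

Let e1 : 8 * e <= 1. Proof. exact: le_trans a1. Qed.
Let e2 : 2 * e <= 1. Proof. by have := e1; have := e0; lra. Qed.
Let a0 : 0 < a. Proof. by have := ea; have := e0; lra. Qed.
Let k0 : 0 < 1 - e. Proof. by have := e1; have := e0; lra. Qed.
Let p0 : 0 < p. Proof. by have := hp; lra. Qed.
Let Q0 : 0 < Q. Proof. by rewrite mulr_gt0//; have := k1; lra. Qed.
Let A0 : 0 < A. Proof. exact: lt_le_trans A1. Qed.
Let w0 z : 0 <= w z. Proof. by have [[]] := wAp. Qed.
Let mw : measurable_fun setT (w : T -> R). Proof. by have [[]] := wAp. Qed.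
Let mC : measurable C. Proof. exact: (measurable_star_cylinder star). Qed.
Let g0 : 0 < growth. Proof. exact: (wgrowth_gt0 hp A1 e0 e2). Qed.
Let gam0 : 0 < gam. Proof. by rewrite divr_gt0// powR_gt0. Qed.

Let mDu : measurable_fun C (fun z => enorm (Du z)).
Proof. by case: LDu => m _; exact: (measurableT_comp measurable_enorm m). Qed.
Let mG : measurable_fun C (fun z => enorm (G z)).
Proof. by case: LG => m _; exact: (measurableT_comp measurable_enorm m). Qed.

Let mwC : measurable_fun C (w : T -> R). Proof. exact: measurable_funTS. Qed.

Let mpw (f : T -> R) (t : R) : measurable_fun C f -> measurable_fun C (fun z => (f z `^ t * w z)%:E).
Proof.
move=> mf; apply/measurable_EFinP; apply: measurable_funM => //.
exact: (measurableT_comp (measurable_powR _) mf).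
Qed.

Let f (z : T) : R := enorm (Du z) + enorm (G z).

Let mf : measurable_fun C f. Proof. exact: measurable_funD. Qed.

Definition energy : R := fine (\int[mu]_(z in C) (f z `^ p * w z)%:E)%E.
Local Notation X := energy.

Lemma energyE : (\int[mu]_(z in C) (f z `^ p * w z)%:E = X%:E)%E.
Proof.
have fp0 z : (0 <= (f z `^ p * w z)%:E)%E by rewrite lee_fin mulr_ge0 ?powR_ge0.
rewrite /energy fineK// ge0_fin_numE; last by apply: integral_ge0 => z _.
apply: (@le_lt_trans _ _ (\int[mu]_(z in C) ((2 `^ p)%:E *
   ((enorm (Du z) `^ p * w z)%:E + (enorm (G z) `^ p * w z)%:E)))%E).
  apply: ge0_le_integral => //.
  - exact: mpw.
  - by apply: measurable_funeM; apply: emeasurable_funD; exact: mpw.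
  - move=> z _; rewrite -EFinD -EFinM lee_fin -mulrDl mulrA ler_wpM2r//.
    by apply: powRD_le; rewrite ?enorm_ge0// ltW.
have n0 (H : 'rV[R]_n * R -> 'rV[R]_n) z : (0 <= (enorm (H z) `^ p * w z)%:E)%E.
  by rewrite lee_fin mulr_ge0 ?powR_ge0.
rewrite ge0_integralZl_EFin ?powR_ge0//; first last.
- by apply: emeasurable_funD; exact: mpw.
- by move=> z _; exact: adde_ge0.
rewrite ge0_integralD//; [|exact: mpw|exact: mpw].
rewrite lte_mul_pinfty// ?lee_fin ?powR_ge0//.
by apply: lte_add_pinfty; [case: LDu|case: LG].
Qed.

Lemma energy_ge0 : 0 <= X.
Proof. by apply: fine_ge0; apply: integral_ge0 => z _; rewrite lee_fin mulr_ge0 ?powR_ge0. Qed.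

Definition cmass : R := fine (\int[mu]_(z in C) (w z)%:E)%E.
Local Notation W := cmass.

Let w0E z : C z -> (0 <= (w z)%:E)%E. Proof. by rewrite lee_fin. Qed.

Let C_sub : C `<=` (pcube r (0, 0) : set T). Proof. exact: (star_cylinder_sub star). Qed.

Let int_wC_le : (\int[mu]_(z in C) (w z)%:E <= (wmass w (0, 0) r)%:E)%E.
Proof.
rewrite -(wmassE wAp)//; apply: ge0_subset_integral => //.
- exact: measurable_pcube.
- by apply/measurable_EFinP; exact: measurable_funTS.
- by move=> z _; rewrite lee_fin.
Qed.

Lemma cmassE : (\int[mu]_(z in C) (w z)%:E = W%:E)%E.
Proof.
rewrite /cmass fineK// ge0_fin_numE; last exact: integral_ge0.
exact: le_lt_trans int_wC_le (ltry _).
Qed.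

Lemma cmass_le_center : W <= wmass w (0, 0) r.
Proof. by rewrite -lee_fin -cmassE. Qed.

Lemma cmass_le (z : T) : C z -> W <= wmass w z (2 * r).
Proof.
move=> /C_sub; rewrite pcubeC => Cz.
apply: (le_trans cmass_le_center); apply: (wmass_sub wAp) => //.
  by rewrite mulr_gt0.
exact: (pcube_center_sub r0 Cz).
Qed.

Let muE : (mu C = (fine (mu C))%:E)%E.
Proof. by rewrite fineK// ge0_fin_numE// (star_cylinder_lty r0 star). Qed.

Lemma star_cylinder_ge : a ^+ n.+2 * pv r <= fine (mu C).
Proof.
rewrite -pvolZ -lee_fin -muE -(measure_pcube (0, 0)); last exact: mulr_gt0.
apply: le_measure; rewrite ?inE//; first exact: measurable_pcube.
move=> z [h1 h2]; split.
  have [_ _ _ st] := star.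
  have := st 0 z.1 1 Omega0 ltr01 (lexx 1) h1.
  by rewrite subrr scale0r add0r scale1r.
move: h2; rewrite /time_itv/= !in_itv/= => /andP[h2 h3].
have h : (a * r) ^+ 2 <= r ^+ 2.
  by rewrite lerXn2r ?nnegrE ?mulr_ge0 ?(ltW a0) ?(ltW r0)// ler_piMl// ltW.
by apply/andP; split; lra.
Qed.

Let V0 : 0 < fine (mu C).
Proof.
by apply: lt_le_trans star_cylinder_ge; rewrite mulr_gt0 ?pvol_gt0// exprn_gt0.
Qed.

Lemma cmass_gt0 : 0 < W.
Proof.
have W0 : 0 <= W by apply: fine_ge0; exact: integral_ge0.
rewrite lt_neqAle W0 andbT eq_sym; apply/eqP => h.
have h1 : (\int[mu]_(z in C) (w z)%:E <= W%:E)%E by rewrite cmassE.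
have h2 : (\int[mu]_(z in C) dual_weight p w z <= (dmass p w (0, 0) r)%:E)%E.
  rewrite -(dmassE wAp)//; apply: ge0_subset_integral => //.
  - exact: measurable_pcube.
  - by apply: measurable_funTS; exact: measurable_dual_weight.
  - by move=> z _; exact: dual_weight_ge0.
have := measure_le_wmass_dmass hp wAp mC h1 h2.
by rewrite h mulr0 mul0r leNgt powR_gt0.
Qed.

#[local] Opaque cmass energy.

Local Notation dn := (dens Omega r Du G).
Let d0 z : 0 <= dn z. Proof. exact: dens_ge0. Qed.
Let md : measurable_fun setT dn. Proof. exact: (measurable_dens star mDu mG). Qed.

Let dnX : (\int[mu]_z (dn z `^ p * w z)%:E <= X%:E)%E.
Proof.
rewrite -energyE [in leRHS]integral_mkcond le_eqVlt; apply/orP; left; apply/eqP.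
apply: eq_integral => z _; rewrite /dens !patchE; case: ifP => // _.
by rewrite powR0 ?mul0r// gt_eqF.
Qed.

Let dens_loc rho (z : T) : 0 < rho ->
  (\int[mu]_(zeta in pcube rho z) (dn zeta)%:E = (cube_mass dn rho z)%:E)%E.
Proof. by move=> rho0; exact: (cube_massP hp wAp wA md d0 dnX z rho0).1. Qed.

Local Notation st := (scale_term Omega r e M Du G).
Local Notation K := (@mass_const R n e M).
Let K0 : 0 <= K. Proof. exact: (mass_const_ge0 e0 ea a1 M1). Qed.

Local Notation Theta := (r `^ Q * (X / W) `^ (k - 1) * X).

Definition level_const : R :=
  K `^ Q * (2 `^ p * A) `^ k * (2 `^ p * A) `^ (k - 1) * @doubling_const R n p A.

Lemma integral_scale_term_le j :
  (\int[mu]_(z in C) (st j z `^ Q * w z)%:E <= (level_const * Theta * gam ^+ j)%:E)%E.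
Proof.
set rho := 2 * (s j * r).
have sj0 : 0 < s j by rewrite exprn_gt0.
have rho0 : 0 < rho by rewrite !mulr_gt0.
have tA : 0 < 2 `^ p * A by rewrite mulr_gt0// powR_gt0.
have W0 := cmass_gt0; have X0 := energy_ge0.
pose mlow := growth ^+ j * W / (2 `^ p * A).
have ml0 : 0 < mlow by exact: (divr_gt0 (mulr_gt0 (exprn_gt0 j g0) W0) tA).
have low z : C z -> mlow <= wmass w z rho.
  move=> Cz; have r20 : 0 < 2 * r by rewrite mulr_gt0.
  have wl := wmass_lower hp A1 wAp wA e0 e2 z j r20.
  have rE : s j * (2 * r) = rho by rewrite /rho; ring.
  rewrite rE in wl; rewrite ler_pdivrMr// [leRHS]mulrC; apply: le_trans wl.
  by apply: ler_wpM2l; [exact: (ltW (exprn_gt0 j g0))|exact: cmass_le].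
have H := level_estimate hp A1 wAp wA md d0 dnX mC rho0 k1 ml0 low.
have c0 := @scale_coeff_ge0 R n r a e M r0 e0 ea a1 M1 j.
have -> : (\int[mu]_(z in C) (st j z `^ Q * w z)%:E =
    \int[mu]_(z in C) ((@scale_coeff R n r e M j `^ Q)%:E *
      (cube_mass dn rho z `^ Q * w z)%:E))%E.
  apply: eq_integral => z _; rewrite -EFinM /scale_term (powRM _ c0 (cube_mass_ge0 d0 _ _)).
  by rewrite -mulrA.
rewrite ge0_integralZl_EFin ?powR_ge0//; first last.
- by apply: mpw; apply: measurable_funTS; exact: measurable_cube_mass.
- by move=> z _; rewrite lee_fin mulr_ge0 ?powR_ge0.
apply: (@le_trans _ _ ((@scale_coeff R n r e M j `^ Q)%:E * ((2 `^ p * A * pv rho `^ p) `^ k *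
   (X / mlow) `^ (k - 1) * X * @doubling_const R n p A)%:E)%E).
  by apply: lee_wpmul2l => //; rewrite lee_fin powR_ge0.
rewrite -EFinM lee_fin le_eqVlt; apply/orP; left; apply/eqP.
have v0 := pvol_gt0 rho0 : 0 < pv rho.
have -> : (2 `^ p * A * pv rho `^ p) `^ k = (2 `^ p * A) `^ k * pv rho `^ Q.
  by rewrite (powRM _ (ltW tA) (powR_ge0 _ _)) -powRrM.
have -> : (X / mlow) `^ (k - 1) =
    (X / W) `^ (k - 1) * (2 `^ p * A) `^ (k - 1) / (growth `^ (k - 1)) ^+ j.
  have -> : X / mlow = X / W * (2 `^ p * A) * (growth ^+ j)^-1.
    have E (x y v t : R) : y != 0 -> v != 0 -> t != 0 -> x / (y * v / t) = x / v * t * y^-1.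
      by move=> yn vn tn; field; rewrite yn vn tn.
    exact (E _ _ _ _ (lt0r_neq0 (exprn_gt0 j g0)) (lt0r_neq0 W0) (lt0r_neq0 tA)).
  have gj0 := ltW (exprn_gt0 j g0).
  have xw : 0 <= X / W by exact: (divr_ge0 X0 (ltW W0)).
  rewrite (powRM _ (mulr_ge0 xw (ltW tA)) (_ : 0 <= (growth ^+ j)^-1)); last by rewrite invr_ge0.
  rewrite (powRM _ xw (ltW tA)) (powR_invl _ gj0).
  by rewrite (powR_exprn _ _ (ltW g0)).
have cp : @scale_coeff R n r e M j `^ Q * pv rho `^ Q = K `^ Q * r `^ Q * ((1 - e) `^ Q) ^+ j.
  rewrite -(powRM _ c0 (ltW v0)) (scale_coeff_pvol M r0 e0 ea a1).
  rewrite (powRM _ (mulr_ge0 K0 (ltW r0)) (ltW sj0)) (powRM _ K0 (ltW r0)).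
  by rewrite (powR_exprn _ _ (ltW k0)).
rewrite /level_const expr_div_n.
transitivity ((@scale_coeff R n r e M j `^ Q * pv rho `^ Q) * (2 `^ p * A) `^ k *
  (X / W) `^ (k - 1) * (2 `^ p * A) `^ (k - 1) / (growth `^ (k - 1)) ^+ j *
    X * @doubling_const R n p A); first by ring.
by rewrite cp; ring.
Qed.

Lemma level_const_ge0 : 0 <= level_const.
Proof.
have A0' := ltW A0; have tA : 0 <= 2 `^ p * A by exact (mulr_ge0 (powR_ge0 _ _) A0').
rewrite /level_const; apply: mulr_ge0.
  by rewrite !mulr_ge0 ?powR_ge0.
exact (mulr_ge0 tA (powR_ge0 _ _)).
Qed.

#[local] Opaque level_const.

Local Notation h := (Num.sqrt gam).
Local Notation m := (h `^ Q^-1).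

Let h0 : 0 < h. Proof. by rewrite sqrtr_gt0. Qed.
Let h1 : h < 1.
Proof.
apply: (@lt_le_trans _ _ (Num.sqrt 1)); last by rewrite sqrtr1.
by rewrite ltr_sqrt.
Qed.
Let m0 : 0 < m. Proof. exact: powR_gt0. Qed.
Let mQ : m `^ Q = h. Proof. by rewrite -powRrM mulVf ?gt_eqF// powRr1// ltW. Qed.
Let m1 : m < 1.
Proof.
apply: (@lt_le_trans _ _ (1 `^ Q^-1)); last by rewrite powR1.
by apply: gt0_ltr_powR; rewrite ?nnegrE ?invr_gt0 ?(ltW h0).
Qed.

Local Notation Acst := (avg Omega u e r 1 (0, 0)).
Local Notation F := (cube_mass dn r (0, 0)).

Let dF : (\int[mu]_z (dn z)%:E <= F%:E)%E.
Proof.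
rewrite -dens_loc// [in leRHS]integral_mkcond le_eqVlt; apply/orP; left; apply/eqP.
apply: eq_integral => z _; rewrite patchE; case: ifPn => // /negP nz.
rewrite /dens patchE; case: ifPn => // zC; case: nz.
by rewrite inE; apply: C_sub; rewrite inE in zC.
Qed.

Let S (z : T) : \bar R := (\sum_(j <oo) (st j z)%:E)%E.

Let st0 j z : 0 <= st j z. Proof. exact: (scale_term_ge0 Omega Du G r0 e0 ea a1 M1). Qed.

Let mst j : measurable_fun setT (st j). Proof. exact: (measurable_scale_term e M star mDu mG). Qed.

Let mS : measurable_fun C S.
Proof.
apply: ge0_emeasurable_sum => [j z _ _|j _]; first by rewrite lee_fin.
by apply/measurable_EFinP; exact: measurable_funTS.
Qed.

Let S_le : (\int[mu]_(z in C) S z <= (K / e * r * F)%:E)%E.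
Proof. exact: (integral_scale_sum r0 e0 ea a1 star M1 mDu mG dens_loc dF). Qed.

Let step j (z : T) : C z ->
  `|avg Omega u e r (s j.+1) z - avg Omega u e r (s j) z| <= st j z.
Proof.
exact: (avg_step_dens r0 e0 ea a1 star M1 bM dbM uW uG mDu mG dens_loc).
Qed.

Let ui : mu.-integrable C (EFin \o u). Proof. by case: uW. Qed.

Let avg_cvg : {ae mu, forall z : T, C z -> avg Omega u e r (s j) z @[j --> \oo] --> u z}.
Proof.
apply: (avg_cvg_ae r0 e0 ea a1 star M1 bM ui mS).
- exact: le_lt_trans S_le (ltry _).
- by move=> z _; apply: nneseries_ge0 => j _ _; rewrite lee_fin.
- move=> z j Cz.
  exact: (@telescope_boundE R (fun j => avg Omega u e r (s j) z) (st ^~ z) (fun i => step i Cz) j).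
- move=> z Cz.
  exact: (@telescope_cvg R (fun j => avg Omega u e r (s j) z) (st ^~ z) (fun i => step i Cz)).
Qed.

Let avg0 (z : T) : avg Omega u e r (s 0) z = Acst.
Proof. by rewrite expr0; exact: avg1_cst. Qed.

Let dev_pointwise (z : T) : C z -> avg Omega u e r (s j) z @[j --> \oo] --> u z ->
  ((`|u z - Acst| `^ Q * w z)%:E <= (((1 - m) `^ Q)^-1)%:E *
    \sum_(j <oo) (h^-1 ^+ j * (st j z `^ Q * w z))%:E)%E.
Proof.
move=> Cz cz.
have t0 j : 0 <= h^-1 ^+ j * (st j z `^ Q * w z).
  by apply: mulr_ge0; [rewrite exprn_ge0// invr_ge0 ltW|rewrite mulr_ge0 ?powR_ge0].
have mp : 0 < (1 - m) `^ Q by rewrite powR_gt0// subr_gt0.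
have mi : 0 < ((1 - m) `^ Q)^-1 by rewrite invr_gt0.
set t := (\sum_(j <oo) _)%E.
have tj j : ((h^-1 ^+ j * (st j z `^ Q * w z))%:E <= t)%E.
  apply: (@le_trans _ _ (\sum_(0 <= i < j.+1) (h^-1 ^+ i * (st i z `^ Q * w z))%:E)%E).
    rewrite big_nat_recr//= leeDr// sume_ge0// => i _; rewrite lee_fin; exact: t0.
  by apply: nneseries_lim_ge => i _ _; rewrite lee_fin.
have tge0 : (0 <= t)%E by apply: nneseries_ge0 => j _ _; rewrite lee_fin.
have [toy|] := eqVneq t +oo%E; first by rewrite toy gt0_muley ?leey// lte_fin.
rewrite -ltey -ge0_fin_numE// => tfin.
rewrite -(fineK tfin) -EFinM lee_fin; set b := fine t.
have b0 : 0 <= b by exact: fine_ge0.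
have [wz|wz] := eqVneq (w z) 0.
  by rewrite wz mulr0 mulr_ge0// ltW.
have wp : 0 < w z by rewrite lt_neqAle eq_sym wz w0.
have gb j : st j z `^ Q <= b / w z * (m `^ Q) ^+ j.
  rewrite mQ; have := tj j; rewrite -(fineK tfin) lee_fin -/b => H.
  rewrite mulrAC ler_pdivlMr// -ler_pdivrMr ?exprn_gt0//.
  by rewrite mulrC -exprVn.
have bw : 0 <= b / w z by rewrite divr_ge0.
have := @telescope_limit_bound R (fun j => avg Omega u e r (s j) z) (st ^~ z)
  (fun i => step i Cz) (u z) (b / w z) m Q Q0 m0 m1 bw cz gb.
rewrite avg0 => H; rewrite -ler_pdivlMr//.
have E (x y v : R) : x / y / v = v^-1 * x / y by ring.
by rewrite E in H.
Qed.

Let mdev (c : R) : measurable_fun C (fun z => `|u z - c|).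
Proof.
apply: (measurableT_comp (@normr_measurable R setT)); apply: measurable_funB => //.
by apply/measurable_EFinP; exact: measurable_int ui.
Qed.

Definition deviation_const : R := level_const / (1 - h) / (1 - m) `^ Q.

Lemma deviation_le :
  (\int[mu]_(z in C) (`|u z - Acst| `^ Q * w z)%:E <= (deviation_const * Theta)%:E)%E.
Proof.
have mi : 0 < ((1 - m) `^ Q)^-1 by rewrite invr_gt0 powR_gt0// subr_gt0.
have hj j : 0 <= h^-1 ^+ j by rewrite exprn_ge0// invr_ge0 ltW.
have t0 j z : 0 <= h^-1 ^+ j * (st j z `^ Q * w z).
  by apply: mulr_ge0 => //; rewrite mulr_ge0 ?powR_ge0.
have mt j : measurable_fun C (fun z => (h^-1 ^+ j * (st j z `^ Q * w z))%:E).
  apply/measurable_EFinP; apply: measurable_funM => //.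
  by apply/measurable_EFinP; apply: mpw; exact: measurable_funTS.
have msum : measurable_fun C (fun z => \sum_(j <oo) (h^-1 ^+ j * (st j z `^ Q * w z))%:E)%E.
  by apply: ge0_emeasurable_sum => [j z _ _|j _] //; rewrite lee_fin.
have sum0 z : (0 <= \sum_(j <oo) (h^-1 ^+ j * (st j z `^ Q * w z))%:E)%E.
  by apply: nneseries_ge0 => j _ _; rewrite lee_fin.
apply: (@le_trans _ _ (\int[mu]_(z in C) ((((1 - m) `^ Q)^-1)%:E *
    \sum_(j <oo) (h^-1 ^+ j * (st j z `^ Q * w z))%:E))%E).
  apply: ae_ge0_le_integral => //.
  - by move=> z _; rewrite lee_fin mulr_ge0 ?powR_ge0.
  - exact: mpw (mdev _).
  - by move=> z _; apply: mule_ge0; rewrite // lee_fin ltW.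
  - exact: measurable_funeM.
  - apply: filterS avg_cvg => z H Cz; exact: dev_pointwise Cz (H Cz).
rewrite ge0_integralZl_EFin//; last exact: ltW.
rewrite integral_nneseries//; last by move=> j z _; rewrite lee_fin.
have -> : deviation_const * Theta = ((1 - m) `^ Q)^-1 * ((level_const * Theta) / (1 - h)).
  by rewrite /deviation_const; ring.
rewrite EFinM; apply: lee_wpmul2l; first by rewrite lee_fin ltW.
have LT0 : 0 <= level_const * Theta.
  apply: mulr_ge0; first exact: level_const_ge0.
  by rewrite !mulr_ge0 ?powR_ge0// energy_ge0.
apply: le_trans (geometric_eseries_le LT0 (ltW h0) h1).
apply: lee_nneseries => [j _ _|j _].
  by apply: integral_ge0 => z _; rewrite lee_fin.
have -> : (\int[mu]_(z in C) (h^-1 ^+ j * (st j z `^ Q * w z))%:E =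
   (h^-1 ^+ j)%:E * \int[mu]_(z in C) (st j z `^ Q * w z)%:E)%E.
  rewrite -ge0_integralZl_EFin//.
    by move=> z _; rewrite lee_fin mulr_ge0 ?powR_ge0.
  by apply: mpw; exact: measurable_funTS.
apply: (@le_trans _ _ ((h^-1 ^+ j)%:E * (level_const * Theta * gam ^+ j)%:E)%E).
  by apply: lee_wpmul2l; [rewrite lee_fin|exact: integral_scale_term_le].
rewrite -EFinM lee_fin mulrCA ler_wpM2l//.
have E (x y : R) : 0 < y -> x = y ^+ 2 -> y^-1 ^+ j * x ^+ j = y ^+ j.
  by move=> y0 ->; rewrite -exprMn; congr (_ ^+ _); field; exact: lt0r_neq0.
by rewrite (E _ _ h0 (esym (sqr_sqrtr (ltW gam0)))).
Qed.

Lemma deviation_const_ge0 : 0 <= deviation_const.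
Proof.
have hh : 0 <= 1 - h by rewrite subr_ge0 ltW.
exact (divr_ge0 (divr_ge0 level_const_ge0 hh) (powR_ge0 _ _)).
Qed.

#[local] Opaque deviation_const avg.

Let integral_dev_le : (\int[mu]_(z in C) `|u z - Acst|%:E <= (K / e * r * F)%:E)%E.
Proof.
apply: le_trans S_le; apply: ae_ge0_le_integral => //.
- by apply/measurable_EFinP; exact: mdev.
- by move=> z _; apply: nneseries_ge0 => j _ _; rewrite lee_fin.
apply: filterS avg_cvg => z H Cz; have cz := H Cz.
have [->|] := eqVneq (S z) +oo%E; first exact: leey.
have S0 : (0 <= S z)%E by apply: nneseries_ge0 => j _ _; rewrite lee_fin.
rewrite -ltey -ge0_fin_numE// => Sfin.
rewrite -(fineK Sfin) lee_fin.
have c1 : `|avg Omega u e r (s j) z - Acst| @[j --> \oo] --> `|u z - Acst|.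
  by apply: cvg_norm; apply: cvgB => //; exact: cvg_cst.
apply: (cvgr_to_le c1); apply: nearW => j; rewrite -lee_fin fineK// -(avg0 z).
exact: (@telescope_boundE R (fun j => avg Omega u e r (s j) z) (st ^~ z) (fun i => step i Cz) j).
Qed.

Let F0 : 0 <= F. Proof. exact: cube_mass_ge0. Qed.

Let Fp_le : F `^ p <= 2 `^ p * A * pv r `^ p * (X / W).
Proof.
apply: le_trans (cube_mass_powR_le hp A1 wAp wA md d0 dnX (0, 0) r0) _.
have tA : 0 <= 2 `^ p * A by exact (mulr_ge0 (powR_ge0 _ _) (ltW A0)).
apply: (ler_wpM2l (mulr_ge0 tA (powR_ge0 _ _))).
apply: (ler_wpM2l energy_ge0).
by rewrite lef_pV2 ?posrE ?cmass_gt0 ?(wmass_gt0 hp wAp)// cmass_le_center.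
Qed.

Definition mean_const : R := (K / e / a ^+ n.+2) `^ p * (2 `^ p * A).

Let ratio_ge0 : 0 <= X / W.
Proof. exact (divr_ge0 energy_ge0 (ltW cmass_gt0)). Qed.

Lemma mean_deviation_le :
  `|mean C u - Acst| `^ p <= mean_const * (r `^ p * (X / W)).
Proof.
have v0 : 0 < pv r by exact: pvol_gt0.
have aN : 0 < a ^+ n.+2 by exact: exprn_gt0.
have Ke : 0 <= K / e by exact (divr_ge0 K0 (ltW e0)).
pose V := fine (mu C); have V0' : 0 < V by exact: V0.
have VE : mu C = V%:E by exact: muE.
have Vge : a ^+ n.+2 * pv r <= V by exact: star_cylinder_ge.
have Ai : mu.-integrable C (fun=> Acst%:E).
  apply/integrableP; split; first exact: measurable_cst.
  by rewrite integral_cst// lte_mul_pinfty// (star_cylinder_lty r0 star).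
have iE : (\int[mu]_(z in C) (u z - Acst)%:E)%E = ((mean C u - Acst) * V)%:E.
  have -> : (\int[mu]_(z in C) (u z - Acst)%:E =
      \int[mu]_(z in C) (u z)%:E - \int[mu]_(z in C) (Acst)%:E)%E.
    by rewrite -(integralB mC ui Ai).
  have ufin := integrable_fin_num mC ui.
  rewrite integral_cst// VE -EFinM -(fineK ufin) -EFinB.
  f_equal; rewrite mulrBl /mean; f_equal.
  exact (esym (etrans (mulrC _ _) (mulVKf (lt0r_neq0 V0') _))).
have h3 : `|mean C u - Acst| * V <= K / e * r * F.
  rewrite -[V in leLHS]gtr0_norm// -normrM -lee_fin.
  apply: le_trans integral_dev_le.
  have -> : (`|(mean C u - Acst) * V|%:E = `|\int[mu]_(z in C) (u z - Acst)%:E|)%E.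
    by rewrite iE.
  apply: le_trans (le_abse_integral _ mC _) _; last exact: lexx.
  apply/measurable_EFinP; apply: measurable_funB => //.
  by apply/measurable_EFinP; exact: measurable_int ui.
have h4 : `|mean C u - Acst| <= K / e / a ^+ n.+2 * r * (F / pv r).
  have -> : K / e / a ^+ n.+2 * r * (F / pv r) = (K / e * r * F) / (a ^+ n.+2 * pv r).
    have E (x b c y v : R) : b != 0 -> v != 0 -> x / b * c * (y / v) = (x * c * y) / (b * v).
      by move=> bn vn; field; rewrite bn vn.
    exact (E _ _ _ _ _ (lt0r_neq0 aN) (lt0r_neq0 v0)).
  rewrite (ler_pdivlMr _ _ (mulr_gt0 aN v0)).
  exact (le_trans (ler_wpM2l (normr_ge0 _) Vge) h3).
have c0 : 0 <= K / e / a ^+ n.+2 by exact (divr_ge0 Ke (ltW aN)).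
have f0 : 0 <= F / pv r by exact (divr_ge0 F0 (ltW v0)).
apply: (@le_trans _ _ ((K / e / a ^+ n.+2 * r * (F / pv r)) `^ p)).
  apply: (ge0_ler_powR (ltW p0)) => //; rewrite nnegrE//.
  exact (mulr_ge0 (mulr_ge0 c0 (ltW r0)) f0).
rewrite (powRM _ (mulr_ge0 c0 (ltW r0)) f0) (powRM _ c0 (ltW r0)).
have h5 : (F / pv r) `^ p <= 2 `^ p * A * (X / W).
  have vi : 0 <= (pv r)^-1 by rewrite invr_ge0 ltW.
  rewrite (powRM _ F0 vi) (powR_invl _ (ltW v0)) ler_pdivrMr ?powR_gt0//.
  by rewrite mulrAC; exact: Fp_le.
have -> : mean_const * (r `^ p * (X / W)) =
    (K / e / a ^+ n.+2) `^ p * r `^ p * (2 `^ p * A * (X / W)).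
  by rewrite /mean_const; ring.
exact (ler_wpM2l (mulr_ge0 (powR_ge0 _ _) (powR_ge0 _ _)) h5).
Qed.

Lemma mean_const_ge0 : 0 <= mean_const.
Proof. exact (mulr_ge0 (powR_ge0 _ _) (mulr_ge0 (powR_ge0 _ _) (ltW A0))). Qed.

#[local] Opaque mean_const mean.

Definition oscillation_const : R := 2 `^ Q * (deviation_const + mean_const `^ k).

Let powQ_split_le (v : T -> R) (c L : R) : measurable_fun C v ->
  (forall z, C z -> 0 <= v z) -> 0 <= c ->
  (\int[mu]_(z in C) (v z `^ Q * w z)%:E <= L%:E)%E ->
  (\int[mu]_(z in C) ((v z + c) `^ Q * w z)%:E <= (2 `^ Q * (L + c `^ Q * W))%:E)%E.
Proof.
move=> mv v0 c0 vL.
have mvc : measurable_fun C (fun z => v z + c) by apply: measurable_funD.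
have vq0 z : C z -> (0 <= (v z `^ Q * w z)%:E)%E by move=> _; rewrite lee_fin mulr_ge0 ?powR_ge0.
apply: (@le_trans _ _ (\int[mu]_(z in C) ((2 `^ Q)%:E *
    ((v z `^ Q * w z)%:E + (c `^ Q)%:E * (w z)%:E)))%E).
  apply: ge0_le_integral => //.
  - by move=> z _; rewrite lee_fin mulr_ge0 ?powR_ge0.
  - exact: mpw.
  - apply: measurable_funeM; apply: emeasurable_funD; first exact: mpw.
    by apply: measurable_funeM; exact/measurable_EFinP.
  - move=> z Cz; rewrite -!(EFinM, EFinD) lee_fin -mulrDl mulrA ler_wpM2r//.
    by apply: powRD_le; [exact: ltW|exact: v0|].
have cw0 z : C z -> (0 <= (c `^ Q)%:E * (w z)%:E)%E.
  by move=> _; apply: mule_ge0; rewrite lee_fin ?powR_ge0.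
have mcw : measurable_fun C (fun z => (c `^ Q)%:E * (w z)%:E)%E.
  by apply: measurable_funeM; exact/measurable_EFinP.
rewrite ge0_integralZl_EFin ?powR_ge0//; first last.
- by apply: emeasurable_funD => //; exact: mpw.
- by move=> z Cz; apply: adde_ge0; [exact: vq0|exact: cw0].
rewrite EFinM; apply: lee_wpmul2l; first by rewrite lee_fin powR_ge0.
rewrite ge0_integralD//; last exact: mpw.
rewrite EFinD; apply: leeD => //.
rewrite ge0_integralZl_EFin ?powR_ge0//; last exact/measurable_EFinP.
by rewrite cmassE EFinM.
Qed.

Let Theta_split : (r `^ p * (X / W)) `^ k * W = Theta.
Proof.
have kn : k != 0 by rewrite gt_eqF//; have := k1; lra.
rewrite (powRM _ (powR_ge0 _ _) ratio_ge0) -powRrM (powR_pred0 kn ratio_ge0).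
have E (t v x y : R) : y != 0 -> t * (v * (x / y)) * y = t * v * x.
  by move=> yn; field.
exact (E _ _ _ _ (lt0r_neq0 cmass_gt0)).
Qed.

Lemma oscillation_le :
  (\int[mu]_(z in C) (`|u z - mean C u| `^ Q * w z)%:E <= (oscillation_const * Theta)%:E)%E.
Proof.
pose c := `|mean C u - Acst|.
have c0 : 0 <= c by exact: normr_ge0.
have H := powQ_split_le (mdev Acst) (fun z _ => normr_ge0 _) c0 deviation_le.
apply: (@le_trans _ _ (\int[mu]_(z in C) ((`|u z - Acst| + c) `^ Q * w z)%:E)%E).
  apply: ge0_le_integral => //.
  - by move=> z _; rewrite lee_fin mulr_ge0 ?powR_ge0.
  - exact: mpw (mdev _).
  - by apply: mpw; apply: measurable_funD => //; exact: mdev.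
  - move=> z _; rewrite lee_fin ler_wpM2r//.
    apply: (ge0_ler_powR (ltW Q0)); rewrite ?nnegrE ?addr_ge0//.
    have tri (x y v : R) : `|x - y| <= `|x - v| + `|y - v|.
      by have -> : x - y = (x - v) - (y - v); [ring|exact: ler_normB].
    exact: tri.
apply: (le_trans H); rewrite lee_fin /oscillation_const -[leRHS]mulrA.
apply: (ler_wpM2l (powR_ge0 _ _)); rewrite mulrDl; apply: lerD => //.
have mc0 := mean_const_ge0.
have rx0 : 0 <= r `^ p * (X / W) by exact (mulr_ge0 (powR_ge0 _ _) ratio_ge0).
rewrite -Theta_split mulrA -(powRM _ mc0 rx0) powRrM.
apply: (ler_wpM2r (ltW cmass_gt0)).
apply: ge0_ler_powR; rewrite ?nnegrE ?powR_ge0//.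
- by have := k1; lra.
- exact: (mulr_ge0 mc0 rx0).
- exact: mean_deviation_le.
Qed.

Lemma Lpw_star : Lpw Q w C u.
Proof.
have mu_ : measurable_fun C u by apply/measurable_EFinP; exact: measurable_int ui.
split; first exact: mu_.
have H := powQ_split_le (mdev (mean C u)) (fun z _ => normr_ge0 _) (normr_ge0 (mean C u))
  oscillation_le.
apply: le_lt_trans (ltry _); apply: le_trans H.
apply: ge0_le_integral => //.
- by move=> z _; rewrite lee_fin mulr_ge0 ?powR_ge0.
- by apply: mpw; exact: (measurableT_comp (@normr_measurable R setT)).
- by apply: mpw; apply: measurable_funD => //; exact: mdev.
- move=> z _; rewrite lee_fin ler_wpM2r//.
  apply: (ge0_ler_powR (ltW Q0)); rewrite ?nnegrE ?addr_ge0//.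
  by rewrite -lerBlDr; exact: lerB_dist.
Qed.

Lemma wmean_star_le :
  (wmean w C (fun z => `|u z - mean C u| `^ Q)%R `^ Q^-1 <=
   (oscillation_const `^ Q^-1)%:E * r%:E *
   wmean w C (fun z => (enorm (Du z) + enorm (G z)) `^ p)%R `^ p^-1)%E.
Proof.
have W0 := cmass_gt0; have X0 := energy_ge0.
have WE : fine (wmeasure w C) = W by [].
have i0 : (0 <= \int[mu]_(z in C) (`|u z - mean C u| `^ Q * w z)%:E)%E.
  by apply: integral_ge0 => z _; rewrite lee_fin mulr_ge0 ?powR_ge0.
have ifin : (\int[mu]_(z in C) (`|u z - mean C u| `^ Q * w z)%:E)%E \is a fin_num.
  by rewrite ge0_fin_numE//; exact: le_lt_trans oscillation_le (ltry _).
have := oscillation_le.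
rewrite /wmean WE.
have -> : (\int[mu]_(z in C) ((enorm (Du z) + enorm (G z)) `^ p * w z)%:E = X%:E)%E.
  exact: energyE.
rewrite -(fineK ifin); set J := fine _.
have J0 : 0 <= J by exact: fine_ge0.
clearbody J; rewrite lee_fin => JL.
rewrite -!EFinM lee_fin [W^-1 * X]mulrC.
have E : (Theta / W) = r `^ Q * (X / W) `^ k.
  rewrite -Theta_split mulfK ?gt_eqF// (powRM _ (powR_ge0 _ _) ratio_ge0).
  by rewrite -powRrM.
have oc0 : 0 <= oscillation_const.
  exact (mulr_ge0 (powR_ge0 _ _) (addr_ge0 deviation_const_ge0 (powR_ge0 _ _))).
have JW : W^-1 * J <= oscillation_const * (r `^ Q * (X / W) `^ k).
  by rewrite -E mulrA mulrC ler_pM2r ?invr_gt0.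
have Qi : 0 <= Q^-1 by rewrite invr_ge0 ltW.
apply: (@le_trans _ _ ((oscillation_const * (r `^ Q * (X / W) `^ k)) `^ Q^-1)).
  apply: (ge0_ler_powR Qi) JW; rewrite nnegrE.
    by rewrite mulr_ge0// invr_ge0 ltW.
  exact (mulr_ge0 oc0 (mulr_ge0 (powR_ge0 _ _) (powR_ge0 _ _))).
rewrite (powRM _ oc0 (mulr_ge0 (powR_ge0 _ _) (powR_ge0 _ _))).
rewrite (powRM _ (powR_ge0 _ _) (powR_ge0 _ _)) -!powRrM divff ?gt_eqF//.
rewrite (powRr1 (ltW r0)) mulrA.
have -> : k * Q^-1 = p^-1.
  by field; rewrite !gt_eqF//; have := k1; lra.
exact: lexx.
Qed.

End star_estimate.

#[local] Opaque wmean oscillation_const.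

Section star_examples.
Context {R : realType} {n : nat}.

Lemma near_coord (P : set R) (y : 'rV[R]_n) i : open P -> P (y ord0 i) ->
  \forall x \near y, P ((x : 'rV[R]_n) ord0 i).
Proof. by move=> oP Py; apply: (@coord_continuous R 1 n ord0 i y P); apply: open_nbhs_nbhs. Qed.

Lemma cube_star_domain (r : R) : 0 < r -> star_domain r 1 (cube r (0 : 'rV[R]_n)).
Proof.
move=> r0; split; [exact: measurable_cube| |by []|].
- rewrite openE => y yK; rewrite /interior /cube.
  have h i : \forall x \near y, `|(0 : 'rV[R]_n) ord0 i - (x : 'rV[R]_n) ord0 i| < r.
    have yi : `]-r, r[%classic (y ord0 i).
      by have := yK i; rewrite mxE sub0r normrN ltr_norml /= in_itv.
    have := near_coord (itv_open _ _) yi; apply: filterS => x /=.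
    by rewrite in_itv/= -ltr_norml mxE sub0r normrN.
  exact: (filter_forall _ h).
- move=> x y s Kx s0 s1 Ky i; have := Kx i; have := Ky i.
  rewrite mul1r !mxE !sub0r !normrN => hy hx.
  apply: (le_lt_trans (ler_normD _ _)); rewrite !normrM (gtr0_norm s0).
  have s1' : 0 <= 1 - s by lra.
  rewrite (ger0_norm s1').
  have h1 := ler_wpM2l s1' (ltW hx).
  have h2 : s * `|y ord0 i| < s * r by rewrite ltr_pM2l.
  lra.
Qed.

Lemma enorm0B (v : 'rV[R]_n) : enorm (0 - v) = enorm v.
Proof. by rewrite /enorm; under eq_bigr do rewrite !mxE sub0r sqrrN. Qed.

Lemma eball0E (r : R) (v : 'rV[R]_n) : 0 < r ->
  eball r 0 v <-> \sum_(i < n) v ord0 i ^+ 2 < r ^+ 2.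
Proof. by move=> r0; rewrite /eball /= enorm0B /enorm -{1}(gtr0_norm r0) -sqrtr_sqr ltr_sqrt// exprn_gt0.
Qed.

Lemma eball_star_domain (r : R) : (0 < n)%N -> 0 < r ->
  star_domain r n%:R^-1 (eball r (0 : 'rV[R]_n)).
Proof.
move=> n0 r0; have nR : 0 < n%:R :> R by rewrite ltr0n.
have n1 : n%:R^-1 <= 1 :> R by rewrite invf_le1// ler1n.
split.
- have -> : eball r (0 : 'rV[R]_n) = setT `&` @enorm R n @^-1` `]-oo, r[.
    by rewrite setTI; apply/seteqP; split => v; rewrite /eball /= enorm0B in_itv.
  exact: measurable_enorm.
- have c : continuous (fun v : 'rV[R]_n => \sum_(i < n) v ord0 i ^+ 2).
    apply: continuous_big => [|i _ v]; first exact: add_continuous.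
    have cc := @coord_continuous R 1 n ord0 i v.
    exact (cvgM cc cc).
  have -> : eball r (0 : 'rV[R]_n) =
      (fun v : 'rV[R]_n => \sum_(i < n) v ord0 i ^+ 2) @^-1` [set t | t < r ^+ 2].
    by apply/seteqP; split => v /=; rewrite eball0E.
  by apply: open_comp => [v _|]; [exact: c|exact: open_lt].
- move=> v bv i; rewrite mxE; apply: le_lt_trans bv.
  have := normr_coord_le_enorm (0 - v) i.
  by rewrite !mxE.
- move=> x y s /(eball0E _ r0) Bx s0 s1 Ky; apply/(eball0E _ r0).
  have s1' : 0 <= 1 - s by lra.
  have By : \sum_(i < n) y ord0 i ^+ 2 < r ^+ 2.
    apply: (@lt_le_trans _ _ (\sum_(i < n) (n%:R^-1 * r ^+ 2))); last first.
      by rewrite sumr_const card_ord -mulrnAl -[_ *+ n]mulr_natl divff ?mul1r// gt_eqF.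
    have i0 := Ordinal n0.
    apply: ltr_sum => [|i _]; first by apply/hasP; exists i0; rewrite // mem_index_enum.
    have := Ky i; rewrite mxE sub0r normrN => h.
    have q0 : 0 <= n%:R^-1 * r by rewrite mulr_ge0 ?invr_ge0 ?ltW.
    have : y ord0 i ^+ 2 < (n%:R^-1 * r) ^+ 2.
      by rewrite -real_normK ?num_real// ltrXn2r.
    move/lt_le_trans; apply; rewrite exprMn ler_wpM2r ?sqr_ge0//.
    by rewrite expr2 ler_piMr// invr_ge0 ltW.
  apply: (@le_lt_trans _ _ (\sum_(i < n) ((1 - s) * x ord0 i ^+ 2 + s * y ord0 i ^+ 2))).
    apply: ler_sum => i _; rewrite !mxE -subr_ge0.
    have -> : (1 - s) * x ord0 i ^+ 2 + s * y ord0 i ^+ 2 -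
      ((1 - s) * x ord0 i + s * y ord0 i) ^+ 2 =
      (1 - s) * s * (x ord0 i - y ord0 i) ^+ 2 by ring.
    exact (mulr_ge0 (mulr_ge0 s1' (ltW s0)) (sqr_ge0 _)).
  rewrite big_split/= -!mulr_sumr.
  have h1 := ler_wpM2l s1' (ltW Bx).
  have h2 : s * (\sum_(i < n) y ord0 i ^+ 2) < s * r ^+ 2 by rewrite ltr_pM2l.
  lra.
Qed.

End star_examples.

Lemma star_theorem {R : realType} (n : nat) (p a A : R) : 1 < p -> 0 < a -> a <= 1 ->
  exists delta c : R, [/\ 0 < delta, 0 < c &
    let k := (n%:R + 2) / (n%:R + 1) + delta in
    1 < k /\
    forall w : 'rV[R]_n * R -> R, Ap_weight p w -> Ap_const p w = A%:E ->
    forall (r : R) (Omega : set 'rV[R]_n), 0 < r -> star_domain r a Omega -> Omega 0 ->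
    forall (u : 'rV[R]_n * R -> R) (Du G : 'rV[R]_n * R -> 'rV[R]_n),
      let C := Omega `*` time_itv r 0 in
      L1W11 Omega (time_itv r 0) u Du -> Lpw_vec p w C Du ->
      distributional_solution Omega (time_itv r 0) u G -> Lpw_vec p w C G ->
      Lpw (p * k) w C u /\
      (wmean w C (fun z => `|u z - mean C u| `^ (p * k))%R `^ (p * k)^-1%R
       <= c%:E * r%:E *
          wmean w C (fun z => (enorm (Du z) + enorm (G z)) `^ p)%R `^ p^-1)%E].
Proof.
move=> hp a0 a1; have [M M1 MB] := @bump_bounded R.
pose e := a / 8; pose A' := Num.max A 1.
have A1 : 1 <= A' by rewrite le_max lexx orbT.
have e0 : 0 < e by rewrite divr_gt0.
have ea : 8 * e <= a by rewrite /e; lra.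
have e2 : 2 * e <= 1 by rewrite /e; lra.
have /andP[q0 q1] := dual_decay_itv hp A1 e0 e2.
have k0 : 0 < 1 - e by lra.
have k1 : 1 - e < 1 by lra.
have [delta d0 [hk hg]] := exponent_gain n hp k0 k1 q0 q1.
set k := (n%:R + 2) / (n%:R + 1) + delta in hk hg *.
exists delta, (@oscillation_const R n a e M p A' k `^ (p * k)^-1 + 1); split; first exact: d0.
  exact: (ltr_wpDl (powR_ge0 _ _) ltr01).
split; first exact: hk.
move=> w wAp wA r Omega r0 star Omega0 u Du G C uW LDu uG LG.
have wA' : (Ap_const p w <= A'%:E)%E by rewrite wA lee_fin le_max lexx.
have bM x : bump1 x <= M by exact: (MB x).1.
have dM x : `|'D_1 (bump1 : R^o -> R) x| <= M by exact: (MB x).2.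
have gam1 : (1 - e) `^ (p * k) / @wgrowth R n p A' e `^ (k - 1) < 1.
  by rewrite wgrowthE.
split; first exact: (Lpw_star r0 e0 ea a1 star Omega0 M1 bM dM uW uG hp A1 wAp wA' LDu LG hk gam1).
apply: (le_trans (wmean_star_le r0 e0 ea a1 star Omega0 M1 bM dM uW uG hp A1 wAp wA' LDu LG hk gam1)).
apply: lee_wpmul2r; first exact: poweR_ge0.
apply: lee_wpmul2r; first by rewrite lee_fin ltW.
by rewrite lee_fin lerDl.
Qed.

(* A is the value of the A_p constant of w: delta and c are chosen from n, p and
   A only, before w. *)
Theorem theorem3p1 (R : realType) (n : nat) (hn : (1 <= n)%N)
    (p : R) (hp : 1 < p) (A : R) :
  (exists delta c : R, [/\ 0 < delta, 0 < c &
    let k := (n%:R + 2) / (n%:R + 1) + delta in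
    1 < k /\
    forall w : 'rV[R]_n * R -> R, Ap_weight p w -> Ap_const p w = A%:E ->
    forall r : R, 0 < r ->
    let I := time_itv r 0 in
    let K := cube r 0 in
    let Q := pcube r (0, 0) in
    forall (u : 'rV[R]_n * R -> R) (Du G : 'rV[R]_n * R -> 'rV[R]_n),
      L1W11 K I u Du -> Lpw_vec p w Q Du ->
      distributional_solution K I u G -> Lpw_vec p w Q G ->
      Lpw (p * k) w Q u /\
      (wmean w Q (fun z => `|u z - mean Q u| `^ (p * k))%R `^ (p * k)^-1%R
       <= c%:E * r%:E *
          wmean w Q (fun z => (enorm (Du z) + enorm (G z)) `^ p)%R `^ p^-1)%E])
  /\
  (exists delta c : R, [/\ 0 < delta, 0 < c &
    let k := (n%:R + 2) / (n%:R + 1) + delta in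
    1 < k /\
    forall w : 'rV[R]_n * R -> R, Ap_weight p w -> Ap_const p w = A%:E ->
    forall r : R, 0 < r ->
    let I := time_itv r 0 in
    let B := eball r 0 in
    let C := pcylinder r (0, 0) in
    forall (u : 'rV[R]_n * R -> R) (Du G : 'rV[R]_n * R -> 'rV[R]_n),
      L1W11 B I u Du -> Lpw_vec p w C Du ->
      distributional_solution B I u G -> Lpw_vec p w C G ->
      Lpw (p * k) w C u /\
      (wmean w C (fun z => `|u z - mean C u| `^ (p * k))%R `^ (p * k)^-1%R
       <= c%:E * r%:E *
          wmean w C (fun z => (enorm (Du z) + enorm (G z)) `^ p)%R `^ p^-1)%E]).
Proof.
split.
  have [delta [c [d0 c0 [k1 H]]]] := star_theorem n A hp ltr01 (lexx 1).
  exists delta, c; split; [exact: d0|exact: c0|]; split; first exact: k1.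
  move=> w wAp wA r r0 I K Q u Du G.
  apply: (H w wAp wA r K r0 (cube_star_domain r0)).
  by move=> i; rewrite subrr normr0.
have nR : 0 < n%:R :> R by rewrite ltr0n.
have ni : 0 < n%:R^-1 :> R by rewrite invr_gt0.
have n1 : n%:R^-1 <= 1 :> R by rewrite invf_le1// ler1n.
have [delta [c [d0 c0 [k1 H]]]] := star_theorem n A hp ni n1.
exists delta, c; split; [exact: d0|exact: c0|]; split; first exact: k1.
move=> w wAp wA r r0 I B C u Du G.
apply: (H w wAp wA r B r0 (eball_star_domain hn r0)).
by apply/(eball0E _ r0); rewrite big1 ?exprn_gt0// => i _; rewrite mxE expr0n.
Qed.
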